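(* Let $\alpha\in(0,1)$, let $s\ge1$ be an integer, let $A\in\mathbb{R}^{s\times s}$, and let $Q:[0,\infty)\to\mathbb{R}^{s\times s}$ and $g:[0,\infty)\to\mathbb{R}^s$ be continuous. Suppose that $\sigma(A)\subset\Lambda_\alpha^s$, that $$\sup_{t\ge0}\;t^{1-\alpha}\int_0^t(t-\tau)^{\alpha-1}\,|||E_{\alpha,\alpha}((t-\tau)^{\alpha}A)\,Q(\tau)|||\,d\tau<1,$$ and that $$\sup_{t\ge0}\;t^{1-\alpha}\int_0^t(t-\tau)^{\alpha-1}\,\|E_{\alpha,\alpha}((t-\tau)^{\alpha}A)\,g(\tau)\|\,d\tau<\infty.$$ For $x_0\in\mathbb{R}^s$ let $\varphi(\cdot,x_0)$ denote the unique solution in $C_{1-\alpha}([0,\infty),\mathbb{R}^s)$ of $$D_{0+}^{\alpha}x(t)=Ax(t)+Q(t)x(t)+g(t),\quad t>0,\qquad \lim_{t\to0^+}t^{1-\alpha}x(t)=x_0.$$ Then $\varphi(\cdot,x_0)\in C_{1-\alpha}^0([0,\infty),\mathbb{R}^s)$ for every $x_0\in\mathbb{R}^s$. In particular, the equation is globally attractive, i.e. $\lim_{t\to\infty}\varphi(t,x_0)=0$ for every $x_0\in\mathbb{R}^s$.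
   Context: $\|\cdot\|$ is an arbitrary norm on $\mathbb{R}^s$ and $|||\cdot|||$ is the matrix norm on $\mathbb{R}^{s\times s}$ induced by it. $\sigma(A)$ is the set of (complex) eigenvalues of $A$, and $\Lambda_\alpha^s:=\{\lambda\in\mathbb{C}\setminus\{0\}:|\arg(\lambda)|>\frac{\alpha\pi}{2}\}$ with $\arg$ the principal argument in $(-\pi,\pi]$ (the superscript $s$ here is part of the notation). The Mittag-Leffler function is $E_{\alpha,\beta}(M):=\sum_{k=0}^\infty\frac{M^k}{\Gamma(\alpha k+\beta)}$ for a square matrix $M$. The Riemann--Liouville fractional integral of order $\beta>0$ is $I_{0+}^{\beta}x(t):=\frac{1}{\Gamma(\beta)}\int_0^t(t-\tau)^{\beta-1}x(\tau)\,d\tau$, and the Riemann--Liouville fractional derivative of order $\alpha\in(0,1)$ is $D_{0+}^{\alpha}x(t):=\frac{d}{dt}I_{0+}^{1-\alpha}x(t)$. $C_{1-\alpha}([0,\infty),\mathbb{R}^s)$ is the set of all continuous functions $x:(0,\infty)\to\mathbb{R}^s$ such that $\lim_{t\to0^+}t^{1-\alpha}x(t)$ exists, and $C_{1-\alpha}^0([0,\infty),\mathbb{R}^s)$ is the subset of those with $\sup_{t}t^{1-\alpha}\|x(t)\|<\infty$. Suprema over $t\ge0$ of expressions defined only for $t>0$ are taken over $t>0$. For continuous $Q$ and $g$, the stated initial value problem has exactly one solution in $C_{1-\alpha}([0,\infty),\mathbb{R}^s)$ for each $x_0$ (a known fact that may be used). *)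

(* Defs.v *)
From HB Require Import structures.
From mathcomp Require Import all_boot all_order all_algebra.
From mathcomp Require Import all_classical all_reals all_analysis.
From mathcomp Require Import complex.

Set Implicit Arguments.
Unset Strict Implicit.
Unset Printing Implicit Defensive.

Import Order.TTheory GRing.Theory Num.Theory.
Import numFieldNormedType.Exports.

Local Open Scope classical_set_scope.
Local Open Scope ring_scope.

Record is_norm (R : realType) (s : nat) (N : 'cV[R]_s -> R) : Prop := IsNorm {
  norm_ge0 : forall v, 0 <= N v;
  norm_eq0 : forall v, N v = 0 -> v = 0;
  normZ : forall (a : R) v, N (a *: v) = `|a| * N v;
  norm_triangle : forall u v, N (u + v) <= N u + N v
}.

Definition induced_norm (R : realType) (s : nat) (N : 'cV[R]_s -> R)
    (M : 'M[R]_s) : R :=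
  sup [set N (M *m v) | v in [set v : 'cV[R]_s | N v <= 1]].

(* Only meaningful for z != 0; the value is in ]- pi, pi]. *)
Definition Arg (R : realType) (z : R[i]) : R :=
  let r := complex.Re z / Num.sqrt (complex.Re z ^+ 2 + complex.Im z ^+ 2) in
  if 0 <= complex.Im z then acos r else - acos r.

Definition Lambda (R : realType) (alpha : R) : set R[i] :=
  [set z | z != 0 /\ alpha * pi / 2 < `|Arg z|].

Definition spectrum (R : realType) (s : nat) (A : 'M[R]_s) : set R[i] :=
  [set z | eigenvalue (map_mx (real_complex R) A) z].

(* Euler's integral; used only at x > 0, where it converges. *)
Definition Gamma (R : realType) (x : R) : R :=
  \int[lebesgue_measure]_(t in `]0, +oo[) (t `^ (x - 1) * expR (- t)).

Definition mittag_leffler (R : realType) (s : nat) (alpha beta : R)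
    (M : 'M[R]_s) : 'M[R]_s :=
  limn (series (fun k : nat => (Gamma (alpha * k%:R + beta))^-1 *: M ^+ k)).

Definition RL_integral (R : realType) (s : nat) (beta : R)
    (x : R -> 'cV[R]_s) (t : R) : 'cV[R]_s :=
  (Gamma beta)^-1 *:
    \col_i \int[lebesgue_measure]_(tau in `]0, t[)
             ((t - tau) `^ (beta - 1) * x tau i 0).

(* "the Riemann-Liouville derivative of order alpha of x exists at t and is d" *)
Definition is_RL_derivative (R : realType) (s : nat) (alpha : R)
    (x : R -> 'cV[R]_s) (t : R) (d : 'cV[R]_s) : Prop :=
  is_derive t 1 (RL_integral (1 - alpha) x) d.

(* A function on ]0, +oo[ is represented by a total function on R; only its
   values at t > 0 matter. *)
Definition C_weighted (R : realType) (s : nat) (alpha : R) :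
    set (R -> 'cV[R]_s) :=
  [set x : R -> 'cV[R]_s | {within `](0 : R), +oo[, continuous x} /\
           cvg (t `^ (1 - alpha) *: x t @[t --> 0^'+])].

Definition C_weighted_bounded (R : realType) (s : nat)
    (N : 'cV[R]_s -> R) (alpha : R) : set (R -> 'cV[R]_s) :=
  [set x : R -> 'cV[R]_s | C_weighted alpha x /\
     (ereal_sup [set (t `^ (1 - alpha) * N (x t))%:E | t in `]0%R, +oo[]
        < +oo)%E].

Definition is_solution (R : realType) (s : nat) (alpha : R) (A : 'M[R]_s)
    (Q : R -> 'M[R]_s) (g : R -> 'cV[R]_s) (x0 : 'cV[R]_s)
    (x : R -> 'cV[R]_s) : Prop :=
  [/\ C_weighted alpha x,
      forall t, 0 < t ->
        is_RL_derivative alpha x t (A *m x t + Q t *m x t + g t) &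
      t `^ (1 - alpha) *: x t @[t --> 0^'+] --> x0].

Definition globally_attractive (R : realType) (s : nat) (alpha : R)
    (A : 'M[R]_s) (Q : R -> 'M[R]_s) (g : R -> 'cV[R]_s) : Prop :=
  forall (x0 : 'cV[R]_s) (x : R -> 'cV[R]_s),
    is_solution alpha A Q g x0 x -> x t @[t --> +oo] --> (0 : 'cV[R]_s).

(* Main.v *)
Require Import Defs.
From HB Require Import structures.
From mathcomp Require Import all_boot all_order all_algebra.
From mathcomp Require Import all_classical all_reals all_analysis.
From mathcomp Require Import measurable_realfun complex ring lra.

Set Implicit Arguments.
Unset Strict Implicit.
Unset Printing Implicit Defensive.

Import Order.TTheory GRing.Theory Num.Theory.
Import numFieldNormedType.Exports.

Local Open Scope classical_set_scope.
Local Open Scope ring_scope.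

Local Notation mu := lebesgue_measure.

(* Write [e t = t^(alpha-1) E_{alpha,alpha}(t^alpha A)] and [*] for convolution on the half line.
   Integration gives [k_{1-alpha} * x = c + 1 * (A x + Q x + g)];
   convolving with [e] and using [k_{1-alpha} * e = 1 + A (1 * e)] leaves
   [1 * x = 1 * (e c + e * (Q x + g))], so [x = e c + e * (Q x + g)] a.e.

   [t^(1-alpha) e t] is bounded by an energy argument.
   A rotation of the kernel [t^(alpha-1)] is of positive type, as a superposition of
   exponentials [e^(-r (1 + i d) t)]; hence [z = lambda I^alpha z + w] with [lambda] in the
   sector controls the mean squares of [z] by those of [w].  Peeling off the eigenvalues of [A]
   down to Cayley-Hamilton extends this to [X = A I^alpha X + w], applied to
   [E_alpha(t^alpha A)] and its first two Euler derivatives.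

   For [u t = t^(1-alpha) N (x t)], splitting the convolution at 1 gives
   [u t <= K + q sup_[1,t] u] with [q < 1], since [N (x tau) <= u tau] for [tau >= 1].
   A functional norming [x t] replaces the triangle inequality for integrals. *)

(** Boundedness of [E_{alpha,alpha}(t^alpha A)] is needed in two places that the integral hypotheses
    do not reach: the free term [e c], and times in []0, 1]], where [N (x t)] may grow like
    [t^(alpha-1)] while the smallness of [Q] is measured without that weight. On []0, 1]] the factor
    [t^(1-alpha) (t - tau)^(alpha-1)] is bounded once [t >= 2], so a bounded resolvent leaves a
    constant. The energy argument stands in for contour integrals and the Jordan form. The sector
    enters only through the rotation: its angle can be anything below [(1 - alpha) pi / 2], which
    together with [|arg lambda| > alpha pi / 2] reaches the open left half plane. A multiple
    eigenvalue is peeled off as often as it occurs. Energy gives mean squares only, hence two Euler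
    derivatives: the first one equals [t^alpha A E_{alpha,alpha}(t^alpha A)], the second one turns
    the mean bound for the first into a pointwise bound. As [0] is outside the sector, [A] can then
    be divided out. *)

Section RealLine.
Context {R : realType}.
Implicit Types (a b t T : R) (f g F : R -> R).

(** * Continuity, cutting to the half line, and the fundamental theorem on intervals *)

Lemma uniform_bound (I : finType) (S : Type) (P : S -> Prop) (D : I -> S -> R) :
  (forall i, exists2 C, 0 <= C & forall s, P s -> D i s <= C) ->
  exists2 C, 0 <= C & forall i s, P s -> D i s <= C.
Proof.
move=> h; have {}h i : {C | 0 <= C & forall s, P s -> D i s <= C} by apply: cid2; exact: h.
pose B i := s2val (h i).
have B0 i : 0 <= B i by rewrite /B; case: (h i).
exists (\sum_i B i) => [|i s Ps]; first exact: sumr_ge0.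
rewrite (bigD1 i)//= -[leLHS]addr0 lerD ?sumr_ge0//.
by rewrite /B; case: (h i) => C C0 hC /=; exact: hC.
Qed.

Lemma is_derive_continuous f t d : is_derive t 1 f d -> {for t, continuous f}.
Proof. by move=> df; apply/differentiable_continuous/derivable1_diffP; apply: ex_derive. Qed.

Lemma continuous_itv_integrable f a b : (forall x, a <= x <= b -> {for x, continuous f}) ->
  mu.-integrable `[a, b] (EFin \o f).
Proof.
move=> cf; apply: continuous_compact_integrable; first exact: segment_compact.
by apply: continuous_in_subspaceT => x /set_mem /=; rewrite in_itv/=; exact: cf.
Qed.

Lemma continuous_itvoo_integrable f a b : (forall x, a <= x <= b -> {for x, continuous f}) ->
  mu.-integrable `]a, b[ (EFin \o f).
Proof.
move=> /continuous_itv_integrable.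
by apply: integrableS => // x /=; rewrite !in_itv/= => /andP[/ltW -> /ltW ->].
Qed.

Lemma integral_FTC f F a b : a < b ->
  (forall x, a <= x <= b -> {for x, continuous f}) ->
  (forall x, a <= x <= b -> is_derive x 1 F (f x)) ->
  (\int[mu]_(t in `[a, b]) (f t)%:E = (F b - F a)%:E)%E.
Proof.
move=> ab cf dF.
have oo x : x \in `]a, b[ -> a <= x <= b by rewrite in_itv/= => /andP[/ltW -> /ltW ->].
have cF x : a <= x <= b -> {for x, continuous F} by move=> /dF; exact: is_derive_continuous.
rewrite (@continuous_FTC2 R f F a b ab)//.
- by apply: continuous_in_subspaceT => x /set_mem /=; rewrite in_itv/=; exact: cf.
- split.
  + by move=> x /oo /dF[].
  + by apply: cvg_at_right_filter; apply: cF; rewrite lexx ltW.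
  + by apply: cvg_at_left_filter; apply: cF; rewrite lexx ltW.
- by move=> x /oo /dF[_]; rewrite derive1E.
Qed.

Lemma integrable_0T f T : continuous f -> mu.-integrable `]0, T[ (EFin \o f).
Proof. by move=> cf; apply: continuous_itvoo_integrable => x _; exact: cf. Qed.

Lemma continuous_funD f g : continuous f -> continuous g -> continuous (fun t => f t + g t).
Proof. by move=> cf cg t; apply: cvgD; [exact: cf|exact: cg]. Qed.

Lemma continuous_funM f g : continuous f -> continuous g -> continuous (fun t => f t * g t).
Proof. by move=> cf cg t; apply: cvgM; [exact: cf|exact: cg]. Qed.

Lemma continuous_funZ a f : continuous f -> continuous (fun t => a * f t).
Proof. by move=> cf; apply: continuous_funM => // t; exact: cvg_cst. Qed.

Lemma continuous_sqr f : continuous f -> continuous (fun t => f t ^+ 2).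
Proof. by move=> cf; exact: (continuous_funM cf cf). Qed.

Lemma Rintegral_FTC f F a b : a < b ->
  (forall x, a <= x <= b -> {for x, continuous f}) ->
  (forall x, a <= x <= b -> is_derive x 1 F (f x)) ->
  \int[mu]_(t in `]a, b[) f t = F b - F a.
Proof.
move=> ab cf dF; have I := continuous_itv_integrable cf.
rewrite Rintegral_itv_obnd_cbnd; last exact: continuous_itvoo_integrable.
rewrite Rintegral_itv_bndo_bndc; last first.
  by apply: integrableS I => // x /=; rewrite !in_itv/= => /andP[-> /ltW ->].
by rewrite /Rintegral (integral_FTC ab cf dF).
Qed.

(** The flag [b] covers both [[0, +oo[], where [Q] and [g] are continuous, and []0, +oo[], where the
    solution is. *)
Lemma within_continuous_gt0 (b : bool) (f : R -> R) t :
  {within [set` Interval (BSide b (0 : R)) +oo%O], continuous f} -> 0 < t ->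
  {for t, continuous f}.
Proof.
move=> cf t0; have : {within `](0 : R), +oo[, continuous f}.
  apply: continuous_subspaceW cf => x /=; rewrite !in_itv/= !andbT.
  by case: b => //= /ltW.
rewrite continuous_open_subspace; last exact: interval_open.
by apply; rewrite inE/= in_itv/= t0.
Qed.

(** Functions of the problem carry arbitrary values at [t <= 0]. Cutting them to []0, +oo[] discards
    these values and turns convolution over the whole line into an integral over []0, t[]. *)
Lemma measurable_cut f : (forall t : R, 0 < t -> {for t, continuous f}) ->
  measurable_fun setT (f \_ `]0, +oo[).
Proof.
move=> cf; apply/(measurable_restrictT _ _).1; first exact: measurable_itv.
apply: open_continuous_measurable_fun; first exact: interval_open.
by move=> t; rewrite inE/= in_itv/= andbT; exact: cf.
Qed.

Lemma cutE f t : 0 < t -> (f \_ `]0, +oo[) t = f t.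
Proof. by move=> t0; rewrite patchE mem_setE in_itv/= t0. Qed.

Lemma cut_le0 f t : t <= 0 -> (f \_ `]0, +oo[) t = 0.
Proof. by move=> t0; rewrite patchE mem_setE in_itv/= ltNge t0. Qed.

Lemma within_bounded f T : {within `[(0 : R), +oo[, continuous f} ->
  exists2 C, 0 <= C & forall t, 0 < t <= T -> `|f t| <= C.
Proof.
move=> cf; have [T0|T0] := leP 0 T; last first.
  by exists 0 => // t /andP[t0 tT]; lra.
have cn : {within `[0, T], continuous (fun t => `|f t|)}.
  have : {within `[0, T], continuous f}.
    by apply: continuous_subspaceW cf => x /=; rewrite !in_itv/= => /andP[->].
  by move=> cf' t; apply: cvg_norm; exact: cf'.
have [c _ hc] := EVT_max T0 cn; exists `|f c| => // t /andP[t0 tT].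
by apply: hc; rewrite in_itv/= tT ltW.
Qed.

End RealLine.

(** * Affine change of variables for Lebesgue integrals *)

Section Affine.
Context {R : realType}.

Lemma measurable_affine (a b : R) : measurable_fun setT (fun x : R => a * x + b).
Proof. by apply: measurable_funD => //; apply: measurable_funM. Qed.

Let pushforward_affine (a b : R) :
  exists nu : {measure set (measurableTypeR R) -> \bar R},
    (forall A, nu A = mu ((fun x : R => a * x + b) @^-1` A)) /\
    (forall f : R -> \bar R, measurable_fun setT f -> (forall x, 0 <= f x)%E ->
       \int[nu]_x f x = \int[mu]_x f (a * x + b)%R)%E.
Proof.
pose phi : measurableTypeR R -> measurableTypeR R := fun x : R => a * x + b.
have mphi : measurable_fun setT phi by exact: measurable_affine.
unshelve eexists.
  apply: (pushforward mu phi).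
  exact: mphi.
split; first by [].
by move=> f mf f0; rewrite ge0_integral_pushforward.
Qed.

(** Half-open intervals determine Lebesgue measure, so it suffices that [|a|] times the pushforward
    has the right value on them. A negative [a] swaps which end of the preimage is closed, without
    changing its length. *)
Lemma ge0_integral_affine (a b : R) (f : R -> \bar R) : a != 0 ->
  measurable_fun setT f -> (forall x, 0 <= f x)%E ->
  (`|a|%:E * \int[mu]_x f (a * x + b)%R = \int[mu]_x f x)%E.
Proof.
move=> a0 mf f0.
have [nu [nuE nuI]] := pushforward_affine a b.
rewrite -nuI// -(@ge0_integral_mscale _ _ _ nu setT _ (NngNum (normr_ge0 a)))//.
apply: eq_measure_integral => A mA _ /=.
apply/esym/(@lebesgue_measure_unique R (mscale (NngNum (normr_ge0 a)) nu)); last exact: mA.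
move=> _ [[l u] _ <-].
suff -> : mu `]l, u] = (`|a|%:E * mu ((fun x : R => (a * x + b)%R) @^-1` `]l, u]))%E.
  by congr (_ * _)%E; exact/esym/nuE.
have [a_gt0|a_le0] := ltP 0 a.
  have -> : ((fun x : R => a * x + b) @^-1` `]l, u]) = `](l - b) / a, (u - b) / a]%classic.
    apply/seteqP; split => x /=; rewrite !in_itv /= => /andP[h1 h2]; apply/andP; split.
    - by rewrite ltr_pdivrMr// ltrBlDr mulrC.
    - by rewrite ler_pdivlMr// lerBrDr mulrC.
    - by move: h1; rewrite ltr_pdivrMr// ltrBlDr mulrC.
    - by move: h2; rewrite ler_pdivlMr// lerBrDr mulrC.
  rewrite !lebesgue_measure_itv /= !lte_fin ltr_pM2r ?invr_gt0// ltrD2r.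
  case: ifP => _; last by rewrite mule0.
  rewrite -!EFinB -EFinM gtr0_norm//; congr EFin; field; lra.
have a_lt0 : a < 0 by rewrite lt_neqAle a0.
have -> : ((fun x : R => a * x + b) @^-1` `]l, u]) = `[(u - b) / a, (l - b) / a[%classic.
  apply/seteqP; split => x /=; rewrite !in_itv /= => /andP[h1 h2]; apply/andP; split.
  - by rewrite ler_ndivrMr// lerBrDr mulrC.
  - by rewrite ltr_ndivlMr// ltrBlDr mulrC.
  - by move: h2; rewrite ltr_ndivlMr// ltrBlDr mulrC.
  - by move: h1; rewrite ler_ndivrMr// lerBrDr mulrC.
rewrite !lebesgue_measure_itv /= !lte_fin ltr_nM2r ?invr_lt0// ltrD2r.
case: ifP => _; last by rewrite mule0.
rewrite -!EFinB -EFinM ltr0_norm//; congr EFin; field; lra.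
Qed.

(** A positive finite factor distributes even over the conventional value of [+oo - +oo]; this
    carries the change of variables from positive and negative parts to every measurable
    function. *)
Let muleB_ge0 (k : R) (x y : \bar R) : 0 < k -> (0 <= x)%E -> (0 <= y)%E ->
  (k%:E * (x - y) = k%:E * x - k%:E * y)%E.
Proof.
move=> k0; case: x => [x| |]; case: y => [y| |] //= _ _; rewrite ?gt0_muley ?gt0_muleNy ?lte_fin//.
by rewrite -!EFinM -!EFinB mulrBr.
Qed.

Lemma integral_affine (a b : R) (f : R -> \bar R) : a != 0 ->
  measurable_fun setT f ->
  (\int[mu]_x f (a * x + b)%R = `|a|^-1%:E * \int[mu]_x f x)%E.
Proof.
move=> a0.
have aux (g : R -> \bar R) : measurable_fun setT g -> (forall x, 0 <= g x)%E ->
    (\int[mu]_x g (a * x + b)%R = `|a|^-1%:E * \int[mu]_x g x)%E.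
  by move=> mg g0; rewrite -(@ge0_integral_affine a b g a0 mg g0) muleA -EFinM mulVf ?normr_eq0// mul1e.
move=> mf; rewrite integralE [in RHS]integralE.
have mp := measurable_funepos mf.
have mn := measurable_funeneg mf.
rewrite muleB_ge0 ?invr_gt0 ?normr_gt0 ?integral_ge0//.
have Hp : (_ = _ :> \bar R) := aux _ mp (fun x => funepos_ge0 _ _).
have Hn : (_ = _ :> \bar R) := aux _ mn (fun x => funeneg_ge0 _ _).
rewrite -Hp -Hn.
by congr (_ - _)%E; apply: eq_integral => x _; rewrite ?funeposE ?funenegE.
Qed.

End Affine.

(** * Power kernels and lower bounds for the Gamma function *)

Section PowerKernel.
Context {R : realType}.
Implicit Types a b t x : R.

(** The kernel [t^(b-1)] extended by [0]. It vanishes at [0] as well, so [pk 1] is the indicator of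
    []0, +oo[], the [1] of the overview. *)
Definition pk b t : R := if 0 < t then t `^ (b - 1) else 0.

Lemma pk_gt0 b t : 0 < t -> pk b t = t `^ (b - 1).
Proof. by rewrite /pk => ->. Qed.

Lemma pk_le0 b t : t <= 0 -> pk b t = 0.
Proof. by rewrite /pk leNgt => /negbTE ->. Qed.

Lemma pk_ge0 b t : 0 <= pk b t.
Proof. by rewrite /pk; case: ifP => // _; exact: powR_ge0. Qed.

Lemma measurable_pk b : measurable_fun setT (pk b).
Proof.
apply: measurable_fun_if => //.
- by apply: measurable_fun_ltr.
- by apply: measurable_funTS; exact: measurable_powR.
Qed.

Lemma continuous_powR_gt0 t (p : R) : 0 < t -> {for t, continuous (fun t : R => t `^ p)}.
Proof.
by move=> t0; apply/differentiable_continuous/derivable1_diffP; have [] := is_derive1_powR p t0.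
Qed.

Lemma integral_powR_itv a (e : R) : 0 < a -> 0 < e -> e < 1 ->
  (\int[mu]_(t in `[e, 1%R]) (t `^ (a - 1))%:E = (a^-1 - a^-1 * e `^ a)%:E)%E.
Proof.
move=> a0 e0 e1.
have dF t : 0 < t -> is_derive t 1 (fun t : R => a^-1 * t `^ a) (t `^ (a - 1)).
  move=> t0; have := is_deriveZ a^-1 (is_derive1_powR a t0).
  by rewrite /GRing.scale/= mulrA mulVf ?gt_eqF// mul1r.
have p0 x : e <= x <= 1 -> 0 < x by move=> /andP[ex _]; exact: lt_le_trans ex.
rewrite (integral_FTC e1 (fun x xe => @continuous_powR_gt0 x (a - 1) (p0 x xe))
  (fun x xe => dF x (p0 x xe))).
by rewrite powR1 mulr1.
Qed.

Lemma integral_powR01 a : 0 < a ->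
  (\int[mu]_(t in `]0%R, 1%R]) (t `^ (a - 1))%:E = (a^-1)%:E)%E.
Proof.
(* Monotone convergence along intervals that avoid the singularity at [0]. The offset [2] keeps the
   left end strictly below [1]. *)
move=> a0.
pose F n : set (measurableTypeR R) := `[n.+2%:R^-1, 1]%classic.
have FE : \bigcup_n F n = `]0, 1]%classic.
  apply/seteqP; split => t /=.
    move=> [n _]; rewrite /F /= in_itv/= => /andP[h h1]; rewrite in_itv/= h1 andbT.
    by apply: lt_le_trans h; rewrite invr_gt0.
  rewrite in_itv/= => /andP[t0 t1]; exists (Num.truncn t^-1) => //=.
  rewrite /F /= in_itv/= t1 andbT invf_ple ?posrE//.
  rewrite ltW// (lt_trans (truncnS_gt _))// ltr_nat//.
have ndF : nondecreasing_seq F.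
  move=> m n mn; rewrite subsetEset => t; rewrite /F /= !in_itv/= => /andP[h h1].
  by rewrite h1 andbT (le_trans _ h)// lef_pV2 ?posrE// ler_nat !ltnS.
have mF i : measurable (F i) by exact: measurable_itv.
have := @ge0_nondecreasing_set_cvg_integral _ _ R F (fun t => (t `^ (a - 1))%:E) mu ndF mF.
rewrite FE => H; apply: (@cvg_unique _ (@ereal_hausdorff R) _ _ _ _ (H _ _)).
- by move=> i; apply: measurable_funTS; apply/measurable_EFinP; exact: measurable_powR.
- by move=> i t _; rewrite lee_fin powR_ge0.
- rewrite (_ : (fun i => _) = (fun i : nat => (a^-1 - a^-1 * (i.+2%:R^-1) `^ a)%:E)); last first.
    apply/funext => i; apply: integral_powR_itv => //.
    by rewrite invf_lt1// ltr1n.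
  apply: cvg_EFin; first by near=> n.
  rewrite -[X in _ --> X]subr0; apply: cvgB; first exact: cvg_cst.
  rewrite -[X in _ --> X](mulr0 a^-1); apply: cvgM; first exact: cvg_cst.
  have := @cvg_at_rightP R (fun t => t `^ a) 0 0.
  move=> [/(_ (powR_cvg0 a0)) h _]; apply: (h (fun n : nat => n.+2%:R^-1)).
  split; first by move=> n; rewrite invr_gt0.
  by have := @cvg_harmonic R; rewrite -(cvg_shiftS).
Unshelve. all: by end_near.
Qed.

Definition gamma_kernel a t : R := pk a t * expR (- t).

Lemma measurable_gamma_kernel a : measurable_fun setT (gamma_kernel a).
Proof.
apply: measurable_funM; first exact: measurable_pk.
by apply: measurableT_comp => //; exact: measurable_expR.
Qed.

Lemma gamma_kernel_ge0 a t : 0 <= gamma_kernel a t.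
Proof. by rewrite mulr_ge0 ?pk_ge0// expR_ge0. Qed.

Lemma pk_le_expR a : exists2 C, 0 <= C & forall t, 1 <= t -> pk a t <= C * expR (t / 2).
Proof.
(* The bound is [m] times [ln y <= y] at [y = e * t]. The choice of [e] makes [m * (e * t)] equal to
   [t / 2], and the [+ 1] keeps [m] positive. *)
pose m := `|a - 1| + 1; have m0 : 0 < m by rewrite ltr_wpDl.
pose e := (2 * m)^-1; have e0 : 0 < e by rewrite invr_gt0 mulr_gt0.
exists (expR (- (m * ln e))); first exact: expR_ge0.
move=> t t1; have t0 : 0 < t by apply: lt_le_trans t1.
rewrite pk_gt0// /powR gt_eqF// -expRD ler_expR.
have lt0 : 0 <= ln t by rewrite ln_ge0.
apply: (@le_trans _ _ (m * ln t)).
  by rewrite ler_wpM2r// (le_trans (ler_norm _))// lerDl.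
have H : ln e + ln t <= e * t.
  rewrite -lnM ?posrE//; have := @le_ln1Dx R (e * t - 1).
  rewrite addrCA subrr addr0 => h; have et0 : 0 < e * t by exact: mulr_gt0.
  by apply: le_trans (h _) _; lra.
have -> : t / 2 = m * (e * t) by rewrite /e; field; rewrite gt_eqF.
by rewrite -mulrN -mulrDr ler_pM2l//; lra.
Qed.

Lemma integrable_patch (D : set R) (f : R -> R) : measurable D ->
  mu.-integrable D (EFin \o f) -> mu.-integrable setT (EFin \o (f \_ D)).
Proof. by move=> mD hf; rewrite -restrict_EFin; have := (integrable_mkcond (mu := mu) (EFin \o f) mD).1 hf. Qed.

Let integrable_exp : mu.-integrable setT (EFin \o (fun t : R => if 0 <= t then expR (- (t / 2)) else 0)).
Proof.
have := @integrable_exponential_pdf R 2^-1 ltac:(by rewrite invr_gt0).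
move=> /(integrableZl measurableT 2); apply: eq_integrable => // t _ /=.
rewrite /exponential_pdf patchE; case: ifPn => [|].
  rewrite inE/= in_itv/= andbT => t0; rewrite t0.
  by rewrite -EFinM mulrA mulfV// mul1r [in RHS]mulrC mulNr.
rewrite notin_setE/= in_itv/= andbT => /negP/negbTE ->; rewrite mule0//.
Qed.

Let integrable_pk01 a : 0 < a -> mu.-integrable setT (EFin \o (pk a \_ `]0, 1])).
Proof.
move=> a0; apply: integrable_patch => //; apply/integrableP; split.
  by apply/measurable_EFinP/measurable_funTS; exact: measurable_pk.
rewrite (_ : (\int[mu]_(x in _) _)%E = (\int[mu]_(t in `]0%R, 1%R]) (t `^ (a - 1))%:E)%E).
  by rewrite integral_powR01// ltry.
apply: eq_integral => t; rewrite inE/= in_itv/= => /andP[t0 _].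
by rewrite ger0_norm ?pk_ge0// pk_gt0.
Qed.

Lemma integrable_gamma_kernel a : 0 < a ->
  mu.-integrable setT (EFin \o gamma_kernel a).
Proof.
move=> a0; have [C C0 HC] := pk_le_expR a.
have := integrableD measurableT (integrable_pk01 a0)
  (integrableZl measurableT C integrable_exp).
apply: le_integrable => //; first by apply/measurable_EFinP; exact: measurable_gamma_kernel.
move=> t _ /=; rewrite -?EFinM -?EFinD !lee_fin ger0_norm ?gamma_kernel_ge0//.
have h0 : 0 <= (pk a \_ `]0, 1]) t.
  by rewrite patchE; case: ifP => // _; exact: pk_ge0.
have h1 : 0 <= C * (if 0 <= t then expR (- (t / 2)) else 0).
  by rewrite mulr_ge0//; case: ifP => // _; exact: expR_ge0.
rewrite ger0_norm ?addr_ge0//.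
have [t0|t0] := leP t 0; first by rewrite /gamma_kernel pk_le0// mul0r addr_ge0.
have [t1|t1] := leP t 1.
  rewrite ler_wpDr// patchE ifT ?inE/= ?in_itv/= ?t0//.
  by rewrite /gamma_kernel ler_piMr ?pk_ge0// -expR0 ler_expR; lra.
rewrite ler_wpDl// (ltW t0) /gamma_kernel; apply: (@le_trans _ _ (C * expR (t / 2) * expR (- t))).
  by rewrite ler_wpM2r ?expR_ge0// HC// ltW.
by rewrite -mulrA -expRD ler_wpM2l// ler_expR; lra.
Qed.

Lemma GammaE a : Gamma a = \int[mu]_t gamma_kernel a t.
Proof.
rewrite /Gamma Rintegral_mkcond; apply: eq_Rintegral => t _.
rewrite patchE; case: ifPn.
  by rewrite inE/= in_itv/= andbT => t0; rewrite /gamma_kernel pk_gt0.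
rewrite notin_setE/= in_itv/= andbT => /negP; rewrite -leNgt => t0.
by rewrite /gamma_kernel pk_le0// mul0r.
Qed.

(** Only the part of Euler's integral over [[r, r + 1]] is kept. The parameter [r] stays free: a
    large fixed [r] shows that [Gamma (alpha * m + b)] outgrows any prescribed geometric sequence in
    [m]. *)
Lemma Gamma_ge a (r : R) : 0 < a -> 1 <= r ->
  r `^ a / (r + 1) * expR (- (r + 1)) <= Gamma a.
Proof.
move=> a0 r1; rewrite GammaE; set c := (X in X <= _).
have r0 : 0 < r by apply: lt_le_trans r1.
have -> : c = \int[mu]_t ((cst c \_ `[r, r + 1]) t).
  rewrite -Rintegral_mkcond Rintegral_cst//=.
  by rewrite lebesgue_measure_itv/= lte_fin ltrDl ltr01 -EFinB addrAC subrr add0r mulr1.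
have c0 : 0 <= c.
  by rewrite mulr_ge0 ?expR_ge0// divr_ge0 ?powR_ge0//; lra.
apply: le_Rintegral => //; last 1 first.
- move=> t _; rewrite patchE; case: ifPn => [|_]; last exact: gamma_kernel_ge0.
  rewrite inE/= in_itv/= => /andP[rt tr]; have t0 : 0 < t by apply: lt_le_trans rt.
  rewrite /gamma_kernel pk_gt0//; apply: ler_pM; rewrite ?expR_ge0//.
  + by rewrite divr_ge0 ?powR_ge0//; lra.
  + rewrite ler_pdivrMr ?addr_gt0//; apply: (@le_trans _ _ (t `^ a)).
      by apply: ge0_ler_powR; rewrite ?nnegrE//; exact: ltW.
    by rewrite -mulr_powRB1 ?(ltW t0)// mulrC ler_wpM2l ?powR_ge0.
  + by rewrite ler_expR; lra.
- apply: integrable_patch => //.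
  apply: continuous_compact_integrable; first exact: segment_compact.
  by apply: continuous_subspaceT => x; exact: cvg_cst.
- exact: integrable_gamma_kernel.
Qed.

Lemma Gamma_gt0 a : 0 < a -> 0 < Gamma a.
Proof.
move=> a0; apply: lt_le_trans (Gamma_ge a0 (lexx 1)).
by rewrite mulr_gt0 ?expR_gt0// divr_gt0// powR_gt0.
Qed.

End PowerKernel.

(** * Convolution, the Beta integral, and weighted function classes *)

Section Convolution.
Context {R : realType}.
Implicit Types (a b c t T x : R) (f g h : R -> R).

Definition conv f g t := \int[mu]_x (f (t - x) * g x).

Lemma EFin_Rintegral f : mu.-integrable setT (EFin \o f) ->
  (\int[mu]_x f x)%:E = (\int[mu]_x (f x)%:E)%E.
Proof. by move=> intf; rewrite fineK//; exact: integrable_fin_num. Qed.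

Lemma Rintegral_affine (a b : R) f : a != 0 -> measurable_fun setT f ->
  \int[mu]_x f (a * x + b) = `|a|^-1 * \int[mu]_x f x.
Proof.
move=> a0 mf; have := @integral_affine R a b (EFin \o f) a0.
rewrite /Rintegral => /= -> //; last exact/measurable_EFinP.
have a1 : (0 < `|a|^-1%:E)%E by rewrite lte_fin invr_gt0 normr_gt0.
case: (\int[mu]_x (f x)%:E)%E => [r||]; rewrite ?gt0_muley ?gt0_muleNy//= ?mulr0//.
Qed.

Lemma Rintegral_shift f c : measurable_fun setT f ->
  \int[mu]_x f (x - c) = \int[mu]_x f x.
Proof.
move=> mf; have := @Rintegral_affine 1 (- c) f (oner_neq0 _) mf.
by rewrite normr1 invr1 mul1r; under eq_Rintegral do rewrite mul1r.
Qed.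

Lemma Rintegral_reflect f c : measurable_fun setT f ->
  \int[mu]_x f (c - x) = \int[mu]_x f x.
Proof.
move=> mf; have := @Rintegral_affine (-1) c f ltac:(by rewrite oppr_eq0 oner_neq0) mf.
by rewrite normrN normr1 invr1 mul1r; under eq_Rintegral do rewrite mulN1r addrC.
Qed.

Lemma measurable_shift f c : measurable_fun setT f ->
  measurable_fun setT (fun x => f (x - c)).
Proof. by move=> mf; apply: (measurableT_comp mf); exact: measurable_funB. Qed.

Lemma measurable_reflect f c : measurable_fun setT f ->
  measurable_fun setT (fun x => f (c - x)).
Proof. by move=> mf; apply: (measurableT_comp mf); exact: measurable_funB. Qed.

Lemma measurable_conv_integrand f g : measurable_fun setT f -> measurable_fun setT g ->
  measurable_fun setT (fun p : R * R => f (p.1 - p.2) * g p.2).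
Proof.
move=> mf mg; apply: measurable_funM.
  by apply: (measurableT_comp mf); apply: measurable_funB; [exact: measurable_fst|exact: measurable_snd].
by apply: (measurableT_comp mg); exact: measurable_snd.
Qed.

Lemma convC f g t : measurable_fun setT f -> measurable_fun setT g ->
  conv f g t = conv g f t.
Proof.
move=> mf mg; rewrite /conv -(@Rintegral_reflect (fun x => f (t - x) * g x) t).
  by apply: eq_Rintegral => x _; rewrite opprB addrCA subrr addr0 mulrC.
by apply: measurable_funM => //; exact: measurable_reflect.
Qed.

Let ge0_Zl (k : \bar R) (f : R -> R) : measurable_fun setT f -> (forall x, 0 <= f x) ->
  (0 <= k)%E -> (k * \int[mu]_x (f x)%:E = \int[mu]_x (k * (f x)%:E))%E.
Proof.
move=> mf f0 k0; rewrite ge0_integralZl//; first exact/measurable_EFinP.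
by move=> x _; rewrite lee_fin.
Qed.

(* Euler's Beta integral, from the double integral of
   [e^(-t) (t - x)^(a-1) x^(b-1)] and homogeneity of the inner integral. *)
Let betaT a b t := (\int[mu]_x (pk a (t - x) * pk b x)%:E)%E.

Let betaT_ge0 a b t : (0 <= betaT a b t)%E.
Proof. by apply: integral_ge0 => x _; rewrite lee_fin mulr_ge0// pk_ge0. Qed.

Let betaT_scale a b t : betaT a b t = ((pk (a + b) t)%:E * betaT a b 1)%E.
Proof.
have [t0|t0] := leP t 0.
  rewrite pk_le0// mul0e /betaT integral0_eq// => x _.
  have [x0|x0] := leP x 0; first by rewrite (pk_le0 _ x0) mulr0.
  by rewrite pk_le0 ?mul0r//; lra.
have mF : measurable_fun setT (fun x : R => (pk a (t - x) * pk b x)%:E).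
  apply/measurable_EFinP; apply: measurable_funM; last exact: measurable_pk.
  by apply: measurable_reflect; exact: measurable_pk.
rewrite /betaT -(@ge0_integral_affine R t 0 _ (lt0r_neq0 t0) mF); last first.
  by move=> x; rewrite lee_fin mulr_ge0// pk_ge0.
rewrite (gtr0_norm t0) (pk_gt0 _ t0).
transitivity (t%:E * ((t `^ (a - 1) * t `^ (b - 1))%:E * betaT a b 1))%E.
  congr (_ * _)%E; rewrite -ge0_integralZl//.
  - apply: eq_integral => x _; rewrite addr0 -EFinM; congr EFin.
    have pks (p y : R) : pk p (t * y) = t `^ (p - 1) * pk p y.
      rewrite /pk pmulr_rgt0//; case: ifPn => y0; last by rewrite mulr0.
      by rewrite powRM// ltW.
    by rewrite -{1}(mulr1 t) -mulrBr !pks; ring.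
  - apply/measurable_EFinP; apply: measurable_funM; last exact: measurable_pk.
    by apply: measurable_reflect; exact: measurable_pk.
  - by move=> x _; rewrite lee_fin mulr_ge0// pk_ge0.
  - by rewrite lee_fin mulr_ge0// powR_ge0.
rewrite muleA -EFinM; congr (_%:E * _)%E.
rewrite -{1}(powRr1 (ltW t0)) -!powRD ?(lt0r_neq0 t0) ?implybT//.
by congr (_ `^ _); ring.
Qed.

Let EFin_Gamma a : 0 < a -> (Gamma a)%:E = (\int[mu]_t (gamma_kernel a t)%:E)%E.
Proof. by move=> a0; rewrite GammaE EFin_Rintegral//; exact: integrable_gamma_kernel. Qed.

Let betaT_Gamma a b : 0 < a -> 0 < b ->
  ((Gamma (a + b))%:E * betaT a b 1 = (Gamma a * Gamma b)%:E)%E.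
Proof.
move=> a0 b0.
have mG : measurable_fun setT (fun p : R * R => (gamma_kernel a (p.1 - p.2) * gamma_kernel b p.2)%:E).
  apply/measurable_EFinP.
  by apply: measurable_conv_integrand; exact: measurable_gamma_kernel.
have G0 p : (0 <= (gamma_kernel a (p.1 - p.2) * gamma_kernel b p.2)%:E)%E.
  by rewrite lee_fin mulr_ge0// gamma_kernel_ge0.
have H := @fubini_tonelli _ _ _ _ R mu mu _ mG G0.
have mpk t : measurable_fun setT (fun y : R => pk a (t - y) * pk b y).
  apply: measurable_funM; last exact: measurable_pk.
  by apply: measurable_reflect; exact: measurable_pk.
have pk0 t y : 0 <= pk a (t - y) * pk b y by exact: mulr_ge0 (pk_ge0 _ _) (pk_ge0 _ _).
transitivity (\int[mu]_x \int[mu]_y (gamma_kernel a (x - y) * gamma_kernel b y)%:E)%E.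
  rewrite muleC (EFin_Gamma (addr_gt0 a0 b0)).
  rewrite (ge0_Zl (measurable_gamma_kernel _) (gamma_kernel_ge0 _) (betaT_ge0 a b 1)).
  apply: eq_integral => x _.
  rewrite {1}/gamma_kernel muleC EFinM (muleC (pk _ _)%:E) -muleA -betaT_scale /betaT.
  have ex0 : (0 <= (expR (- x))%:E)%E by rewrite lee_fin expR_ge0.
  rewrite (ge0_Zl (mpk x) (pk0 x) ex0).
  apply: eq_integral => y _; rewrite -EFinM; congr EFin.
  rewrite /gamma_kernel.
  have -> : expR (- x) = expR (- (x - y)) * expR (- y) by rewrite -expRD; congr expR; ring.
  by ring.
rewrite H EFinM (EFin_Gamma b0).
have ga0 : (0 <= (Gamma a)%:E)%E by rewrite lee_fin (ltW (Gamma_gt0 a0)).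
rewrite (ge0_Zl (measurable_gamma_kernel _) (gamma_kernel_ge0 _) ga0).
apply: eq_integral => y _.
rewrite (EFin_Gamma a0).
have -> : (\int[mu]_t (gamma_kernel a t)%:E = \int[mu]_t (gamma_kernel a (t - y))%:E)%E.
  have mg : measurable_fun setT (EFin \o gamma_kernel a).
    by apply/measurable_EFinP; exact: measurable_gamma_kernel.
  have := @integral_affine R 1 (- y) _ (oner_neq0 _) mg.
  rewrite normr1 invr1 mul1e => <-; apply: eq_integral => x _ /=.
  by rewrite mul1r.
rewrite muleC ge0_Zl.
- by apply: eq_integral => x _ /=; rewrite -EFinM mulrC.
- by apply: measurable_shift; exact: measurable_gamma_kernel.
- by move=> x; exact: gamma_kernel_ge0.
- by rewrite lee_fin gamma_kernel_ge0.
Qed.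

Definition beta a b : R := Gamma a * Gamma b / Gamma (a + b).

Let betaT1 a b : 0 < a -> 0 < b -> betaT a b 1 = (beta a b)%:E.
Proof.
move=> a0 b0; have GB := Gamma_gt0 (addr_gt0 a0 b0).
have := betaT_Gamma a0 b0; have := betaT_ge0 a b 1.
case: (betaT a b 1) => [r _| |] //; last by rewrite gt0_muley ?lte_fin.
move=> /eqP; rewrite -EFinM eqe => /eqP h; congr EFin.
by rewrite /beta -h mulrAC mulfV ?mul1r// gt_eqF.
Qed.

Let betaTE a b t : 0 < a -> 0 < b -> betaT a b t = (beta a b * pk (a + b) t)%:E.
Proof. by move=> a0 b0; rewrite betaT_scale betaT1// -EFinM mulrC. Qed.

Lemma beta_ge0 a b : 0 < a -> 0 < b -> 0 <= beta a b.
Proof. by move=> a0 b0; rewrite /beta divr_ge0 ?mulr_ge0// ltW// Gamma_gt0// addr_gt0. Qed.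

Lemma integrable_conv_pk a b t : 0 < a -> 0 < b ->
  mu.-integrable setT (EFin \o (fun x => pk a (t - x) * pk b x)).
Proof.
move=> a0 b0; apply/integrableP; split.
  apply/measurable_EFinP; apply: measurable_funM; last exact: measurable_pk.
  by apply: measurable_reflect; exact: measurable_pk.
have := betaTE t a0 b0; rewrite /betaT => h.
rewrite (_ : (\int[mu]_x _)%E = (beta a b * pk (a + b) t)%:E) ?ltry// -h.
by apply: eq_integral => x _ /=; rewrite ger0_norm// mulr_ge0// pk_ge0.
Qed.

Lemma conv_pk a b t : 0 < a -> 0 < b -> conv (pk a) (pk b) t = beta a b * pk (a + b) t.
Proof.
move=> a0 b0; have := betaTE t a0 b0.
by rewrite /betaT -(EFin_Rintegral (integrable_conv_pk t a0 b0)) => -[].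
Qed.

(** Measurable functions bounded by a multiple of [t^(a-1)] up to every time [T], hence zero for
    [t <= 0]. For positive exponents, convolution stays in these classes and adds the exponents, so
    membership settles integrability and the use of Fubini at once. *)
Definition W a f := measurable_fun setT f /\
  forall T, exists2 C, 0 <= C & forall t, t <= T -> `|f t| <= C * pk a t.

Lemma W_measurable a f : W a f -> measurable_fun setT f.
Proof. by case. Qed.

Lemma W_le0 a f t : W a f -> t <= 0 -> f t = 0.
Proof.
move=> [_ /(_ t)[C C0 /(_ t (lexx _))]] h t0.
by apply/eqP; rewrite -normr_eq0 eq_le normr_ge0 andbT (le_trans h)// pk_le0 ?mulr0.
Qed.

Lemma W_pk a : W a (pk a).
Proof.
split; first exact: measurable_pk.
by move=> T; exists 1 => // t _; rewrite mul1r ger0_norm// pk_ge0.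
Qed.

Lemma W_abs a f : W a f -> W a (fun t => `|f t|).
Proof.
move=> [mf hf]; split; first exact: measurableT_comp.
by move=> T; have [C C0 h] := hf T; exists C => // t /h; rewrite normr_id.
Qed.

Lemma W_weaken a b f : a <= b -> W b f -> W a f.
Proof.
move=> ab [mf hf]; split => // T; have [C C0 h] := hf T.
exists (C * `|T| `^ (b - a)); first by rewrite mulr_ge0// powR_ge0.
move=> t tT; apply: (le_trans (h _ tT)); rewrite -mulrA ler_wpM2l//.
have [t0|t0] := leP t 0; first by rewrite !pk_le0// mulr0.
rewrite !pk_gt0// (_ : b - 1 = b - a + (a - 1)); last by ring.
rewrite powRD ?(gt_eqF t0) ?implybT// ler_wpM2r ?powR_ge0// ge0_ler_powR ?nnegrE ?(ltW t0)//.
  by rewrite subr_ge0.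
by rewrite (le_trans tT)// ler_norm.
Qed.

Lemma W_add a f g : W a f -> W a g -> W a (fun t => f t + g t).
Proof.
move=> [mf hf] [mg hg]; split; first exact: measurable_funD.
move=> T; have [C C0 h] := hf T; have [D D0 k] := hg T.
exists (C + D); first exact: addr_ge0.
by move=> t tT; rewrite mulrDl (le_trans (ler_normD _ _))// lerD// ?h ?k.
Qed.

Lemma W_scale a c f : W a f -> W a (fun t => c * f t).
Proof.
move=> [mf hf]; split; first by apply: measurable_funM => //; exact: measurable_cst.
move=> T; have [C C0 h] := hf T; exists (`|c| * C); first by rewrite mulr_ge0.
by move=> t tT; rewrite normrM -mulrA ler_wpM2l// h.
Qed.

Lemma W_opp a f : W a f -> W a (fun t => - f t).
Proof. by move=> hf; have := W_scale (-1) hf; under eq_fun do rewrite mulN1r. Qed.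

Lemma W0 a : W a (fun=> 0).
Proof. by split=> // T; exists 0 => // t _; rewrite normr0 mul0r. Qed.

Lemma W_sum a (I : Type) (r : seq I) (P : pred I) (F : I -> R -> R) :
  (forall i, W a (F i)) -> W a (fun t => \sum_(i <- r | P i) F i t).
Proof.
move=> hF; elim: r => [|i r ih].
  by under eq_fun do rewrite big_nil; exact: W0.
under eq_fun do rewrite big_cons.
by case: (P i) => //; exact: W_add.
Qed.

(** Off [0 < x < t] both sides vanish; inside, [x] and [t - x] are both at most [T], where the two
    local bounds apply. This reduces everything to the Beta integrand. *)
Lemma W_conv_bound a b f g T C D : 0 <= T -> (forall t, t <= T -> `|f t| <= C * pk a t) ->
  (forall t, t <= T -> `|g t| <= D * pk b t) -> forall t x, t <= T ->
  `|f (t - x) * g x| <= C * D * (pk a (t - x) * pk b x).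
Proof.
move=> T0 hf hg t x tT; rewrite normrM.
have fN y : y <= 0 -> y <= T -> f y = 0.
  move=> y0 /hf; rewrite pk_le0// mulr0 => h.
  by apply/eqP; rewrite -normr_eq0 eq_le h normr_ge0.
have gN y : y <= 0 -> y <= T -> g y = 0.
  move=> y0 /hg; rewrite pk_le0// mulr0 => h.
  by apply/eqP; rewrite -normr_eq0 eq_le h normr_ge0.
have [x0|x0] := leP x 0.
  by rewrite (pk_le0 _ x0) !mulr0 gN ?normr0 ?mulr0// (le_trans x0).
have [tx|tx] := leP t x.
  have h : t - x <= 0 by rewrite subr_le0.
  by rewrite (pk_le0 _ h) mul0r mulr0 fN ?normr0 ?mul0r//; lra.
rewrite mulrACA; apply: ler_pM => //; first by apply: hf; lra.
by apply: hg; lra.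
Qed.

Lemma W_conv_integrable a b f g t : 0 < a -> 0 < b -> W a f -> W b g ->
  mu.-integrable setT (EFin \o (fun x => f (t - x) * g x)).
Proof.
move=> a0 b0 [mf /(_ `|t|)[C C0 hf]] [mg /(_ `|t|)[D D0 hg]].
have := integrableZl measurableT (C * D) (integrable_conv_pk t a0 b0).
apply: le_integrable => //.
  by apply/measurable_EFinP; apply: measurable_funM => //; exact: measurable_reflect.
move=> x _ /=; rewrite lee_fin.
rewrite (le_trans (W_conv_bound (normr_ge0 t) hf hg x (ler_norm t)))// ler_norm//.
Qed.

Lemma W_conv a b f g : 0 < a -> 0 < b -> W a f -> W b g -> W (a + b) (conv f g).
Proof.
move=> a0 b0 wf wg; split.
  apply/measurable_EFinP.
  rewrite (_ : _ \o _ = fun t => \int[mu]_x (f (t - x) * g x)%:E)%E; last first.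
    by apply/funext => t /=; rewrite EFin_Rintegral//; exact: W_conv_integrable wf wg.
  have mF : measurable_fun setT (fun p : R * R => (f (p.1 - p.2) * g p.2)%:E).
    apply/measurable_EFinP; apply: measurable_conv_integrand.
      exact: W_measurable wf.
    exact: W_measurable wg.
  (* Measurability in [t] comes from Tonelli's theorem, applied to the positive and the negative
     part. *)
  have -> : (fun t => \int[mu]_x (f (t - x) * g x)%:E)%E =
    (fun t => \int[mu]_x ((fun p : R * R => (f (p.1 - p.2) * g p.2)%:E)^\+ (t, x)) -
              \int[mu]_x ((fun p : R * R => (f (p.1 - p.2) * g p.2)%:E)^\- (t, x)))%E.
    apply/funext => t; rewrite integralE; congr (_ - _)%E;
    by apply: eq_integral => x _; rewrite ?funeposE ?funenegE.
  apply: emeasurable_funB.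
  - by apply: measurable_fun_fubini_tonelli_F => //; exact: measurable_funepos.
  - by apply: measurable_fun_fubini_tonelli_F => //; exact: measurable_funeneg.
move=> T; have [C C0 hf] := wf.2 `|T|; have [D D0 hg] := wg.2 `|T|.
exists (C * D * beta a b); first by rewrite mulr_ge0 ?beta_ge0// mulr_ge0.
move=> t /le_trans/(_ (ler_norm T)) tT; rewrite -mulrA -conv_pk// /conv.
have I1 := W_conv_integrable t a0 b0 wf wg.
have I2 := integrable_conv_pk t a0 b0.
rewrite -RintegralZl//; apply: (le_trans (le_normr_Rintegral measurableT I1)).
apply: le_Rintegral => //.
- exact: integrable_norm.
- exact: (integrableZl measurableT _ I2).
- by move=> x _; exact: (W_conv_bound (normr_ge0 T) hf hg).
Qed.

End Convolution.

(** * Linearity and associativity of convolution; values of Gamma *)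

Section ConvolutionAlgebra.
Context {R : realType}.
Local Notation mu := (@lebesgue_measure R).
Implicit Types (a b c t T x : R) (f g h : R -> R).

Lemma eq_conv f1 f2 g1 g2 t : f1 =1 f2 -> g1 =1 g2 -> conv f1 g1 t = conv f2 g2 t.
Proof. by move=> ff gg; apply: eq_Rintegral => x _; rewrite ff gg. Qed.

Lemma convDr a b f g1 g2 t : 0 < a -> 0 < b -> W a f -> W b g1 -> W b g2 ->
  conv f (fun x => g1 x + g2 x) t = conv f g1 t + conv f g2 t.
Proof.
move=> a0 b0 wf w1 w2; rewrite /conv -RintegralD//.
- by apply: eq_Rintegral => x _; rewrite mulrDr.
- exact: W_conv_integrable wf w1.
- exact: W_conv_integrable wf w2.
Qed.

Lemma convZr a b c f g t : 0 < a -> 0 < b -> W a f -> W b g ->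
  conv f (fun x => c * g x) t = c * conv f g t.
Proof.
move=> a0 b0 wf wg; rewrite /conv -RintegralZl//.
- by apply: eq_Rintegral => x _; rewrite mulrCA.
- exact: W_conv_integrable wf wg.
Qed.

Lemma integrable_lsum (D : set (measurableTypeR R)) (I : Type) (r : seq I) (c : I -> R) (F : I -> R -> R) :
  measurable D -> (forall i, mu.-integrable D (EFin \o F i)) ->
  mu.-integrable D (EFin \o (fun x => \sum_(i <- r) c i * F i x)).
Proof.
move=> mD IF; elim: r => [|i r ih].
  under eq_fun do rewrite big_nil; exact: integrable0.
have := integrableD mD (integrableZl mD (c i) (IF i)) ih.
by apply: eq_integrable => // x _ /=; rewrite big_cons.
Qed.

Lemma Rintegral_lsum (D : set (measurableTypeR R)) (I : Type) (r : seq I) (c : I -> R) (F : I -> R -> R) :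
  measurable D -> (forall i, mu.-integrable D (EFin \o F i)) ->
  \int[mu]_(x in D) (\sum_(i <- r) c i * F i x) = \sum_(i <- r) c i * \int[mu]_(x in D) F i x.
Proof.
move=> mD IF; elim: r => [|i r ih].
  by under eq_Rintegral do rewrite big_nil; rewrite big_nil Rintegral_cst// mul0r.
rewrite big_cons -ih -(RintegralZl _ mD (IF i)) -RintegralD//.
- by apply: eq_Rintegral => x _; rewrite big_cons.
- exact: (integrableZl mD (c i) (IF i)).
- exact: integrable_lsum.
Qed.

Lemma conv_sumr a b f (I : Type) (r : seq I) (F : I -> R -> R) t :
  0 < a -> 0 < b -> W a f -> (forall i, W b (F i)) ->
  conv f (fun x => \sum_(i <- r) F i x) t = \sum_(i <- r) conv f (F i) t.
Proof.
move=> a0 b0 wf wF; transitivity (\int[mu]_x \sum_(i <- r) 1 * (f (t - x) * F i x)).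
  by apply: eq_Rintegral => x _; rewrite mulr_sumr; apply: eq_bigr => i _; rewrite mul1r.
rewrite Rintegral_lsum//; last by move=> i; exact: W_conv_integrable wf (wF i).
by apply: eq_bigr => i _; rewrite mul1r.
Qed.

Lemma convDl a b f1 f2 g t : 0 < a -> 0 < b -> W a f1 -> W a f2 -> W b g ->
  conv (fun x => f1 x + f2 x) g t = conv f1 g t + conv f2 g t.
Proof.
move=> a0 b0 w1 w2 wg; have mg := W_measurable wg.
have [m1 m2] := (W_measurable w1, W_measurable w2).
rewrite convC// ?(convDr _ b0 a0)//; last exact: measurable_funD.
by rewrite (convC _ mg m1) (convC _ mg m2).
Qed.

Lemma convZl a b c f g t : 0 < a -> 0 < b -> W a f -> W b g ->
  conv (fun x => c * f x) g t = c * conv f g t.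
Proof.
move=> a0 b0 wf wg; have [mf mg] := (W_measurable wf, W_measurable wg).
rewrite convC// ?(convZr _ _ b0 a0)// ?(convC _ mg mf)//.
by apply: measurable_funM => //; exact: measurable_cst.
Qed.

Lemma conv_suml a b g (I : Type) (r : seq I) (F : I -> R -> R) t :
  0 < a -> 0 < b -> W b g -> (forall i, W a (F i)) ->
  conv (fun x => \sum_(i <- r) F i x) g t = \sum_(i <- r) conv (F i) g t.
Proof.
move=> a0 b0 wg wF; have mg := W_measurable wg.
rewrite convC//; last exact: (W_measurable (W_sum _ _ wF)).
rewrite (conv_sumr _ _ b0 a0)//; apply: eq_bigr => i _.
by rewrite convC//; exact: W_measurable (wF i).
Qed.

Lemma integrable_shift f c : mu.-integrable setT (EFin \o f) ->
  mu.-integrable setT (EFin \o (fun x => f (x - c))).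
Proof.
move=> /integrableP[/measurable_EFinP mf fi]; apply/integrableP; split.
  by apply/measurable_EFinP; exact: measurable_shift.
have mF : measurable_fun setT (fun x : R => (`|f x|%:E : \bar R)).
  by apply/measurable_EFinP; exact: measurableT_comp.
have := integral_affine (- c) (oner_neq0 _) mF; rewrite normr1 invr1 mul1e => E.
rewrite (_ : (\int[mu]_x _)%E = (\int[mu]_x (`|f (1 * x - c)|)%:E)%E); last first.
  by apply: eq_integral => x _; rewrite mul1r.
by rewrite E.
Qed.

(** Fubini, with [f (t - x) * (g (x - y) * h y)] as the function of two variables. Its absolute
    integral is the convolution of [|f|] with that of [|g|] and [|h|], which is finite because
    absolute values stay in the weighted classes. *)
Lemma convA a b c f g h t : 0 < a -> 0 < b -> 0 < c -> W a f -> W b g -> W c h ->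
  conv (conv f g) h t = conv f (conv g h) t.
Proof.
move=> a0 b0 c0 wf wg wh.
have [mf mg mh] := And3 (W_measurable wf) (W_measurable wg) (W_measurable wh).
pose G (p : R * R) : \bar R := (f (t - p.1) * (g (p.1 - p.2) * h p.2))%:E.
have mG : measurable_fun setT G.
  apply/measurable_EFinP; apply: measurable_funM; last exact: measurable_conv_integrand.
  by apply: (measurableT_comp (measurable_reflect t mf)); exact: measurable_fst.
have iG : (mu \x mu)%E.-integrable setT G.
  apply/integrable12ltyP => //.
  have wgh := W_conv b0 c0 (W_abs wg) (W_abs wh).
  have bc0 : 0 < b + c by exact: addr_gt0.
  have I := W_conv_integrable t a0 bc0 (W_abs wf) wgh.
  rewrite (_ : (\int[mu]_x _)%E =
    \int[mu]_x (`|f (t - x)| * conv (fun x => `|g x|) (fun x => `|h x|) x)%:E)%E.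
    by rewrite -(EFin_Rintegral I) ltry.
  apply: eq_integral => x _.
  have Ix := W_conv_integrable x b0 c0 (W_abs wg) (W_abs wh).
  rewrite EFinM (EFin_Rintegral Ix) -ge0_integralZl//.
  - by apply: eq_integral => y _; rewrite /G /= !normrM.
  - apply/measurable_EFinP; apply: measurable_funM; last exact: W_measurable (W_abs wh).
    exact: (measurable_reflect x (W_measurable (W_abs wg))).
have H := Fubini iG; rewrite /G /= in H.
have EL : (conv (conv f g) h t)%:E =
    (\int[mu]_y \int[mu]_x (f (t - x) * (g (x - y) * h y))%:E)%E.
  have ab0 := addr_gt0 a0 b0.
  rewrite (EFin_Rintegral (W_conv_integrable t ab0 c0 (W_conv a0 b0 wf wg) wh)).
  apply: eq_integral => y _.
  have I1 := W_conv_integrable (t - y) a0 b0 wf wg.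
  have mI : measurable_fun setT (fun x => f (t - x) * g (x - y)).
    by apply: measurable_funM; [exact: measurable_reflect|exact: measurable_shift].
  have -> : conv f g (t - y) = \int[mu]_x (f (t - x) * g (x - y)).
    rewrite -(Rintegral_shift (- y) mI); apply: eq_Rintegral => x _.
    by rewrite opprK; congr (f _ * g _); ring.
  have I2 : mu.-integrable setT (EFin \o (fun x => f (t - x) * g (x - y))).
    have := integrable_shift y (W_conv_integrable (t - y) a0 b0 wf wg).
    by apply: eq_integrable => // x _ /=; congr (f _ * _)%:E; ring.
  rewrite -RintegralZr// EFin_Rintegral.
    by apply: eq_integral => x _; rewrite mulrA.
  by have := integrableZr measurableT (h y) I2; apply: eq_integrable.
have ER : (conv f (conv g h) t)%:E =
    (\int[mu]_x \int[mu]_y (f (t - x) * (g (x - y) * h y))%:E)%E.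
  have bc0 := addr_gt0 b0 c0.
  rewrite (EFin_Rintegral (W_conv_integrable t a0 bc0 wf (W_conv b0 c0 wg wh))).
  apply: eq_integral => x _; have I1 := W_conv_integrable x b0 c0 wg wh.
  rewrite -RintegralZl// EFin_Rintegral//.
  exact: (integrableZl measurableT _ I1).
suff : (conv (conv f g) h t)%:E = (conv f (conv g h) t)%:E by case.
by rewrite EL ER H.
Qed.

(** The kernel [k_b] of the overview: its convolution with a function cut to []0, +oo[] is the
    fractional integral of order [b]. *)
Definition rlk b t := (Gamma b)^-1 * pk b t.

Lemma W_rlk b : W b (rlk b).
Proof. by apply: W_scale; exact: W_pk. Qed.

Lemma conv_pkE b f t : conv (pk b) (f \_ `]0, +oo[) t =
  \int[mu]_(x in `]0, t[) ((t - x) `^ (b - 1) * f x).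
Proof.
rewrite [RHS]Rintegral_mkcond /conv; apply: eq_Rintegral => x _; rewrite !patchE.
rewrite !mem_setE !in_itv/= andbT.
have [x0|x0] := ltP 0 x; last by rewrite mulr0.
by rewrite /pk subr_gt0; case: ifP => //; rewrite mul0r.
Qed.

Lemma conv1E f t : (forall x, x <= 0 -> f x = 0) ->
  conv (pk 1) f t = \int[mu]_(x in `]0, t[) f x.
Proof.
move=> f0; have -> : conv (pk 1) f t = conv (pk 1) (f \_ `]0, +oo[) t.
  by apply: eq_conv => // x; have [x0|x0] := ltP 0 x; [rewrite cutE|rewrite cut_le0// f0].
by rewrite conv_pkE; apply: eq_Rintegral => x _; rewrite subrr powRr0 mul1r.
Qed.

Lemma eq_integral_off r (F G : R -> \bar R) : measurable_fun setT F ->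
  measurable_fun setT G -> (forall x, x != r -> F x = G x) ->
  (\int[mu]_x F x = \int[mu]_x G x)%E.
Proof.
move=> mF mG FG.
have mD : measurable ([set: R] `\ r) by apply: measurableD => //; exact: measurable_set1.
rewrite -(integral_setD1 (r := r) mD) ; last exact: measurable_funTS.
rewrite -[RHS](integral_setD1 (r := r) mD) ; last exact: measurable_funTS.
apply: eq_integral => x /set_mem[_ /= /eqP xr]; exact: FG.
Qed.

Lemma Gamma1 : Gamma 1 = 1 :> R.
Proof.
rewrite GammaE; have := @integral_exponential_pdf R 1 ltr01; rewrite /Rintegral.
have -> : (\int[mu]_x (gamma_kernel 1 x)%:E = \int[mu]_x (exponential_pdf 1 x)%:E)%E.
  apply: (eq_integral_off (r := 0)).
  - by apply/measurable_EFinP; exact: measurable_gamma_kernel.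
  - by apply/measurable_EFinP; exact: measurable_exponential_pdf.
  - move=> x x0; congr EFin; rewrite /exponential_pdf patchE mem_setE in_itv/= andbT.
    rewrite /gamma_kernel /pk subrr powRr0 le_eqVlt eq_sym (negbTE x0)/=.
    by case: ifP => _; rewrite ?mul0r// !mul1r mulN1r.
by move=> ->.
Qed.

(** The Beta integral at [(1, x)] is the integral of [y^(x-1)] over the unit interval, that is
    [x^-1]; its expression by Gamma values is the functional equation. *)
Lemma GammaD1 x : 0 < x -> Gamma (x + 1) = x * Gamma x.
Proof.
move=> x0; have := conv_pk 1 ltr01 x0.
rewrite conv1E; last by move=> y; exact: pk_le0.
rewrite pk_gt0// powR1 mulr1 /beta Gamma1 mul1r addrC.
have -> : \int[mu]_(y in `]0, 1[) pk x y = x^-1.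
  have := integral_powR01 x0; rewrite -integral_itv_bndo_bndc; last first.
    by apply/measurable_EFinP/measurable_funTS; exact: measurable_powR.
  rewrite /Rintegral => h.
  rewrite (_ : (\int[mu]_(y in _) _)%E = (x^-1)%:E)// -h.
  by apply: eq_integral => y; rewrite inE/= in_itv/= => /andP[y0 _]; rewrite pk_gt0.
have g0 := lt0r_neq0 (Gamma_gt0 x0); have g1 := lt0r_neq0 (Gamma_gt0 (addr_gt0 x0 ltr01)).
move=> h; have x1 := lt0r_neq0 x0.
have := congr1 (fun z => z * (x * Gamma (x + 1))) h.
by rewrite mulrA mulVf// mul1r mulrACA (mulrC (_^-1)) -mulrA mulrA => ->; field.
Qed.

End ConvolutionAlgebra.

(** * Entire power series *)

Section PowerSeries.
Context {R : realType}.
Implicit Types (a b c t T u x : R) (d : nat -> R).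

(** Infinite radius of convergence, stated as boundedness at every radius. Using the bound at twice
    a radius gives the decay [2^-k] of the terms. *)
Definition entire d := forall M, 0 <= M -> exists C, forall m, `|d m| * M ^+ m <= C.

Definition ps d u := limn (pseries d u).

Let half_sum (v : nat -> R) C n p : (forall k, `|v k| <= C * 2^-1 ^+ k) ->
  `|\sum_(n <= k < n + p) v k| <= 2 * C * (2^-1 ^+ n - 2^-1 ^+ (n + p)).
Proof.
move=> hv; elim: p => [|p ih].
  by rewrite addn0 big_geq// normr0 subrr mulr0.
rewrite addnS big_nat_recr ?leq_addr//= (le_trans (ler_normD _ _))//.
apply: (le_trans (lerD ih (hv _))).
by rewrite exprS le_eqVlt; apply/orP; left; apply/eqP; field.
Qed.

Lemma entire_half d U : 0 <= U -> entire d -> exists2 C, 0 <= C &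
  forall u, `|u| <= U -> forall k, `|d k * u ^+ k| <= C * 2^-1 ^+ k.
Proof.
move=> U0 hd; have [C hC] := hd (2 * U) (mulr_ge0 (ler0n _ 2) U0).
exists C; first by apply: le_trans (hC 0); rewrite expr0 mulr1.
move=> u uU k; rewrite exprVn ler_pdivlMr ?exprn_gt0// normrM normrX.
rewrite (le_trans _ (hC k))// exprMn (mulrC (2 ^+ k)) mulrA ler_wpM2r ?exprn_ge0//.
by rewrite ler_wpM2l// lerXn2r ?nnegrE.
Qed.

Lemma entire_cvg d u : entire d -> cvgn (pseries d u).
Proof.
move=> hd; have [C C0 hC] := entire_half (normr_ge0 u) hd.
apply: normed_cvg; apply: (series_le_cvg _ _ (hC u (lexx _))) => //.
  by move=> n; rewrite mulr_ge0.
by apply: is_cvg_geometric_series; rewrite ger0_norm// invf_lt1// ltr1n.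
Qed.

(** The rate [2^-n] is uniform on [|u| <= U]; this is what later permits fractional integration term
    by term. *)
Lemma ps_tail d U : 0 <= U -> entire d -> exists2 C, 0 <= C &
  forall u n, `|u| <= U -> `|ps d u - \sum_(0 <= k < n) d k * u ^+ k| <= C * 2^-1 ^+ n.
Proof.
move=> U0 hd; have [C C0 hC] := entire_half U0 hd; exists (2 * C); first exact: mulr_ge0.
move=> u n uU; set v := \sum_(0 <= k < n) _.
have cv : (fun m => `|pseries d u m - v|) m @[m --> \oo] --> `|ps d u - v|.
  by apply: cvg_norm; apply: cvgB; [exact: entire_cvg|exact: cvg_cst].
rewrite -(cvg_lim (@Rhausdorff R) cv); apply: limr_le; first by apply/cvg_ex; exists `|ps d u - v|.
exists n => // m /= nm; rewrite /pseries /series /= /v -(subnKC nm).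
rewrite (big_cat_nat (n := n)) ?leq_addr//= addrAC subrr add0r.
apply: (le_trans (half_sum _ _ (hC u uU))); rewrite ler_wpM2l// ?mulr_ge0//.
by rewrite lerBlDr lerDl exprn_ge0.
Qed.

Lemma ps_bound d U : 0 <= U -> entire d -> exists2 C, 0 <= C &
  forall u, `|u| <= U -> `|ps d u| <= C.
Proof.
move=> U0 hd; have [C C0 hC] := ps_tail U0 hd; exists C => // u uU.
by have := hC u 0%N uU; rewrite big_geq// subr0 expr0 mulr1.
Qed.

Lemma psE d u l : entire d -> (\sum_(0 <= k < n) d k * u ^+ k @[n --> \oo] --> l) -> ps d u = l.
Proof. by move=> hd hl; apply: cvg_lim. Qed.

Lemma entire_diffs d : entire d -> entire (pseries_diffs d).
Proof.
move=> hd M M0; have M1 : 0 <= 2 * (M + 1) by rewrite mulr_ge0// addr_ge0.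
have [C hC] := hd _ M1; exists C => m.
rewrite /pseries_diffs normrM normr_nat (le_trans _ (hC m.+1))//.
rewrite (mulrC m.+1%:R) -mulrA ler_wpM2l// exprMn; apply: ler_pM => //; first exact: exprn_ge0.
  by rewrite -natrX ler_nat ltnW// ltn_expl.
rewrite exprS; apply: (@le_trans _ _ (1 * (M + 1) ^+ m)).
  by rewrite mul1r lerXn2r ?nnegrE ?addr_ge0// lerDl.
by rewrite ler_wpM2r ?exprn_ge0 ?addr_ge0// lerDr.
Qed.

Lemma continuous_ps d : entire d -> continuous (ps d).
Proof.
move=> hd x; apply/differentiable_continuous/derivable1_diffP.
have := @pseries_snd_diffs R d (`|x| + 1) x (@entire_cvg _ _ hd)
  (@entire_cvg _ _ (entire_diffs hd)) (@entire_cvg _ _ (entire_diffs (entire_diffs hd))).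
case=> //.
by rewrite [ltRHS]ger0_norm ?addr_ge0// ltrDl.
Qed.

Lemma ps_shift d u : entire d -> ps d u = d 0 + u * ps (fun m => d m.+1) u.
Proof.
move=> hd; apply: psE => //.
rewrite -(cvg_shiftS (fun n => \sum_(0 <= k < n) d k * u ^+ k)).
have hd1 : entire (fun m => d m.+1).
  move=> M M0; have [C hC] := hd (M + 1) (addr_ge0 M0 ler01); exists C => m.
  apply: le_trans (hC m.+1); rewrite ler_wpM2l// exprS.
  apply: (@le_trans _ _ (1 * (M + 1) ^+ m)).
    by rewrite mul1r lerXn2r ?nnegrE ?addr_ge0// lerDl.
  by rewrite ler_wpM2r ?exprn_ge0 ?addr_ge0// lerDr.
rewrite (_ : (fun n => _) = fun n => d 0 + u * \sum_(0 <= k < n) d k.+1 * u ^+ k).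
  apply: cvgD; first exact: cvg_cst.
  by apply: cvgM; [exact: cvg_cst|exact: (@entire_cvg _ u hd1)].
apply/funext => n /=; rewrite big_nat_recl//= expr0 mulr1; congr (_ + _).
by rewrite mulr_sumr; apply: eq_bigr => k _; rewrite exprS mulrCA.
Qed.

Lemma ps_sum (I : Type) (r : seq I) (k : I -> R) (D : I -> nat -> R) u :
  (forall i, entire (D i)) ->
  ps (fun m => \sum_(i <- r) k i * D i m) u = \sum_(i <- r) k i * ps (D i) u.
Proof.
move=> hD; apply: cvg_lim; first exact: Rhausdorff.
rewrite (_ : pseries _ _ = fun n => \sum_(i <- r) k i * pseries (D i) u n).
  apply: cvg_big => [|i _]; first by apply: add_continuous.
  by apply: cvgM; [exact: cvg_cst|exact: (@entire_cvg _ u (hD i))].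
apply/funext => n; rewrite /pseries /series /=.
under [RHS]eq_bigr do rewrite mulr_sumr.
rewrite exchange_big/=; apply: eq_bigr => j _.
by rewrite mulr_suml; apply: eq_bigr => i _; rewrite mulrA.
Qed.



(** * Fractional power series with Mittag-Leffler coefficients *)

Section MittagLefflerSeries.
Context (alpha : R) (alpha_gt0 : 0 < alpha).
Implicit Types (k : nat -> R).

(** At most geometric growth: it holds for the entries of [A ^+ m] and survives multiplication by
    [m], that is, Euler derivatives. *)
Definition geo k := exists C M, [/\ 0 <= C, 0 <= M & forall m, `|k m| <= C * M ^+ m].

Definition mcoef b k m := k m / Gamma (alpha * m%:R + b).

(* The fractional power series [sum_m k_m t^(alpha m + b - 1) / Gamma (alpha m + b)]. *)
Definition mser k b t := pk b t * ps (mcoef b k) (t `^ alpha).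

Lemma am_gt0 b m : 0 < b -> 0 < alpha * m%:R + b.
Proof. by move=> b0; rewrite ltr_wpDl// mulr_ge0// ltW. Qed.

Lemma entire_mcoef b k : 0 < b -> geo k -> entire (mcoef b k).
Proof.
move=> b0 [C [M [C0 M0 hk]]] L L0.
(* [q] exceeds [M * L] and is at least [1], so its root [r] with [r ^ alpha = q] satisfies the
   [1 <= r] of the Gamma bound, and [r ^ (alpha * m)] becomes [q ^ m]. *)
pose q := M * L + 1; have q1 : 1 <= q by rewrite lerDr mulr_ge0.
have q0 : 0 < q by apply: lt_le_trans q1.
pose r := q `^ alpha^-1.
have r1 : 1 <= r.
  have h1 : 1 `^ alpha^-1 = 1 :> R by rewrite powR1.
  by rewrite -h1 ge0_ler_powR ?nnegrE ?(ltW q0)// invr_ge0 ltW.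
have r0 : 0 < r by apply: lt_le_trans r1.
have ra : r `^ alpha = q by rewrite -powRrM mulVf ?gt_eqF// powRr1// ltW.
pose G := expR (- (r + 1)) / (r + 1) * r `^ b.
have r2 : 0 < r + 1 by rewrite addr_gt0.
have G0 : 0 < G by rewrite mulr_gt0 ?powR_gt0// divr_gt0// expR_gt0.
exists (C / G) => m.
have gm := Gamma_ge (am_gt0 m b0) r1.
have {}gm : G * q ^+ m <= Gamma (alpha * m%:R + b).
  apply: le_trans gm; rewrite powRD ?(gt_eqF r0) ?implybT// powRrM ra powR_mulrn ?(ltW q0)//.
  by rewrite /G le_eqVlt; apply/orP; left; apply/eqP; field; rewrite gt_eqF.
have g0 := Gamma_gt0 (am_gt0 m b0).
rewrite /mcoef normrM normfV (gtr0_norm g0) mulrAC ler_pdivrMr// mulrAC ler_pdivlMr//.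
apply: (@le_trans _ _ (C * q ^+ m * G)); last by rewrite -mulrA ler_wpM2l// mulrC.
rewrite ler_wpM2r ?(ltW G0)//.
apply: (@le_trans _ _ (C * M ^+ m * L ^+ m)); first by rewrite ler_wpM2r ?exprn_ge0.
by rewrite -mulrA -exprMn ler_wpM2l// lerXn2r ?nnegrE ?mulr_ge0 ?(ltW q0)// lerDl.
Qed.

Lemma measurable_ps_powR d : entire d -> measurable_fun setT (fun t : R => ps d (t `^ alpha)).
Proof.
move=> hd; apply: (measurableT_comp _ (measurable_powR alpha)).
by apply: continuous_measurable_fun; exact: continuous_ps.
Qed.

Lemma powR_le_norm t T : t <= T -> 0 < t -> `|t `^ alpha| <= `|T| `^ alpha.
Proof.
move=> tT t0; rewrite ger0_norm ?powR_ge0// ge0_ler_powR ?nnegrE ?(ltW t0) ?(ltW alpha_gt0)//.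
by rewrite (le_trans tT)// ler_norm.
Qed.

Lemma W_mser b k : 0 < b -> geo k -> W b (mser k b).
Proof.
move=> b0 hk; have hd := entire_mcoef b0 hk; split.
  by apply: measurable_funM; [exact: measurable_pk|exact: measurable_ps_powR].
move=> T; have [C C0 hC] := ps_bound (powR_ge0 `|T| alpha) hd; exists C => // t tT.
have [t0|t0] := leP t 0; first by rewrite /mser pk_le0// mul0r normr0 mulr0.
rewrite normrM (ger0_norm (pk_ge0 _ _)) mulrC ler_wpM2r ?pk_ge0//.
by apply: hC; exact: powR_le_norm.
Qed.

Lemma pk_powR b t m : pk b t * (t `^ alpha) ^+ m = pk (alpha * m%:R + b) t.
Proof.
have [t0|t0] := leP t 0; first by rewrite !pk_le0// mul0r.
rewrite !pk_gt0// -powR_mulrn ?powR_ge0// -powRrM -powRD ?(gt_eqF t0) ?implybT//.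
by congr (_ `^ _); ring.
Qed.

(** By the Beta integral, the kernel of order [g] raises the exponent of each term by [g] and
    replaces its Gamma factor by the matching one, so the identity is exact for the partial sums
    [S]. The remainders on both sides are [O(2^-n)] times a power kernel, uniformly up to time
    [|t|]. *)
Lemma conv_mser g b k t : 0 < g -> 0 < b -> geo k ->
  conv (rlk g) (mser k b) t = mser k (b + g) t.
Proof.
move=> g0 b0 hk; have bg0 := addr_gt0 b0 g0.
have hd := entire_mcoef b0 hk; have hd' := entire_mcoef bg0 hk.
pose S b n s := \sum_(0 <= m < n) mcoef b k m * pk (alpha * m%:R + b) s.
have SE c n s : S c n s = pk c s * \sum_(0 <= m < n) mcoef c k m * (s `^ alpha) ^+ m.
  by rewrite /S mulr_sumr; apply: eq_bigr => m _; rewrite mulrCA pk_powR.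
have Wt c m : 0 < c -> W c (fun s => mcoef c k m * pk (alpha * m%:R + c) s).
  move=> c0; apply: W_scale; apply: W_weaken (W_pk _).
  by rewrite lerDr mulr_ge0// ltW.
have WS c n : 0 < c -> W c (S c n) by move=> c0; apply: W_sum => m; exact: Wt.
have cS n : conv (rlk g) (S b n) t = S (b + g) n t.
  rewrite /S (conv_sumr _ _ g0 b0 (W_rlk g)) => [|m]; last exact: Wt.
  apply: eq_bigr => m _; have am := am_gt0 m b0.
  rewrite (convZr _ _ g0 am (W_rlk g) (W_pk _)) (convZl _ _ g0 am (W_pk g) (W_pk _)).
  rewrite conv_pk// /beta /mcoef.
  have -> : g + (alpha * m%:R + b) = alpha * m%:R + (b + g) by ring.
  have := lt0r_neq0 (Gamma_gt0 (am_gt0 m bg0)); have := lt0r_neq0 (Gamma_gt0 am).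
  have := lt0r_neq0 (Gamma_gt0 g0).
  move: (Gamma g) (Gamma _) (Gamma _) => x y z x0 y0 z0.
  by field; rewrite x0 y0 z0.
have [C C0 hC] := ps_tail (powR_ge0 `|t| alpha) hd.
have [C' C0' hC'] := ps_tail (powR_ge0 `|t| alpha) hd'.
have res c D n s : s <= `|t| -> 0 < c ->
   (forall u n, `|u| <= `|t| `^ alpha -> `|ps (mcoef c k) u - \sum_(0 <= m < n) mcoef c k m * u ^+ m| <= D * 2^-1 ^+ n) ->
   `|mser k c s - S c n s| <= D * 2^-1 ^+ n * pk c s.
  move=> st c0 hD; rewrite SE /mser -mulrBr normrM (ger0_norm (pk_ge0 _ _)) mulrC.
  have [s0|s0] := leP s 0; first by rewrite pk_le0// !mulr0.
  by rewrite ler_wpM2r ?pk_ge0// hD// -(normr_id t) powR_le_norm.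
have WD n : W b (fun s => mser k b s - S b n s).
  by apply: W_add; [exact: W_mser|apply: W_opp; exact: WS].
have bound n : `|conv (rlk g) (mser k b) t - mser k (b + g) t| <=
    (C * conv (rlk g) (pk b) t + C' * pk (b + g) t) * 2^-1 ^+ n.
  have -> : conv (rlk g) (mser k b) t - mser k (b + g) t =
      conv (rlk g) (fun s => mser k b s - S b n s) t - (mser k (b + g) t - S (b + g) n t).
    rewrite (convDr _ g0 b0 (W_rlk g) (W_mser b0 hk) (W_opp (WS b n b0))).
    rewrite -cS (_ : conv (rlk g) (fun x => - S b n x) t = - conv (rlk g) (S b n) t).
      by ring.
    rewrite -mulN1r -(convZr _ _ g0 b0 (W_rlk g) (WS b n b0)); apply: eq_conv => // x.
    by rewrite mulN1r.
  rewrite (le_trans (ler_normB _ _))// mulrDl; apply: lerD; last first.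
    by rewrite mulrAC; apply: res => //; exact: ler_norm.
  rewrite mulrAC -(convZr _ _ g0 b0 (W_rlk g) (W_pk b)) /conv.
  have I1 := W_conv_integrable t g0 b0 (W_rlk g) (WD n).
  have I2 := W_conv_integrable t g0 b0 (W_rlk g) (W_scale (C * 2^-1 ^+ n) (W_pk b)).
  apply: (le_trans (le_normr_Rintegral measurableT I1)).
  apply: le_Rintegral => //; first exact: integrable_norm.
  move=> x _; rewrite normrM ger0_norm; last first.
    by rewrite mulr_ge0 ?pk_ge0// invr_ge0 ltW// Gamma_gt0.
  have [x0|x0] := leP `|t| x.
    rewrite /rlk pk_le0; first by rewrite mulr0 !mul0r.
    by rewrite subr_le0 (le_trans (ler_norm t)).
  rewrite ler_wpM2l//; last by apply: res => //; exact: ltW.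
  by rewrite mulr_ge0 ?pk_ge0// invr_ge0 ltW// Gamma_gt0.
apply/eqP; rewrite -subr_eq0 -normr_eq0 eq_le normr_ge0 andbT.
pose K := C * conv (rlk g) (pk b) t + C' * pk (b + g) t.
have cK : K * 2^-1 ^+ n @[n --> \oo] --> 0.
  by apply: cvg_geometric; rewrite ger0_norm// invf_lt1// ltr1n.
rewrite -(cvg_lim (@Rhausdorff R) cK); apply: limr_ge; first by apply/cvg_ex; exists 0.
by near=> n; exact: bound.
Unshelve. all: by end_near.
Qed.

End MittagLefflerSeries.
End PowerSeries.

(** * The Gamma integral along a rotated ray *)

Section RotatedGamma.
Context {R : realType}.
Implicit Types (d x r t s phi : R).

Lemma is_derive_Rintegral (F dF : R -> R -> R) (G : R -> R) a u v : u < a < v ->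
  (forall x r, u < x < v -> is_derive x 1 (F ^~ r) (dF x r)) ->
  (forall x, u < x < v -> mu.-integrable setT (EFin \o F x)) ->
  (forall x r, u < x < v -> `|dF x r| <= G r) ->
  mu.-integrable setT (EFin \o G) ->
  is_derive a 1 (fun x => \int[mu]_r F x r) (\int[mu]_r dF a r).
Proof.
move=> auv der intF bnd intG.
have I x : `]u, v[%classic x -> u < x < v by rewrite /= in_itv.
have d1 x r : u < x < v -> partial1of2 F x r = dF x r.
  by move=> xuv; rewrite /partial1of2 derive1E; have [_ ->] := der x r xuv.
have G0 r : 0 <= G r by apply: le_trans (bnd a r auv).
have Ia : `]u, v[%classic a by rewrite /= in_itv.
have H : h^-1 *: ((fun x => \int[mu]_r F x r) (h + a) - (fun x => \int[mu]_r F x r) a)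
    @[h --> 0^'] --> \int[mu]_r partial1of2 F a r.
  apply: (@cvg_differentiation_under_integral R _ _ mu F setT measurableT a u v Ia _ _ G G0 intG).
  - by move=> x /I; exact: intF.
  - by move=> x r /I xuv _; have [] := der x r xuv.
  - by move=> x r /I xuv _; rewrite d1//; exact: bnd.
have E : \int[mu]_r partial1of2 F a r = \int[mu]_r dF a r.
  by apply: eq_Rintegral => r _; rewrite d1.
rewrite {}E in H.
have H' : h^-1 *: ((fun x => \int[mu]_r F x r) (h *: 1 + a) - (fun x => \int[mu]_r F x r) a)
    @[h --> 0^'] --> \int[mu]_r dF a r.
  by under eq_fun do rewrite /GRing.scale/= mulr1.
split; first by apply/cvg_ex; exists (\int[mu]_r dF a r).
by apply: cvg_lim => //.
Qed.

Lemma pkS s r : pk (s + 1) r = r * pk s r.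
Proof.
rewrite /pk; case: ifP => [r0|]; last by rewrite mulr0.
rewrite (_ : s + 1 - 1 = s - 1 + 1); last by ring.
by rewrite powRD ?(gt_eqF r0) ?implybT// powRr1 ?(ltW r0)// mulrC.
Qed.

(** The phases [0] and [pi / 2] give the real part and minus the imaginary part of the integral of
    [r^(s-1) e^(-r (1 + i d))]. With a free phase, the derivative in [d] is again of this form, with
    [s + 1] and [phi - pi / 2]. *)
Definition gamma_cos s d phi := \int[mu]_r (gamma_kernel s r * cos (d * r - phi)).

Let integrable_gcos (g h : R -> R) : mu.-integrable setT (EFin \o g) ->
  measurable_fun setT h -> (forall r, `|h r| <= 1) ->
  mu.-integrable setT (EFin \o (fun r => g r * h r)).
Proof.
move=> ig mh hh; have mg := measurable_int _ ig.
apply: le_integrable ig => //.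
  by apply/measurable_EFinP/measurable_funM => //; exact/measurable_EFinP.
by move=> r _ /=; rewrite lee_fin normrM ler_piMr.
Qed.

Let norm_cos x : `|cos x| <= 1 :> R.
Proof. by rewrite ler_norml cos_geN1 cos_le1. Qed.

Let norm_sin x : `|sin x| <= 1 :> R.
Proof. by rewrite ler_norml sin_geN1 sin_le1. Qed.

Let measurable_cosl d phi : measurable_fun setT (fun r : R => cos (d * r - phi)).
Proof.
by apply: continuous_measurable_fun => r; apply: is_derive_continuous.
Qed.

Let measurable_sinl d phi : measurable_fun setT (fun r : R => sin (d * r - phi)).
Proof.
by apply: continuous_measurable_fun => r; apply: is_derive_continuous.
Qed.

Lemma integrable_gamma_cos s d phi : 0 < s ->
  mu.-integrable setT (EFin \o (fun r => gamma_kernel s r * cos (d * r - phi))).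
Proof. by move=> s0; apply: integrable_gcos => //; exact: integrable_gamma_kernel. Qed.

Lemma is_derive_gamma_cos s d phi : 0 < s ->
  is_derive d 1 (fun d => gamma_cos s d phi) (gamma_cos (s + 1) d (phi - pi / 2)).
Proof.
move=> s0; have s1 : 0 < s + 1 by rewrite addr_gt0.
apply: (@is_derive_Rintegral (fun x r => gamma_kernel s r * cos (x * r - phi))
  (fun x r => gamma_kernel (s + 1) r * cos (x * r - (phi - pi / 2)))
  (gamma_kernel (s + 1)) d (d - 1) (d + 1)).
- by apply/andP; split; lra.
- move=> x r _; apply: is_derive_eq.
  rewrite /GRing.scale /= /gamma_kernel pkS.
  by rewrite opprB addrA addrAC cosDpihalf; ring.
- by move=> x _; exact: integrable_gamma_cos.
- move=> x r _; rewrite normrM ger0_norm ?gamma_kernel_ge0// ler_piMr ?gamma_kernel_ge0//.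
- exact: integrable_gamma_kernel.
Qed.

Lemma integrable_scale (f : R -> R) a : a != 0 -> mu.-integrable setT (EFin \o f) ->
  mu.-integrable setT (EFin \o (fun x => f (a * x))).
Proof.
move=> a0 /integrableP[/measurable_EFinP mf fi]; apply/integrableP; split.
  apply/measurable_EFinP; apply: (measurableT_comp mf).
  by apply: measurable_funM => //; exact: measurable_cst.
have mF : measurable_fun setT (fun x : R => (`|f x|%:E : \bar R)).
  by apply/measurable_EFinP; exact: measurableT_comp.
have := integral_affine 0 a0 mF => E.
rewrite (_ : (\int[mu]_x _)%E = (\int[mu]_x (`|f (a * x + 0)|)%:E)%E); last first.
  by apply: eq_integral => x _; rewrite addr0.
rewrite E; apply: lte_mul_pinfty => //; rewrite ?lee_fin ?invr_ge0//.
Qed.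

Let pk_scale s x r : 0 < x -> pk s (x * r) = x `^ (s - 1) * pk s r.
Proof.
move=> x0; rewrite /pk pmulr_rgt0//; case: ifPn => y0; last by rewrite mulr0.
by rewrite powRM// ltW.
Qed.

Lemma integrable_pk_exp s x : 0 < s -> 0 < x ->
  mu.-integrable setT (EFin \o (fun r => pk s r * expR (- (x * r)))).
Proof.
move=> s0 x0; have := integrable_scale (lt0r_neq0 x0) (integrable_gamma_kernel s0).
move=> /(integrableZl measurableT (x `^ (s - 1))^-1); apply: eq_integrable => // r _ /=.
by rewrite -EFinM /gamma_kernel pk_scale// -mulrA mulKf// gt_eqF// powR_gt0.
Qed.

Lemma integrable_pk_exp_cos s x d phi : 0 < s -> 0 < x ->
  mu.-integrable setT (EFin \o (fun r => pk s r * expR (- (x * r)) * cos (d * r - phi))).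
Proof. by move=> s0 x0; apply: integrable_gcos => //; exact: integrable_pk_exp. Qed.

(** The substitution [r -> x r] brings out [x^(-s)]. Read from right to left, it writes a power
    kernel as a superposition of damped oscillations in [x]. *)
Lemma gamma_cos_scale s d phi x : 0 < s -> 0 < x ->
  \int[mu]_r (pk s r * expR (- (x * r)) * cos (x * d * r - phi)) =
  x `^ (- s) * gamma_cos s d phi.
Proof.
move=> s0 x0; have xn0 := lt0r_neq0 x0.
have mf : measurable_fun setT (fun r => gamma_kernel s r * cos (d * r - phi)).
  by apply: measurable_funM => //; exact: measurable_gamma_kernel.
have := Rintegral_affine 0 xn0 mf; rewrite (gtr0_norm x0) => h.
have xs0 : x `^ (s - 1) != 0 by rewrite gt_eqF// powR_gt0.
apply: (mulfI xs0).
rewrite -(RintegralZl _ measurableT (integrable_pk_exp_cos (x * d) phi s0 x0)).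
transitivity (\int[mu]_r (gamma_kernel s (x * r + 0) * cos (d * (x * r + 0) - phi))).
  apply: eq_Rintegral => r _; rewrite addr0 /gamma_kernel pk_scale// !mulrA.
  by rewrite (mulrC d x).
rewrite h mulrA -powRD ?xn0 ?implybT//.
by rewrite addrC addrA addNr sub0r powR_inv1// ltW.
Qed.

(** The scaling identity is differentiated at [x = 1]: under the integral sign on one side, through
    [x^(-s)] on the other. Equating the two derivatives has the effect of an integration by
    parts. *)
Lemma gamma_cos_ibp s d phi : 0 < s ->
  gamma_cos (s + 1) d phi + d * gamma_cos (s + 1) d (phi + pi / 2) = s * gamma_cos s d phi.
Proof.
move=> s0; have s1 : 0 < s + 1 by rewrite addr_gt0.
have h2 : 0 < 2^-1 :> R by rewrite invr_gt0.
pose F (x r : R) := pk s r * expR (- (x * r)) * cos (x * d * r - phi).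
pose dF (x r : R) := - (pk (s + 1) r * expR (- (x * r)) * (cos (x * d * r - phi) + d * sin (x * d * r - phi))).
have D1 : is_derive (1 : R) 1 (fun x : R => \int[mu]_r F x r) (\int[mu]_r dF 1 r).
  (* For [x] in the window []1/2, 2[] the factor [e^(-x r)] is dominated by [e^(-r/2)], still
     integrable against [pk (s + 1)]. *)
  apply: (@is_derive_Rintegral F dF
    (fun r => (1 + `|d|) * (pk (s + 1) r * expR (- (2^-1 * r)))) 1 2^-1 2).
  - by apply/andP; split; lra.
  - move=> x r _; rewrite /F /dF; apply: is_derive_eq.
    by rewrite /GRing.scale /= pkS; ring.
  - by move=> x /andP[x0 _]; apply: integrable_pk_exp_cos => //; exact: lt_trans x0.
  - move=> x r /andP[x0 _]; rewrite /dF normrN normrM.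
    rewrite ger0_norm ?mulr_ge0 ?pk_ge0 ?expR_ge0// mulrC.
    apply: ler_pM; rewrite ?mulr_ge0 ?pk_ge0 ?expR_ge0//.
      rewrite (le_trans (ler_normD _ _))// lerD// normrM.
      by rewrite -[leRHS]mulr1 ler_wpM2l.
    have [r0|r0] := leP r 0; first by rewrite pk_le0// !mul0r.
    by rewrite ler_wpM2l ?pk_ge0// ler_expR lerN2 ler_wpM2r ?(ltW r0)// ltW.
  - exact: (integrableZl measurableT _ (integrable_pk_exp s1 h2)).
have D2 : is_derive (1 : R) 1 (fun x : R => \int[mu]_r F x r) (- s * gamma_cos s d phi).
  apply: (@near_eq_is_derive _ _ _ (fun x : R => gamma_cos s d phi *: x `^ (- s))).
    near=> x; transitivity (x `^ (- s) * gamma_cos s d phi).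
      by rewrite /GRing.scale/= mulrC.
    apply/esym; apply: gamma_cos_scale => //.
    near: x; apply: open_nbhs_nbhs; split; [exact: (@open_gt R 0)|exact: ltr01].
  have := is_deriveZ (gamma_cos s d phi) (is_derive1_powR (- s) (@ltr01 R)).
  by rewrite /GRing.scale /= powR1 mulr1 mulrC.
have E : \int[mu]_r dF 1 r = - s * gamma_cos s d phi.
  by case: D1 => _ <-; case: D2 => _ <-.
move: E; rewrite mulNr => /(congr1 (@GRing.opp R)); rewrite opprK => <-.
have I1 := integrable_gamma_cos d phi s1.
have I2 := integrable_gamma_cos d (phi + pi / 2) s1.
rewrite -(RintegralZl _ measurableT I2) -RintegralD//; last first.
  exact: (integrableZl measurableT _ I2).
rewrite -[RHS]mulN1r -RintegralZl//.
  apply: eq_Rintegral => r _; rewrite /dF /gamma_kernel !mul1r opprD addrA cosBpihalf.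
  by ring.
have := integrableD measurableT (integrableZl measurableT (-1) I1) (integrableZl measurableT (- d) I2).
apply: eq_integrable => // r _ /=; rewrite -!EFinM -EFinD; congr EFin.
by rewrite /dF /gamma_kernel !mul1r opprD addrA cosBpihalf; ring.
Unshelve. all: by end_near.
Qed.

Let gamma_cosN s d : 0 < s -> gamma_cos s d (- (pi / 2)) = - gamma_cos s d (pi / 2).
Proof.
move=> s0; rewrite -[RHS]mulN1r /gamma_cos -RintegralZl//; last exact: integrable_gamma_cos.
apply: eq_Rintegral => r _.
by rewrite opprK cosDpihalf cosBpihalf; ring.
Qed.

Let gamma_cospi s d : 0 < s -> gamma_cos s d (pi / 2 + pi / 2) = - gamma_cos s d 0.
Proof.
move=> s0; rewrite -[RHS]mulN1r /gamma_cos -RintegralZl//; last exact: integrable_gamma_cos.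
apply: eq_Rintegral => r _.
by rewrite opprD addrA cosBpihalf sinBpihalf subr0; ring.
Qed.

(** The modulus of [Gamma s (1 + i d)^(-s)]; the argument is [- s * atan d]. *)
Definition gamma_mod s d := Gamma s * expR (- (s / 2 * ln (1 + d ^+ 2))).

Lemma gamma_mod_gt0 s d : 0 < s -> 0 < gamma_mod s d.
Proof. by move=> s0; rewrite mulr_gt0 ?Gamma_gt0 ?expR_gt0. Qed.

(* [int_0^oo r^(s-1) e^(-r (1 + i d)) dr = Gamma s (1 + i d)^(-s)]; the integral
   solves the same first-order differential equation in [d] as the right-hand side. *)
Lemma gamma_cosE s d : 0 < s ->
  gamma_cos s d 0 = gamma_mod s d * cos (s * atan d) /\
  gamma_cos s d (pi / 2) = gamma_mod s d * sin (s * atan d).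
Proof.
move=> s0; have s1 : 0 < s + 1 by rewrite addr_gt0.
pose C (x : R) := gamma_cos s x 0; pose S (x : R) := gamma_cos s x (pi / 2).
pose C1 (x : R) := gamma_cos (s + 1) x 0; pose S1 (x : R) := gamma_cos (s + 1) x (pi / 2).
have x2 (x : R) : 0 < 1 + x ^+ 2 by rewrite ltr_pwDl// sqr_ge0.
have x2n (x : R) := lt0r_neq0 (x2 x).
have dC (x : R) : is_derive x 1 C (- S1 x).
  by have := is_derive_gamma_cos x 0 s0; rewrite sub0r gamma_cosN.
have dS (x : R) : is_derive x 1 S (C1 x).
  by have := is_derive_gamma_cos x (pi / 2) s0; rewrite subrr.
have R1 x : C1 x + x * S1 x = s * C x.
  by have := gamma_cos_ibp x 0 s0; rewrite add0r.
have R2 x : S1 x - x * C1 x = s * S x.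
  by have := gamma_cos_ibp x (pi / 2) s0; rewrite gamma_cospi// mulrN.
(* [R1] and [R2] are linear equations for [C1] and [S1] with determinant [1 + x^2]. Solving them
   closes the differential system for [C] and [S]. *)
have C1E x : C1 x = s * (C x - x * S x) / (1 + x ^+ 2).
  have -> : s * (C x - x * S x) = (1 + x ^+ 2) * C1 x.
    by rewrite mulrBr mulrCA -R1 -R2; ring.
  by rewrite mulrC mulKf.
have S1E x : S1 x = s * (S x + x * C x) / (1 + x ^+ 2).
  have -> : s * (S x + x * C x) = (1 + x ^+ 2) * S1 x.
    by rewrite mulrDr mulrCA -R1 -R2; ring.
  by rewrite mulrC mulKf.
pose E (x : R) := expR (s / 2 * ln (1 + x ^+ 2)).
have dE (x : R) : is_derive x 1 E (E x * (s * x / (1 + x ^+ 2))).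
  have dl := is_derive1_ln (x2 x).
  have dl2 : is_derive x 1 (fun x : R => 1 + x ^+ 2) (2 * x).
    by apply: is_derive_eq; rewrite /GRing.scale /=; ring.
  have := @is_derive1_comp R (@ln R) (fun x : R => 1 + x ^+ 2) x _ _ dl dl2.
  move=> dl3; have dl4 := is_deriveZ (s / 2) dl3.
  have h := @is_derive1_comp R (@expR R) _ x _ _ (is_derive_expR _) dl4.
  have -> : E x * (s * x / (1 + x ^+ 2)) =
      expR (s / 2 * ln (1 + x ^+ 2)) * ((s / 2) *: ((1 + x ^+ 2)^-1 * (2 * x))).
    by rewrite /E /GRing.scale /=; field.
  exact: h.
have dth (x : R) : is_derive x 1 (fun x : R => s * atan x) (s / (1 + x ^+ 2)).
  by apply: is_derive_eq; rewrite /GRing.scale /=.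
have dc (x : R) : is_derive x 1 (fun x : R => cos (s * atan x)) (- sin (s * atan x) * (s / (1 + x ^+ 2))).
  exact: (@is_derive1_comp R (@cos R) _ x _ _ (is_derive_cos _) (dth x)).
have ds (x : R) : is_derive x 1 (fun x : R => sin (s * atan x)) (cos (s * atan x) * (s / (1 + x ^+ 2))).
  exact: (@is_derive1_comp R (@sin R) _ x _ _ (is_derive_sin _) (dth x)).
(* [P - i Q] is the integral [C - i S] multiplied by [(1 + i x)^s], where [E] is the modulus of that
   power. Both are constant, equal to their values [Gamma s] and [0] at [x = 0]. *)
pose P (x : R) := E x * (C x * cos (s * atan x) + S x * sin (s * atan x)).
pose Q (x : R) := E x * (S x * cos (s * atan x) - C x * sin (s * atan x)).
have dP (x : R) : is_derive x 1 P 0.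
  have h := is_deriveM (dE x) (is_deriveD (is_deriveM (dC x) (dc x)) (is_deriveM (dS x) (ds x))).
  apply: is_derive_eq h _; rewrite /GRing.scale /= !fctE C1E S1E.
  by field.
have dQ (x : R) : is_derive x 1 Q 0.
  have h := is_deriveM (dE x) (is_deriveB (is_deriveM (dS x) (dc x)) (is_deriveM (dC x) (ds x))).
  apply: is_derive_eq h _; rewrite /GRing.scale /= !fctE C1E S1E.
  by field.
have C0 : C 0 = Gamma s.
  rewrite GammaE; apply: eq_Rintegral => r _.
  by rewrite mul0r subrr cos0 mulr1.
have S0 : S 0 = 0.
  rewrite /S /gamma_cos; under eq_Rintegral do rewrite mul0r sub0r cosN cos_pihalf mulr0.
  by rewrite Rintegral_cst// mul0r.
have E0 : E 0 = 1 by rewrite /E expr0n/= addr0 ln1 mulr0 expR0.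
have PE := is_derive_0_is_cst d 0 dP; have QE := is_derive_0_is_cst d 0 dQ.
move: PE QE; rewrite /P /Q atan0 mulr0 cos0 sin0 C0 S0 E0 !mulr0 !mulr1 !mul1r addr0 subr0 => PE QE.
have En : E d != 0 by rewrite gt_eqF// expR_gt0.
have QE' : S d * cos (s * atan d) - C d * sin (s * atan d) = 0.
  by apply: (mulfI En); rewrite mulr0.
have PE' : C d * cos (s * atan d) + S d * sin (s * atan d) = gamma_mod s d.
  by apply: (mulfI En); rewrite PE /gamma_mod expRN -/(E d) mulrCA mulfV// mulr1.
have cs := cos2Dsin2 (s * atan d).
split.
  rewrite -PE' -/(C d).
  transitivity (C d * (cos (s * atan d) ^+ 2 + sin (s * atan d) ^+ 2) +
     (S d * cos (s * atan d) - C d * sin (s * atan d)) * sin (s * atan d)).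
    by rewrite QE' mul0r addr0 cs mulr1.
  by ring.
rewrite -PE' -/(S d).
transitivity (S d * (cos (s * atan d) ^+ 2 + sin (s * atan d) ^+ 2) -
     (S d * cos (s * atan d) - C d * sin (s * atan d)) * cos (s * atan d)).
  by rewrite QE' mul0r subr0 cs mulr1.
by ring.
Qed.

End RotatedGamma.

(** * Positivity of the exponential kernel *)

Section ExponentialKernel.
Context {R : realType}.
Implicit Types (f p F : R -> R) (r t T x : R).

(** The base point [-1] lies to the left of [0], so the primitive is differentiable at [0] itself
    and on all of [[0, T]]. *)
Lemma continuous_primitive f : continuous f ->
  exists F, forall x, -1 < x -> is_derive x 1 F (f x).
Proof.
move=> cf; exists (fun x => \int[mu]_(t in `[-1, x]) f t) => x x1.
have [||d1 d2] := @continuous_FTC1_closed R f (-1) x (x + 1) _ _ x1 (cf x).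
- by rewrite ltrDl.
- by apply: continuous_itv_integrable => y _; exact: cf.
- by split; [exact: d1|rewrite -derive1E; exact: d2].
Qed.

Lemma Rintegral_primitive f F T : 0 <= T ->
  (forall x, -1 < x -> {for x, continuous f}) ->
  (forall x, -1 < x -> is_derive x 1 F (f x)) ->
  \int[mu]_(t in `]0, T[) f t = F T - F 0.
Proof.
rewrite le_eqVlt => /predU1P[<- _ _|T0 cf dF].
  by rewrite set_itv_ge ?bnd_simp// Rintegral_set0 subrr.
by apply: Rintegral_FTC => // x /andP[x0 _]; [apply: cf|apply: dF]; lra.
Qed.

(* With [Z t = int_0^t e^(r x) p x dx] and [H = e^(-2 r t) Z^2 / 2], the integrand is [H' + 2 r H]. *)
Lemma exp_kernel_ge0 p r T : 0 <= r -> 0 <= T -> continuous p ->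
  let G := fun t => p t * (expR (- (r * t)) * \int[mu]_(x in `]0, t[) (expR (r * x) * p x)) in
  mu.-integrable `]0, T[ (EFin \o G) /\ 0 <= \int[mu]_(t in `]0, T[) G t.
Proof.
move=> r0 T0 cp.
have cexp (c : R) : continuous (fun x : R => expR (c * x)).
  by move=> x; apply: is_derive_continuous.
have cg : continuous (fun x => expR (r * x) * p x).
  exact: continuous_funM.
have [G dG] := continuous_primitive cg.
have cG x : -1 < x -> {for x, continuous G}.
  by move=> /dG; exact: is_derive_continuous.
pose Z t := G t - G 0.
have cZ x : -1 < x -> {for x, continuous Z}.
  by move=> x1; apply: cvgB; [exact: cG|exact: cvg_cst].
pose H t := expR (- 2 * r * t) * (Z t * Z t) / 2.
pose h t := p t * (expR (- r * t) * Z t) - 2 * r * H t.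
have dH x : -1 < x -> is_derive x 1 H (h x).
  move=> x1; have dGx := dG x x1; rewrite /H /Z; apply: is_derive_eq.
  have e0 : expR (r * x) != 0 by rewrite gt_eqF// expR_gt0.
  have e1 : expR (- r * x) = (expR (r * x))^-1 by rewrite -expRN mulNr.
  have e2 : expR (- 2 * r * x) = (expR (r * x))^-1 * (expR (r * x))^-1.
    by rewrite -expRN -expRD; congr expR; ring.
  rewrite /GRing.scale /= /h /H /Z e1 e2.
  by field.
have cE x : -1 < x -> {for x, continuous (fun t => p t * (expR (- r * t) * Z t))}.
  move=> x1; apply: cvgM; first exact: cp.
  by apply: cvgM; [exact: cexp|exact: cZ].
have cH x : -1 < x -> {for x, continuous H}.
  by move=> /dH; exact: is_derive_continuous.
have ch x : -1 < x -> {for x, continuous h}.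
  move=> x1; apply: cvgB; first exact: cE.
  by apply: cvgM; [exact: cvg_cst|exact: cH].
have IT f : (forall x, -1 < x -> {for x, continuous f}) -> mu.-integrable `]0, T[ (EFin \o f).
  move=> cf; apply: continuous_itvoo_integrable => x /andP[x0 _]; apply: cf; lra.
have H0 t : 0 <= H t.
  by rewrite divr_ge0// mulr_ge0 ?expR_ge0// -expr2 sqr_ge0.
have EG t : t \in `]0, T[%classic -> p t * (expR (- r * t) * Z t) =
    p t * (expR (- (r * t)) * \int[mu]_(x in `]0, t[) (expR (r * x) * p x)).
  rewrite inE/= in_itv/= => /andP[t0 _].
  rewrite mulNr; congr (_ * (_ * _)); apply/esym/Rintegral_primitive; first exact: ltW.
  by move=> x _; exact: cg.
split.
  by apply: eq_integrable (IT _ cE) => // t tT /=; rewrite EG.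
rewrite (_ : \int[mu]_(t in `]0, T[) _ =
    \int[mu]_(t in `]0, T[) (p t * (expR (- r * t) * Z t))); last first.
  by apply: eq_Rintegral => t /EG.
apply: (@le_trans _ _ (\int[mu]_(t in `]0, T[) h t)).
  by rewrite (Rintegral_primitive T0 ch dH) [H 0]/H /Z subrr mul0r mulr0 mul0r subr0.
apply: le_Rintegral => //; [exact: IT|exact: IT|].
by move=> t _; rewrite /h lerBlDr lerDl mulr_ge0// mulr_ge0.
Qed.

End ExponentialKernel.

(** * Lebesgue measure on the plane *)

Section PlaneMeasure.
Context {R : realType}.
Local Notation mu := (@lebesgue_measure R).

(** The positivity proof applies Fubini to the product of the [(t, x)]-plane with the [r]-axis, so
    the plane measure must itself be a sigma-finite factor. Growing squares exhaust it. *)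
Lemma sigma_finite_plane : sigma_finite setT (mu \x mu)%E.
Proof.
exists (fun n => `[- (n%:R : R), n%:R] `*` `[- (n%:R : R), n%:R]).
  apply/seteqP; split => // -[x y] _.
  have h z : `|z| <= `|x| + `|y| -> `[- (Num.truncn (`|x| + `|y|)).+1%:R, (Num.truncn (`|x| + `|y|)).+1%:R]%classic z.
    move=> hz; rewrite /= in_itv/= -ler_norml (le_trans hz)// ltW//.
    by rewrite truncnS_gt.
  by exists (Num.truncn (`|x| + `|y|)).+1 => //; split; apply: h; rewrite ?lerDl ?lerDr.
move=> n; have m : measurable (`[- n%:R, n%:R] : set (measurableTypeR R)) by exact: measurable_itv.
split; first exact: measurableX.
have F : (mu `[(- n%:R)%R, n%:R%R]%classic < +oo)%E.
  by rewrite lebesgue_measure_itv/=; case: ifP => // _; rewrite -EFinD ltry.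
by rewrite product_measure1E// lte_mul_pinfty// ge0_fin_numE.
Qed.

Definition plane_measure : {sigma_finite_measure set (measurableTypeR R * measurableTypeR R)%type -> \bar R} :=
  HB.pack (mu \x mu)%E (Measure_isSigmaFinite.Build _ _ _ (mu \x mu)%E sigma_finite_plane).

End PlaneMeasure.

(** * Positive type of the rotated power kernel, and the scalar energy inequality *)

Section KernelPositivity.
Context {R : realType}.
Local Notation mu := (@lebesgue_measure R).
Context (alpha : R) (alpha_gt0 : 0 < alpha) (alpha_lt1 : alpha < 1).
Implicit Types (a b f g p : R -> R) (d r t T x M : R).
Let sigma := 1 - alpha.
Let sigma_gt0 : 0 < sigma. Proof. by rewrite subr_gt0. Qed.

Definition chi T t : R := if 0 < t < T then 1 else 0.

Lemma chi_ge0 T t : 0 <= chi T t.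
Proof. by rewrite /chi; case: ifP. Qed.

Lemma measurable_chi T : measurable_fun setT (chi T).
Proof.
have -> : chi T = (cst 1 : R -> R) \_ `]0, T[.
  by apply/funext => t; rewrite patchE mem_setE in_itv.
by apply/(measurable_restrictT _ _).1.
Qed.

Lemma W_chi T f M : 0 <= M -> measurable_fun setT f ->
  (forall t, `|f t| <= M * chi T t) -> W 1 f.
Proof.
move=> M0 mf hM; split=> // S; exists M => // t _; apply: (le_trans (hM t)).
rewrite /chi; case: ifPn => [/andP[t0 _]|_]; last by rewrite mulr0 mulr_ge0// pk_ge0.
by rewrite pk_gt0// subrr powRr0.
Qed.

Lemma integrable_chi T f C : measurable_fun setT f -> (forall t, `|f t| <= C * chi T t) ->
  mu.-integrable setT (EFin \o f).
Proof.
move=> mf hf.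
have : mu.-integrable setT (EFin \o cst C \_ `]0, T[).
  apply: integrable_patch => //.
  by apply: continuous_itvoo_integrable => x _; exact: cvg_cst.
apply: le_integrable => //; first exact/measurable_EFinP.
move=> t _ /=; rewrite patchE mem_setE in_itv/= lee_fin (le_trans (hf t))//.
by rewrite /chi; case: ifP => _; rewrite ?mulr1 ?mulr0 ?ler_norm.
Qed.

Lemma conv_chi_bound k g T M : 0 < k -> 0 <= M -> measurable_fun setT g ->
  (forall t, `|g t| <= M * chi T t) ->
  exists2 C, 0 <= C & forall t, 0 < t < T -> `|conv (pk k) g t| <= C.
Proof.
move=> k0 M0 mg hg; have wc := W_conv k0 ltr01 (W_pk k) (W_chi M0 mg hg).
have [C C0 hC] := wc.2 `|T|; exists (C * `|T| `^ k); first by rewrite mulr_ge0// powR_ge0.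
move=> t /andP[t0 tT]; apply: (le_trans (hC t (le_trans (ltW tT) (ler_norm T)))).
rewrite ler_wpM2l// pk_gt0// addrK ge0_ler_powR ?nnegrE ?(ltW t0) ?(ltW k0)//.
by rewrite (le_trans (ltW tT))// ler_norm.
Qed.

Lemma form_integrable k T f g M : 0 < k -> 0 <= M -> measurable_fun setT f -> measurable_fun setT g ->
  (forall t, `|f t| <= M * chi T t) -> (forall t, `|g t| <= M * chi T t) ->
  mu.-integrable setT (EFin \o (fun t => f t * conv (pk k) g t)).
Proof.
move=> k0 M0 mf mg hf hg.
have wc := W_conv k0 ltr01 (W_pk k) (W_chi M0 mg hg).
have [C C0 hC] := conv_chi_bound k0 M0 mg hg.
apply: (@integrable_chi T _ (M * C)).
  by apply: measurable_funM => //; exact: W_measurable wc.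
move=> t; rewrite normrM; have := hf t; rewrite /chi; case: ifPn => h hft.
  by rewrite !mulr1 in hft *; apply: ler_pM => //; exact: hC.
by rewrite !mulr0 in hft *; apply: mulr_le0_ge0.
Qed.

Section Rotated.
Context (A B : R -> R) (M T d : R) (M0 : 0 <= M).
Context (mA : measurable_fun setT A) (mB : measurable_fun setT B).
Context (hA : forall t, `|A t| <= M * chi T t) (hB : forall t, `|B t| <= M * chi T t).
Let psi := sigma * atan d.
(** For [z = A + i B], [X] and [Y] are the real and imaginary parts of [conj (z q.1) * z q.2], and
    [rot] is the real part of that product times [e^(-i u d r)]. The phase [- 0] keeps the shape of
    [gamma_cos]. *)
Let X (q : R * R) := A q.1 * A q.2 + B q.1 * B q.2.
Let Y (q : R * R) := A q.1 * B q.2 - B q.1 * A q.2.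
Let u (q : R * R) := q.1 - q.2.
Let rot (q : R * R) r := cos (u q * d * r - 0) * X q + cos (u q * d * r - pi / 2) * Y q.
(** Integrated over [r], this is the rotated power kernel applied to [X] and [Y]; integrated over
    the plane at fixed [r], it is the quadratic form of one damped oscillation. *)
Let Phi (z : (R * R) * R) :=
  pk 1 (u z.1) * (pk sigma z.2 * expR (- (u z.1 * z.2)) * rot z.1 z.2).

Let measurable_u : measurable_fun setT u.
Proof. by apply: measurable_funB; [exact: measurable_fst|exact: measurable_snd]. Qed.

Let mfst f : measurable_fun setT f -> measurable_fun setT (fun q : R * R => f q.1).
Proof. by move=> mf; apply: (measurableT_comp mf); exact: measurable_fst. Qed.

Let msnd f : measurable_fun setT f -> measurable_fun setT (fun q : R * R => f q.2).
Proof. by move=> mf; apply: (measurableT_comp mf); exact: measurable_snd. Qed.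

Let measurable_X : measurable_fun setT X.
Proof. by apply: measurable_funD; apply: measurable_funM; (exact: mfst || exact: msnd). Qed.

Let measurable_Y : measurable_fun setT Y.
Proof. by apply: measurable_funB; apply: measurable_funM; (exact: mfst || exact: msnd). Qed.

Let chi2 (q : R * R) := chi T q.1 * chi T q.2.

Let chi2_ge0 q : 0 <= chi2 q. Proof. by rewrite mulr_ge0// chi_ge0. Qed.

Let prod_bound f g (q : R * R) : (forall t, `|f t| <= M * chi T t) ->
  (forall t, `|g t| <= M * chi T t) -> `|f q.1 * g q.2| <= M * M * chi2 q.
Proof. by move=> hf hg; rewrite normrM /chi2 mulrACA; apply: ler_pM. Qed.

Let bound_X q : `|X q| <= 2 * (M * M * chi2 q).
Proof.
by rewrite (le_trans (ler_normD _ _))// mulrDl !mul1r lerD// prod_bound.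
Qed.

Let bound_Y q : `|Y q| <= 2 * (M * M * chi2 q).
Proof.
by rewrite (le_trans (ler_normB _ _))// mulrDl !mul1r lerD// prod_bound.
Qed.

Let norm_cos x : `|cos x| <= 1 :> R.
Proof. by rewrite ler_norml cos_geN1 cos_le1. Qed.

Let K := 4 * (M * M).
Let K0 : 0 <= K. Proof. by rewrite !mulr_ge0. Qed.

Let bound_rot q r : `|rot q r| <= K * chi2 q.
Proof.
have h x Z : `|Z| <= 2 * (M * M * chi2 q) -> `|cos x * Z| <= 2 * (M * M * chi2 q).
  by move=> hZ; rewrite normrM (le_trans (ler_piMl _ _))// normr_ge0.
rewrite (le_trans (ler_normD _ _))// (le_trans (lerD (h _ _ (bound_X q)) (h _ _ (bound_Y q))))//.
by rewrite /K; lra.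
Qed.

Let bound_Phi q r :
  `|Phi (q, r)| <= K * chi2 q * (pk 1 (u q) * (pk sigma r * expR (- (u q * r)))).
Proof.
rewrite /Phi /= mulrA normrM [leRHS]mulrC; apply: ler_pM => //.
by rewrite ger0_norm// mulr_ge0 ?pk_ge0// mulr_ge0 ?pk_ge0// expR_ge0.
Qed.

Let measurable_Phi : measurable_fun setT Phi.
Proof.
have mu1 : measurable_fun setT (fun z : (R * R) * R => u z.1).
  by apply: (measurableT_comp measurable_u); exact: measurable_fst.
have m2 : measurable_fun setT (fun z : (R * R) * R => z.2) by exact: measurable_snd.
have mc c : measurable_fun setT (fun z : (R * R) * R => cos (u z.1 * d * z.2 - c)).
  apply: (measurableT_comp (continuous_measurable_fun (@continuous_cos R))).
  apply: measurable_funB => //; apply: measurable_funM => //; apply: measurable_funM => //.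
have mfstX (F : R * R -> R) : measurable_fun setT F -> measurable_fun setT (fun z : (R * R) * R => F z.1).
  by move=> mF; apply: (measurableT_comp mF); exact: measurable_fst.
apply: measurable_funM; first exact: (measurableT_comp (measurable_pk 1)).
apply: measurable_funM.
  apply: measurable_funM; first exact: (measurableT_comp (measurable_pk sigma)).
  by apply: (measurableT_comp (@measurable_expR R)); apply: measurableT_comp => //; exact: measurable_funM.
apply: measurable_funD; apply: measurable_funM; rewrite ?mc//.
- exact: mfstX.
- exact: mfstX.
Qed.

Let pk1_scale q : pk 1 (u q) * (u q) `^ (- sigma) = pk alpha (u q).
Proof.
rewrite /pk; case: ifP => _; last by rewrite mul0r.
by rewrite subrr powRr0 mul1r opprB.
Qed.

(** The majorant of [Phi] is handled by the scaling identity at frequency [0]: its [r]-integral is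
    again a multiple of [pk alpha (u q)]. *)
Let integral_dom q :
  mu.-integrable setT (EFin \o (fun r => K * chi2 q * (pk 1 (u q) * (pk sigma r * expR (- (u q * r)))))) /\
  \int[mu]_r (K * chi2 q * (pk 1 (u q) * (pk sigma r * expR (- (u q * r))))) =
  K * Gamma sigma * (chi2 q * pk alpha (u q)).
Proof.
have [u0|u0] := leP (u q) 0.
  rewrite !(pk_le0 _ u0) !mulr0; split.
    by apply: (eq_integrable measurableT (cst 0%E)) => [r _ /=|]; [rewrite mul0r mulr0|exact: integrable0].
  under eq_Rintegral do rewrite mul0r mulr0.
  by rewrite Rintegral_cst// mul0r.
have I := integrable_pk_exp sigma_gt0 u0.
split.
  have := integrableZl measurableT (K * chi2 q * pk 1 (u q)) I.
  by apply: eq_integrable => // r _ /=; rewrite -EFinM; congr EFin; ring.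
transitivity (\int[mu]_r ((K * chi2 q * pk 1 (u q)) * (pk sigma r * expR (- (u q * r))))).
  by apply: eq_Rintegral => r _; ring.
rewrite RintegralZl//.
have -> : \int[mu]_r (pk sigma r * expR (- (u q * r))) = (u q) `^ (- sigma) * Gamma sigma.
  have := gamma_cos_scale 0 0 sigma_gt0 u0.
  have -> : gamma_cos sigma 0 0 = Gamma sigma.
    by rewrite GammaE; apply: eq_Rintegral => r _; rewrite mul0r subrr cos0 mulr1.
  by move=> <-; apply: eq_Rintegral => r _; rewrite mulr0 mul0r subrr cos0 mulr1.
by rewrite -pk1_scale; ring.
Qed.

Let integral_Phi q : \int[mu]_r Phi (q, r) =
  gamma_mod sigma d * (pk alpha (u q) * (cos psi * X q + sin psi * Y q)).
Proof.
have [u0|u0] := leP (u q) 0.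
  rewrite (pk_le0 _ u0) mul0r mulr0 /Phi /=.
  under eq_Rintegral do rewrite (pk_le0 _ u0) mul0r.
  by rewrite Rintegral_cst// mul0r.
have I1 := integrable_pk_exp_cos (u q * d) 0 sigma_gt0 u0.
have I2 := integrable_pk_exp_cos (u q * d) (pi / 2) sigma_gt0 u0.
have [g1 g2] := gamma_cosE d sigma_gt0.
transitivity (\int[mu]_r ((pk 1 (u q) * X q) * (pk sigma r * expR (- (u q * r)) * cos (u q * d * r - 0)) +
   (pk 1 (u q) * Y q) * (pk sigma r * expR (- (u q * r)) * cos (u q * d * r - pi / 2)))).
  by apply: eq_Rintegral => r _; rewrite /Phi /rot /=; ring.
rewrite RintegralD//; last 2 first.
- exact: (integrableZl measurableT _ I1).
- exact: (integrableZl measurableT _ I2).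
rewrite !RintegralZl// !gamma_cos_scale// g1 g2 -pk1_scale /psi.
by ring.
Qed.

Let measurable_EPhi : measurable_fun setT (EFin \o Phi).
Proof. by apply/measurable_EFinP. Qed.

Local Notation mu2 := (@plane_measure R).

(** Integrating the majorant over [r] leaves a multiple of the form of [pk alpha] on the indicator
    [chi T], which is finite. This justifies the exchange of the plane and [r] integrals. *)
Let integral_abs_Phi : (\int[mu2]_q \int[mu]_r `|(Phi (q, r))%:E| < +oo)%E.
Proof.
have mG : measurable_fun setT (fun q : R * R => (K * Gamma sigma * (chi2 q * pk alpha (u q)))%:E).
  apply/measurable_EFinP; apply: measurable_funM; first exact: measurable_cst.
  apply: measurable_funM; last exact: (measurableT_comp (measurable_pk alpha)).
  by apply: measurable_funM; [apply: mfst|apply: msnd]; exact: measurable_chi.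
have KG0 : 0 <= K * Gamma sigma by rewrite mulr_ge0// ltW// Gamma_gt0.
apply: (@le_lt_trans _ _ (\int[mu2]_q (K * Gamma sigma * (chi2 q * pk alpha (u q)))%:E)%E).
  apply: ge0_le_integral => //.
  - by move=> q _; apply: integral_ge0.
  - have mN : measurable_fun setT (fun z => `|(Phi z)%:E|)%E.
      by apply: measurableT_comp => //; exact/measurable_EFinP.
    exact: (@measurable_fun_fubini_tonelli_F _ _ _ _ _ mu _ mN (fun z => abse_ge0 _)).
  - move=> q _; have [I <-] := integral_dom q; rewrite (EFin_Rintegral I).
    apply: ge0_le_integral => //.
    + apply: measurableT_comp => //; apply/measurable_EFinP.
      exact: (@measurable_fun_pair2 _ _ _ _ _ _ Phi q measurable_Phi).
    + exact: measurable_int I.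
    + by move=> r _; rewrite lee_fin; exact: bound_Phi.
have ch : forall t, `|chi T t| <= 1 * chi T t by move=> t; rewrite mul1r ger0_norm// chi_ge0.
have I := form_integrable alpha_gt0 ler01 (measurable_chi T) (measurable_chi T) ch ch.
have G0 (q : R * R) : (0 <= (K * Gamma sigma * (chi2 q * pk alpha (u q)))%:E)%E.
  by rewrite lee_fin mulr_ge0// mulr_ge0// pk_ge0.
rewrite [ltLHS](_ : _ = \int[mu]_t fubini_F mu (fun q : R * R => (K * Gamma sigma * (chi2 q * pk alpha (u q)))%:E) t)%E; last first.
  exact: (@fubini_tonelli1 _ _ _ _ R mu mu _ mG G0).
have E t : fubini_F mu (fun q : R * R => (K * Gamma sigma * (chi2 q * pk alpha (u q)))%:E) t =
   (K * Gamma sigma * (chi T t * conv (pk alpha) (chi T) t))%:E.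
  have wch := W_chi ler01 (measurable_chi T) ch.
  have I1 := W_conv_integrable t alpha_gt0 ltr01 (W_pk alpha) wch.
  rewrite mulrA /conv -RintegralZl// EFin_Rintegral.
    by apply: eq_integral => x _; congr EFin; rewrite /chi2 /u /=; ring.
  exact: (integrableZl measurableT _ I1).
under eq_integral do rewrite E.
have I2 : mu.-integrable setT (EFin \o (fun t => K * Gamma sigma * (chi T t * conv (pk alpha) (chi T) t))).
  exact: (integrableZl measurableT _ I).
by rewrite -(EFin_Rintegral I2) ltry.
Qed.

Let integrable_Phi_r q : mu.-integrable setT (EFin \o (fun r => Phi (q, r))).
Proof.
have [I _] := integral_dom q; apply: le_integrable I => //.
  by apply/measurable_EFinP; exact: (@measurable_fun_pair2 _ _ _ _ _ _ Phi q measurable_Phi).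
move=> r _ /=; rewrite lee_fin (le_trans (bound_Phi q r))// ler_norm//.
Qed.

Let bound_Phi_plane r q : 0 < r -> `|Phi (q, r)| <= K * pk sigma r * chi2 q.
Proof.
move=> r0; apply: (le_trans (bound_Phi q r)).
have -> : K * chi2 q * (pk 1 (u q) * (pk sigma r * expR (- (u q * r)))) =
  K * pk sigma r * chi2 q * (pk 1 (u q) * expR (- (u q * r))) by ring.
rewrite ler_piMr//; first by rewrite mulr_ge0 ?chi2_ge0// mulr_ge0// pk_ge0.
have [u0|u0] := leP (u q) 0; first by rewrite (pk_le0 _ u0) mul0r.
rewrite pk_gt0// subrr powRr0 mul1r -expR0 ler_expR oppr_le0 mulr_ge0 ?ltW//.
Qed.

Let integrable_Phi_x r t : 0 < r -> mu.-integrable setT (EFin \o (fun x => Phi ((t, x), r))).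
Proof.
move=> r0; apply: (@integrable_chi T _ (K * pk sigma r)).
  have mS := measurable_fun_pair1 r measurable_Phi.
  exact: (measurable_fun_pair2 t mS).
move=> x; apply: (le_trans (bound_Phi_plane _ r0)).
rewrite ler_wpM2l ?mulr_ge0 ?pk_ge0// /chi2/= /chi; case: ifP => _; rewrite ?mul1r ?mul0r//.
by case: ifP.
Qed.

Let integrable_Phi_plane r : 0 < r ->
  (mu \x mu)%E.-integrable setT (fun q : R * R => (Phi (q, r))%:E).
Proof.
move=> r0.
have mS : measurable_fun setT (fun q : R * R => (Phi (q, r))%:E).
  by apply/measurable_EFinP; exact: (@measurable_fun_pair1 _ _ _ _ _ _ Phi r measurable_Phi).
apply/integrable12ltyP => //.
have Ic : mu.-integrable setT (EFin \o (fun x => K * pk sigma r * chi T x)).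
  apply: (@integrable_chi T _ (K * pk sigma r)).
    by apply: measurable_funM; [exact: measurable_cst|exact: measurable_chi].
  by move=> t; rewrite ger0_norm// !mulr_ge0 ?pk_ge0 ?chi_ge0.
have mN : measurable_fun setT (fun q : R * R => `|(Phi (q, r))%:E|)%E.
  exact: measurableT_comp.
set L := \int[mu]_x (K * pk sigma r * chi T x).
have It : mu.-integrable setT (EFin \o (fun t => L * chi T t)).
  apply: (@integrable_chi T _ `|L|).
    by apply: measurable_funM; [exact: measurable_cst|exact: measurable_chi].
  by move=> t; rewrite normrM (ger0_norm (chi_ge0 T t)).
apply: (@le_lt_trans _ _ (\int[mu]_t (L * chi T t)%:E)%E); last first.
  by rewrite -(EFin_Rintegral It) ltry.
apply: ge0_le_integral => //.
- by move=> t _; apply: integral_ge0.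
- exact: (@measurable_fun_fubini_tonelli_F _ _ _ _ _ mu _ mN (fun z => abse_ge0 _)).
- exact: measurable_int It.
- move=> t _; rewrite EFinM muleC (EFin_Rintegral Ic) -ge0_integralZl//; last first.
  + by rewrite lee_fin chi_ge0.
  + by move=> x _; rewrite lee_fin !mulr_ge0 ?pk_ge0 ?chi_ge0.
  + exact: measurable_int Ic.
  apply: ge0_le_integral => //.
  + exact: (measurable_fun_pair2 t mN).
  + by apply/measurable_EFinP; apply: measurable_funM;
      [exact: measurable_cst|apply: measurable_funM; [exact: measurable_cst|exact: measurable_chi]].
  + move=> x _; rewrite -EFinM lee_fin mulrCA; apply: bound_Phi_plane => //.
Qed.

(** Fubini compares two orders of integration of [Phi]. Plane first, the integrand in [r] is
    nonnegative by assumption; [r] first, the result is the claimed form times the positive constant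
    [gamma_mod sigma d]. *)
Lemma rotated_form_ge0 :
  (forall r, (0 < r)%R -> 0 <= \int[mu]_t (\int[mu]_x Phi ((t, x), r))%:E)%E ->
  0 <= \int[mu]_t \int[mu]_x (pk alpha (t - x) * (cos psi * X (t, x) + sin psi * Y (t, x))).
Proof.
move=> hpos.
have iP := proj2 (@integrable12ltyP _ _ _ _ R mu2 mu _ measurable_EPhi) integral_abs_Phi.
have FP := Fubini iP.
have m0 := gamma_mod_gt0 d sigma_gt0.
pose g (q : R * R) := pk alpha (u q) * (cos psi * X q + sin psi * Y q).
have Eg q : (\int[mu]_r (EFin \o Phi) (q, r))%E = (gamma_mod sigma d * g q)%:E.
  by rewrite -(EFin_Rintegral (integrable_Phi_r q)) integral_Phi.
have ig : (mu \x mu)%E.-integrable setT (fun q : R * R => (gamma_mod sigma d * g q)%:E).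
  have := integrable_fubini_F iP.
  by apply: eq_integrable => // q _; rewrite /fubini_F Eg.
have RHS0 : (0 <= \int[mu]_r \int[mu2]_q (EFin \o Phi) (q, r))%E.
  apply: integral_ge0 => r _.
  have [r0|r0] := leP r 0.
    rewrite integral0_eq// => q _ /=.
    by rewrite /Phi/= (pk_le0 _ r0) !mul0r mulr0.
  have -> : (\int[mu2]_q (EFin \o Phi) (q, r) = \int[mu]_t \int[mu]_x (Phi ((t, x), r))%:E)%E.
    exact/esym/(integral12_prod_meas1 (integrable_Phi_plane r0)).
  have := hpos r r0; under eq_integral do rewrite (EFin_Rintegral (integrable_Phi_x _ r0)).
  by [].
move: RHS0; rewrite -FP.
have -> : (\int[mu2]_q \int[mu]_r (EFin \o Phi) (q, r) = \int[mu]_t \int[mu]_x (gamma_mod sigma d * g (t, x))%:E)%E.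
  under eq_integral do rewrite Eg.
  exact/esym/(integral12_prod_meas1 ig).
have iA : W 1 A := W_chi M0 mA hA.
have iB : W 1 B := W_chi M0 mB hB.
have I t : mu.-integrable setT (EFin \o (fun x => g (t, x))).
  have IA := W_conv_integrable t alpha_gt0 ltr01 (W_pk alpha) iA.
  have IB := W_conv_integrable t alpha_gt0 ltr01 (W_pk alpha) iB.
  have := integrableD measurableT
    (integrableZl measurableT (cos psi * A t - sin psi * B t) IA)
    (integrableZl measurableT (cos psi * B t + sin psi * A t) IB).
  apply: eq_integrable => // x _ /=; rewrite -!EFinM -EFinD /g /X /Y /u /=; congr EFin; ring.
have ig' : mu.-integrable setT (fun t => \int[mu]_x (gamma_mod sigma d * g (t, x))%:E)%E.
  exact: (integrable_fubini_F ig).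
have Et t : (\int[mu]_x (gamma_mod sigma d * g (t, x))%:E = (gamma_mod sigma d * \int[mu]_x g (t, x))%:E)%E.
  rewrite EFinM (EFin_Rintegral (I t)) -integralZl//.
  exact: I.
have I' : mu.-integrable setT (EFin \o (fun t => gamma_mod sigma d * \int[mu]_x g (t, x))).
  by apply: eq_integrable ig' => // t _; rewrite Et.
under eq_integral do rewrite Et.
rewrite -(EFin_Rintegral I') lee_fin => h0.
have I2 : mu.-integrable setT (EFin \o (fun t => \int[mu]_x g (t, x))).
  have := integrableZl measurableT (gamma_mod sigma d)^-1 I'; apply: eq_integrable => // t _ /=.
  by rewrite -EFinM mulKf// gt_eqF.
move: h0; rewrite RintegralZl// pmulr_rge0//.
Qed.

End Rotated.

(** [Gamma alpha] times the fractional integral of order [alpha]; the factor [(Gamma alpha)^-1] is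
    supplied where the equation is used. *)
Definition frac a t := conv (pk alpha) (a \_ `]0, +oo[) t.

Let conv_cut a T t : 0 < t < T ->
  conv (pk alpha) (fun x => chi T x * a x) t = frac a t.
Proof.
move=> /andP[t0 tT]; apply: eq_Rintegral => x _; rewrite patchE mem_setE in_itv/= andbT /chi.
have [x0|x0] := ltP 0 x; last by rewrite mul0r.
have [xT|xT] := ltP x T; first by rewrite mul1r.
by rewrite pk_le0 ?mul0r//; lra.
Qed.

(** With [z = a + i b] and [psi = sigma * atan d], the integrand is the real part of
    [e^(-i psi) conj z] times the unnormalised fractional integral of [z]. *)
Lemma rotated_frac_ge0 a b T d : continuous a -> continuous b -> 0 <= T ->
  0 <= \int[mu]_(t in `]0, T[)
    (cos (sigma * atan d) * (a t * frac a t + b t * frac b t) +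
     sin (sigma * atan d) * (a t * frac b t - b t * frac a t)).
Proof.
move=> ca cb T0.
have [Ma Ma0 hMa] := within_bounded T (continuous_subspaceT ca).
have [Mb Mb0 hMb] := within_bounded T (continuous_subspaceT cb).
pose A t := chi T t * a t; pose B t := chi T t * b t; pose M := Ma + Mb.
have M0 : 0 <= M by exact: addr_ge0.
have mA : measurable_fun setT A.
  by apply: measurable_funM; [exact: measurable_chi|exact: continuous_measurable_fun].
have mB : measurable_fun setT B.
  by apply: measurable_funM; [exact: measurable_chi|exact: continuous_measurable_fun].
have hA t : `|A t| <= M * chi T t.
  rewrite /A /chi; case: ifPn => [/andP[t0 tT]|_]; last by rewrite mul0r normr0 mulr0.
  by rewrite mul1r mulr1 (le_trans (hMa t _)) ?lerDl// t0 ltW.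
have hB t : `|B t| <= M * chi T t.
  rewrite /B /chi; case: ifPn => [/andP[t0 tT]|_]; last by rewrite mul0r normr0 mulr0.
  by rewrite mul1r mulr1 (le_trans (hMb t _)) ?lerDr// t0 ltW.
have iA : W 1 A := W_chi M0 mA hA.
have iB : W 1 B := W_chi M0 mB hB.
have := @rotated_form_ge0 A B M T d M0 mA mB hA hB; set psi := sigma * atan d => H.
have {}H := H _.
have -> : \int[mu]_(t in `]0, T[)
    (cos psi * (a t * frac a t + b t * frac b t) + sin psi * (a t * frac b t - b t * frac a t)) =
  \int[mu]_t \int[mu]_x (pk alpha (t - x) * (cos psi * (A t * A x + B t * B x) + sin psi * (A t * B x - B t * A x))).
  rewrite Rintegral_mkcond; apply: eq_Rintegral => t _; rewrite patchE mem_setE in_itv/=.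
  case: ifPn => [h|/negbTE h]; last first.
    rewrite /A /B {1 3 5 7}/chi h !mul0r.
    under eq_Rintegral do rewrite !mul0r addr0 subr0 !mulr0 addr0 mulr0.
    by rewrite Rintegral_cst// mul0r.
  have IA := W_conv_integrable t alpha_gt0 ltr01 (W_pk alpha) iA.
  have IB := W_conv_integrable t alpha_gt0 ltr01 (W_pk alpha) iB.
  transitivity (\int[mu]_x ((cos psi * a t - sin psi * b t) * (pk alpha (t - x) * A x) +
                            (cos psi * b t + sin psi * a t) * (pk alpha (t - x) * B x))).
    rewrite RintegralD//; last 2 first.
    - exact: (integrableZl measurableT _ IA).
    - exact: (integrableZl measurableT _ IB).
    rewrite !RintegralZl//.
    have EA := conv_cut a h; have EB := conv_cut b h; rewrite /conv in EA EB.
    by rewrite EA EB; ring.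
  by apply: eq_Rintegral => x _; rewrite [A t]/A [B t]/B {1 2 3 4}/chi h !mul1r; ring.
apply: H => r r0.
(* [p + i q] is [(a + i b) e^(i d r x)]. This modulation absorbs the oscillation and leaves the real
   kernel [e^(-r (t - x))], positive on [p] and on [q] separately. *)
pose p x := a x * cos (d * r * x) - b x * sin (d * r * x).
pose q x := a x * sin (d * r * x) + b x * cos (d * r * x).
have ccos : continuous (fun x : R => cos (d * r * x)).
  by move=> x; apply: is_derive_continuous.
have csin : continuous (fun x : R => sin (d * r * x)).
  by move=> x; apply: is_derive_continuous.
have cexp : continuous (fun x : R => expR (r * x)).
  by move=> x; apply: is_derive_continuous.
have cp : continuous p.
  by move=> x; apply: cvgB; apply: cvgM; [exact: ca|exact: ccos|exact: cb|exact: csin].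
have cq : continuous q.
  by move=> x; apply: cvgD; apply: cvgM; [exact: ca|exact: csin|exact: cb|exact: ccos].
have [Ip Gp0] := exp_kernel_ge0 (ltW r0) T0 cp.
have [Iq Gq0] := exp_kernel_ge0 (ltW r0) T0 cq.
set Gp := (fun t => p t * _) in Ip Gp0; set Gq := (fun t => q t * _) in Iq Gq0.
have E t : \int[mu]_x (pk 1 (t - x) * (pk sigma r * expR (- ((t - x) * r)) *
    (cos ((t - x) * d * r - 0) * (A t * A x + B t * B x) +
     cos ((t - x) * d * r - pi / 2) * (A t * B x - B t * A x)))) =
   ((fun t => pk sigma r * (Gp t + Gq t)) \_ `]0, T[) t.
  rewrite patchE mem_setE in_itv/=.
  case: ifPn => [h|/negbTE h]; last first.
    have At0 : A t = 0 by rewrite /A /chi h mul0r.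
    have Bt0 : B t = 0 by rewrite /B /chi h mul0r.
    under eq_Rintegral do rewrite At0 Bt0 !(mul0r, subr0, addr0, mulr0).
    by rewrite Rintegral_cst// mul0r.
  have IG f : continuous f -> mu.-integrable setT (EFin \o (fun x => expR (r * x) * f x) \_ `]0, t[).
    move=> cf; apply: integrable_patch => //.
    by apply: integrable_0T; exact: continuous_funM.
  have J1 := IG _ cp; have J2 := IG _ cq.
  have Ep (f : R -> R) : \int[mu]_(x in `]0, t[) (expR (r * x) * f x) =
      \int[mu]_x (((fun x => expR (r * x) * f x) \_ `]0, t[) x).
    by rewrite Rintegral_mkcond.
  rewrite /Gp /Gq !Ep.
  transitivity (\int[mu]_x (pk sigma r * (p t * expR (- (r * t))) * ((fun x => expR (r * x) * p x) \_ `]0, t[) x +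
     pk sigma r * (q t * expR (- (r * t))) * ((fun x => expR (r * x) * q x) \_ `]0, t[) x)); last first.
    rewrite RintegralD//; last 2 first.
    - exact: (integrableZl measurableT _ J1).
    - exact: (integrableZl measurableT _ J2).
    by rewrite !RintegralZl//; ring.
  apply: eq_Rintegral => x _; rewrite !patchE !mem_setE !in_itv/=.
  case: ifPn => [/andP[x0 xt]|hx]; last first.
    have [xt|xt] := ltP x t; last by rewrite pk_le0 ?subr_le0// mul0r !mulr0 addr0.
    have x0 : (0 < x) = false by apply/negbTE; move: hx; rewrite xt andbT.
    have Ax0 : A x = 0 by rewrite /A /chi x0 mul0r.
    have Bx0 : B x = 0 by rewrite /B /chi x0 mul0r.
    by rewrite Ax0 Bx0 !(mul0r, mulr0, subr0, addr0).
  have hxT : 0 < x < T by move: h => /andP[_ tT]; rewrite x0 (lt_trans xt).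
  rewrite pk_gt0 ?subr_gt0// subrr powRr0 /A /B /chi h hxT !mul1r subr0 cosBpihalf.
  have -> : (t - x) * d * r = d * r * t - d * r * x by ring.
  have -> : expR (- ((t - x) * r)) = expR (- (r * t)) * expR (r * x) by rewrite -expRD; congr expR; ring.
  by rewrite cosB sinB /p /q; ring.
under eq_integral do rewrite E.
have mD : measurable (`]0, T[%classic : set (measurableTypeR R)) by exact: measurable_itv.
have IGG : mu.-integrable `]0, T[ (EFin \o (fun t => pk sigma r * (Gp t + Gq t))).
  exact: (integrableZl mD _ (integrableD mD Ip Iq)).
rewrite -(EFin_Rintegral (integrable_patch mD IGG)) lee_fin.
rewrite -Rintegral_mkcond RintegralZl//; last first.
  exact: (integrableD mD Ip Iq).
by rewrite RintegralD// mulr_ge0 ?pk_ge0// addr_ge0.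
Qed.

(** The angles [sigma * atan d] fill the interval of radius [(1 - alpha) pi / 2] around [0]. As
    [|Arg z|] exceeds [alpha pi / 2], one of them turns [z] to an argument [omega] in the open left
    half plane. *)
Lemma sector_angle (z : R[i]) : Lambda alpha z ->
  exists d rho omega, [/\ 0 < rho,
    cos omega < 0,
    complex.Re z = rho * cos (omega - sigma * atan d) &
    complex.Im z = rho * sin (omega - sigma * atan d)].
Proof.
case: z => p q [z0]; rewrite /Arg /=.
set rho := Num.sqrt (p ^+ 2 + q ^+ 2); set r := p / rho => hArg.
have n0 : 0 < p ^+ 2 + q ^+ 2.
  rewrite lt_neqAle addr_ge0 ?sqr_ge0// andbT eq_sym.
  apply: contra z0; rewrite paddr_eq0 ?sqr_ge0// !sqrf_eq0 => /andP[/eqP -> /eqP ->].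
  by [].
have rho0 : 0 < rho by rewrite sqrtr_gt0.
have rho2 : rho ^+ 2 = p ^+ 2 + q ^+ 2 by rewrite sqr_sqrtr// ltW.
have r2 : r ^+ 2 <= 1.
  rewrite /r expr_div_n rho2 ler_pdivrMr// mul1r lerDl sqr_ge0//.
have r1 : -1 <= r <= 1 by rewrite -ler_norml -(@ler_pXn2r _ 2)// ?nnegrE// ?expr1n ?real_normK ?num_real.
pose chi := acos r.
have chi0 : 0 <= chi by exact: acos_ge0.
have chipi : chi <= pi by exact: acos_lepi.
have hchi : alpha * pi / 2 < chi.
  by move: hArg; case: ifP => _; rewrite ?normrN ger0_norm.
have cchi : cos chi = r by exact: acosK.
have schi : sin chi = `|q| / rho.
  rewrite sin_acos// /r; apply/eqP; rewrite -(@eqrXn2 _ 2)// ?sqrtr_ge0 ?divr_ge0 ?(ltW rho0)//.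
  rewrite sqr_sqrtr ?subr_ge0// !expr_div_n real_normK ?num_real// rho2; apply/eqP; field.
  by rewrite gt_eqF.
have pi0 := pi_gt0 R.
(* [m] is the least nonnegative angle for which [chi + sigma * m] reaches [pi / 2]. The sector
   condition amounts to [m < pi / 2], and the midpoint [phi] makes every inequality strict. *)
pose m := Num.max 0 ((pi / 2 - chi) / sigma).
have m0 : 0 <= m by rewrite le_max lexx.
have mlt : m < pi / 2.
  rewrite gt_max divr_gt0//= ltr_pdivrMr// /sigma; nra.
have mge : (pi / 2 - chi) <= sigma * m.
  by rewrite [leRHS]mulrC -ler_pdivrMr// /m le_max lexx orbT.
pose phi := (m + pi / 2) / 2.
have phi0 : 0 < phi by rewrite /phi; lra.
have phipi : phi < pi / 2 by rewrite /phi; lra.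
have hsum : pi / 2 < chi + sigma * phi.
  have : sigma * m < sigma * phi by rewrite ltr_pM2l// /phi; lra.
  by lra.
have hsum2 : chi + sigma * phi < pi + pi / 2.
  have : sigma * phi < 1 * (pi / 2).
    by apply: ltr_pM => //; [exact: ltW|exact: ltW|rewrite /sigma ltrBlDr ltrDl].
  by lra.
have cneg : cos (chi + sigma * phi) < 0.
  rewrite -(subrK pi (chi + sigma * phi)) cosDpi oppr_lt0 cos_gt0_pihalf//.
  by apply/andP; split; lra.
have atanphi : atan (tan phi) = phi.
  by rewrite tanK// in_itv/= phipi andbT; lra.
have [q0|q0] := leP 0 q.
  exists (tan phi), rho, (chi + sigma * phi); rewrite atanphi addrK cchi schi ger0_norm//.
  by split => //; rewrite /r mulrC divfK// gt_eqF.
(* Below the real axis the whole picture is reflected, including the slope of the rotation. *)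
exists (- tan phi), rho, (- (chi + sigma * phi)).
have -> : - (chi + sigma * phi) - sigma * atan (- tan phi) = - chi.
  by rewrite atanN atanphi; ring.
rewrite !cosN sinN cchi schi ltr0_norm//.
split => //; rewrite /r; first by rewrite mulrC divfK// gt_eqF.
by rewrite mulNr opprK mulrC divfK// gt_eqF.
Qed.

(** For [zeta = a + i b] and [v = u1 + i u2] the hypothesis is [zeta = z I^alpha zeta + v].
    Multiplying [zeta - v] by [e^(-i omega) conj zeta] gives a positive multiple of the rotated
    form, whose real part integrates to something nonnegative; since [cos omega < 0], the energy of
    [zeta] is bounded by the cross term with [v]. *)
Lemma sector_energy (z : R[i]) : Lambda alpha z -> exists2 C, 0 <= C &
  forall T a b u1 u2, 0 <= T -> continuous a -> continuous b -> continuous u1 -> continuous u2 ->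
  (forall t, 0 < t < T ->
    a t = (Gamma alpha)^-1 * (complex.Re z * frac a t - complex.Im z * frac b t) + u1 t /\
    b t = (Gamma alpha)^-1 * (complex.Im z * frac a t + complex.Re z * frac b t) + u2 t) ->
  \int[mu]_(t in `]0, T[) (a t ^+ 2 + b t ^+ 2) <=
    C * \int[mu]_(t in `]0, T[) (u1 t ^+ 2 + u2 t ^+ 2).
Proof.
move=> /sector_angle[d [rho [omega [rho0 cneg -> ->]]]].
set psi := sigma * atan d; pose delta := - cos omega.
have delta0 : 0 < delta by rewrite oppr_gt0.
exists (delta^-1 ^+ 2); first by rewrite sqr_ge0.
move=> T a b u1 u2 T0 ca cb cu1 cu2 hab.
have kap0 : 0 < (Gamma alpha)^-1 by rewrite invr_gt0 Gamma_gt0.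
set kap := (Gamma alpha)^-1 in hab kap0.
have mD : measurable (`]0, T[%classic : set (measurableTypeR R)) by exact: measurable_itv.
have cab : continuous (fun t => a t ^+ 2 + b t ^+ 2) by apply: continuous_funD; exact: continuous_sqr.
have cuu : continuous (fun t => u1 t ^+ 2 + u2 t ^+ 2) by apply: continuous_funD; exact: continuous_sqr.
have := rotated_frac_ge0 d ca cb T0; rewrite -/psi => pos.
pose f t := cos psi * (a t * frac a t + b t * frac b t) + sin psi * (a t * frac b t - b t * frac a t).
pose g t := cos omega * (a t ^+ 2 + b t ^+ 2) - cos omega * (a t * u1 t + b t * u2 t)
   - sin omega * (a t * u2 t - b t * u1 t).
have fg t : 0 < t < T -> kap * rho * f t = g t.
  move=> /hab[Ea Eb].
  have E1 : u1 t = a t - kap * (rho * cos (omega - psi) * frac a t - rho * sin (omega - psi) * frac b t) by rewrite Ea; ring.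
  have E2 : u2 t = b t - kap * (rho * sin (omega - psi) * frac a t + rho * cos (omega - psi) * frac b t) by rewrite Eb; ring.
  rewrite /g E1 E2 /f.
  have -> : cos psi = cos (omega - (omega - psi)) by rewrite opprB addrCA subrr addr0.
  have -> : sin psi = sin (omega - (omega - psi)) by rewrite opprB addrCA subrr addr0.
  by rewrite (cosB omega) (sinB omega); ring.
have cg : continuous g.
  rewrite (_ : g = fun t => cos omega * (a t ^+ 2 + b t ^+ 2) + ((- cos omega) * (a t * u1 t + b t * u2 t)
     + (- sin omega) * (a t * u2 t + (-1) * (b t * u1 t)))); last by apply/funext => t; rewrite /g; ring.
  apply: continuous_funD; first exact: continuous_funZ.
  apply: continuous_funD; apply: continuous_funZ; apply: continuous_funD; try exact: continuous_funM.
  by apply: continuous_funZ; exact: continuous_funM.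
have g0 : 0 <= \int[mu]_(t in `]0, T[) g t.
  have -> : \int[mu]_(t in `]0, T[) g t = kap * rho * \int[mu]_(t in `]0, T[) f t.
    rewrite -RintegralZl//.
      by apply: eq_Rintegral => t; rewrite inE/= in_itv/= => /fg ->.
    have := integrableZl mD (kap * rho)^-1 (integrable_0T T cg).
    apply: eq_integrable => // t; rewrite inE/= in_itv/= => /fg <-.
    by rewrite -EFinM mulKf// gt_eqF// mulr_gt0.
  by rewrite mulr_ge0// mulr_ge0// ltW.
(* Completing the square: [2 * delta] times the difference of the two sides is the squared modulus
   of [delta * (a + i b) + e^(-i omega) (u1 + i u2)]. *)
have gle t : g t <= (- (delta / 2)) * (a t ^+ 2 + b t ^+ 2) + (2 * delta)^-1 * (u1 t ^+ 2 + u2 t ^+ 2).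
  have cs := cos2Dsin2 omega.
  have h : 0 <= (delta * a t + cos omega * u1 t + sin omega * u2 t) ^+ 2 +
                (delta * b t + cos omega * u2 t - sin omega * u1 t) ^+ 2.
    by rewrite addr_ge0// sqr_ge0.
  rewrite -subr_ge0 (_ : _ - g t = (2 * delta)^-1 * ((delta * a t + cos omega * u1 t + sin omega * u2 t) ^+ 2 +
                (delta * b t + cos omega * u2 t - sin omega * u1 t) ^+ 2)).
    by rewrite mulr_ge0// invr_ge0 mulr_ge0// ltW.
  transitivity ((2 * delta)^-1 * (delta ^+ 2 * (a t ^+ 2 + b t ^+ 2) +
     (cos omega ^+ 2 + sin omega ^+ 2) * (u1 t ^+ 2 + u2 t ^+ 2) + 2 * delta *
     (cos omega * (a t * u1 t + b t * u2 t) + sin omega * (a t * u2 t - b t * u1 t)))).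
    have Hc : cos omega = - delta by rewrite opprK.
    by rewrite cs /g Hc; field; rewrite gt_eqF.
  by congr (_ * _); ring.
have := le_trans g0 (le_Rintegral mD (integrable_0T T cg) (integrable_0T T (continuous_funD (continuous_funZ cab) (continuous_funZ cuu))) (fun t _ => gle t)).
have J1 := integrable_0T T cab; have J2 := integrable_0T T cuu.
rewrite RintegralD//; last 2 first.
- exact: integrable_0T (continuous_funZ cab).
- exact: integrable_0T (continuous_funZ cuu).
rewrite !RintegralZl//.
set x := \int[mu]_(t in `]0, T[) _; set y := \int[mu]_(t in `]0, T[) _.
rewrite mulNr addrC subr_ge0 => h.
have := ler_wpM2l (ltW (mulr_gt0 (ltac:(by []) : 0 < 2 :> R) (ltac:(by rewrite invr_gt0) : 0 < delta^-1))) h.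
rewrite (_ : 2 / delta * (delta / 2 * x) = x); last by field; rewrite gt_eqF.
by rewrite (_ : 2 / delta * ((2 * delta)^-1 * y) = delta^-1 ^+ 2 * y)//; field; rewrite gt_eqF.
Qed.

End KernelPositivity.

(** * Functions with bounded mean squares *)

Section LinearGrowth.
Context {R : realType}.
Implicit Types (f g : R -> R) (F : R -> R[i]).

(** The energy on []0, T[] grows at most linearly, so the mean square is bounded in [T]. This is
    stable under linear combinations and is what the energy inequality transports. *)
Definition Lg f := continuous f /\ exists2 C, 0 <= C &
  forall T, 0 <= T -> \int[mu]_(t in `]0, T[) (f t ^+ 2) <= C * T.

Lemma integrable_sqr_0T f T : continuous f ->
  mu.-integrable `]0, T[ (EFin \o (fun t => f t ^+ 2)).
Proof. by move=> cf; apply: integrable_0T; exact: continuous_sqr. Qed.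

Let mD T : measurable (`]0, T[%classic : set (measurableTypeR R)).
Proof. exact: measurable_itv. Qed.

Lemma Lg_cst c : Lg (fun=> c).
Proof.
split; first by move=> t; exact: cvg_cst.
exists (c ^+ 2); first exact: sqr_ge0.
move=> T T0; rewrite Rintegral_cst//= lebesgue_measure_itv/= lte_fin.
by case: ifP => _; rewrite /= ?subr0// mulr0 mulr_ge0// sqr_ge0.
Qed.

Lemma Lg_scale c f : Lg f -> Lg (fun t => c * f t).
Proof.
move=> [cf [C C0 hC]]; split; first exact: continuous_funZ.
exists (c ^+ 2 * C); first by rewrite mulr_ge0// sqr_ge0.
move=> T T0; under eq_Rintegral do rewrite exprMn.
rewrite RintegralZl//; last by apply: integrable_0T; exact: continuous_sqr.
by rewrite -[leRHS]mulrA; apply: ler_wpM2l; [exact: sqr_ge0|exact: hC].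
Qed.

Lemma Lg_add f g : Lg f -> Lg g -> Lg (fun t => f t + g t).
Proof.
move=> [cf [C C0 hC]] [cg [D D0 hD]].
have cfg := continuous_funD cf cg.
split=> //; exists (2 * (C + D)); first by rewrite mulr_ge0// addr_ge0.
move=> T T0.
have If := integrable_0T T (continuous_sqr cf).
have Ig := integrable_0T T (continuous_sqr cg).
have Ifg : mu.-integrable `]0, T[ (EFin \o (fun t => f t ^+ 2 + g t ^+ 2)).
  exact: (integrableD (mD T) If Ig).
apply: (@le_trans _ _ (\int[mu]_(t in `]0, T[) (2 * (f t ^+ 2 + g t ^+ 2)))).
  apply: le_Rintegral => //.
  - exact: integrable_0T (continuous_sqr cfg).
  - exact: (integrableZl (mD T) _ Ifg).
  - by move=> t _; have := sqr_ge0 (f t - g t); rewrite sqrrB sqrrD; lra.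
rewrite RintegralZl// RintegralD// -mulrA ler_wpM2l// mulrDl lerD//.
  exact: hC.
exact: hD.
Qed.

Definition LgC F := Lg (fun t => complex.Re (F t)) /\ Lg (fun t => complex.Im (F t)).

Lemma LgC_add F G : LgC F -> LgC G -> LgC (fun t => F t + G t).
Proof.
move=> [F1 F2] [G1 G2]; split.
  rewrite (_ : (fun t => _) = fun t => complex.Re (F t) + complex.Re (G t)); first exact: Lg_add.
  by apply/funext => t; case: (F t) => a b; case: (G t).
rewrite (_ : (fun t => _) = fun t => complex.Im (F t) + complex.Im (G t)); first exact: Lg_add.
by apply/funext => t; case: (F t) => a b; case: (G t).
Qed.

Lemma LgC_scale z F : LgC F -> LgC (fun t => z * F t).
Proof.
case: z => p q [F1 F2]; split.
  rewrite (_ : (fun t => _) = fun t => p * complex.Re (F t) + (- q) * complex.Im (F t)).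
    by apply: Lg_add; exact: Lg_scale.
  by apply/funext => t; case: (F t) => a b /=; rewrite mulNr.
rewrite (_ : (fun t => _) = fun t => p * complex.Im (F t) + q * complex.Re (F t)).
  by apply: Lg_add; exact: Lg_scale.
by apply/funext => t; case: (F t) => a b /=.
Qed.

Lemma LgC_real f : Lg f -> LgC (fun t => real_complex R (f t)).
Proof. by move=> hf; split => //; exact: Lg_cst. Qed.

Lemma LgC_sum (I : Type) (r : seq I) (h : I -> R -> R[i]) :
  (forall i, LgC (h i)) -> LgC (fun t => \sum_(i <- r) h i t).
Proof.
move=> hh; elim: r => [|i r ih].
  by under eq_fun do rewrite big_nil; apply: (LgC_real (Lg_cst 0)).
by under eq_fun do rewrite big_cons; exact: LgC_add.
Qed.

Definition LgM n (F : R -> 'M[R[i]]_n) := forall i j, LgC (fun t => F t i j).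

Lemma LgM_add n (F G : R -> 'M[R[i]]_n) : LgM F -> LgM G -> LgM (fun t => F t + G t).
Proof. by move=> hF hG i j; under eq_fun do rewrite mxE; exact: LgC_add. Qed.

Lemma LgM_mul n (B : 'M[R[i]]_n) (F : R -> 'M[R[i]]_n) : LgM F -> LgM (fun t => B *m F t).
Proof.
move=> hF i j; under eq_fun do rewrite mxE.
by apply: LgC_sum => k; exact: LgC_scale.
Qed.

End LinearGrowth.

(** * From one eigenvalue to the matrix equation *)

Section MatrixEnergy.
Context {R : realType}.
Context (alpha : R) (alpha_gt0 : 0 < alpha) (alpha_lt1 : alpha < 1).
Context (n : nat) (A : 'M[R]_n.+1).
Context (X w : R -> 'M[R]_n.+1).
Let cplx (M : 'M[R]_n.+1) : 'M[R[i]]_n.+1 := map_mx (real_complex R) M.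
Let AC := cplx A.
Let Y t := \matrix_(i, j) ((Gamma alpha)^-1 * frac alpha (fun t => X t i j) t).
Hypothesis specA : spectrum A `<=` Lambda alpha.
Hypothesis continuous_X : forall i j, continuous (fun t => X t i j).
Hypothesis W_X : forall i j, W 1 ((fun t => X t i j) \_ `]0, +oo[).
Hypothesis X_eq : forall t, 0 < t -> X t = A *m Y t + w t.
Hypothesis Lg_w : LgM (cplx \o w).

(** [0] lies outside the sector. The inverse of [A] serves twice: to express the forcing in the
    descent over eigenvalues, and to isolate [E_{alpha,alpha}] in its Euler identity. *)
Lemma complex_unitmx : map_mx (real_complex R) A \in unitmx.
Proof.
rewrite -/(cplx A) -/AC; have [//|hA] := boolP (AC \in unitmx).
have : spectrum A 0.
  rewrite /spectrum /=; apply/eigenvalueP.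
  have : row_free AC = false by apply/negbTE; rewrite row_free_unit.
  rewrite -kermx_eq0 => /negbT /rowV0Pn[v]; rewrite sub_kermx => /eqP hv v0.
  by exists v => //; rewrite hv scale0r.
by move=> /specA[]; rewrite eqxx.
Qed.

Let frac_sum (c : 'I_n.+1 -> R) j t :
  frac alpha (fun t => \sum_k c k * X t k j) t = \sum_k c k * frac alpha (fun t => X t k j) t.
Proof.
rewrite /frac -[RHS](eq_bigr _ (fun k _ => convZr (c k) t alpha_gt0 ltr01 (W_pk alpha) (W_X k j))).
rewrite -(conv_sumr _ _ alpha_gt0 ltr01 (W_pk alpha)); last by move=> k; exact: W_scale.
apply: eq_conv => // x; rewrite !patchE mem_setE in_itv/= andbT.
under [RHS]eq_bigr do rewrite patchE mem_setE in_itv/= andbT.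
case: ifP => // _; rewrite big1// => k _; exact: mulr0.
Qed.

Let ReE (P : 'M[R[i]]_n.+1) (M : 'M[R]_n.+1) i j :
  complex.Re ((P *m cplx M) i j) = \sum_k complex.Re (P i k) * M k j.
Proof.
rewrite mxE raddf_sum/=; apply: eq_bigr => k _; rewrite mxE.
by case: (P i k) => p q /=; rewrite mulr0 subr0.
Qed.

Let ImE (P : 'M[R[i]]_n.+1) (M : 'M[R]_n.+1) i j :
  complex.Im ((P *m cplx M) i j) = \sum_k complex.Im (P i k) * M k j.
Proof.
rewrite mxE raddf_sum/=; apply: eq_bigr => k _; rewrite mxE.
by case: (P i k) => p q /=; rewrite mulr0 add0r.
Qed.

Let frac_Re (P : 'M[R[i]]_n.+1) i j t :
  (Gamma alpha)^-1 * frac alpha (fun t => complex.Re ((P *m cplx (X t)) i j)) t =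
  complex.Re ((P *m cplx (Y t)) i j).
Proof.
rewrite ReE (_ : (fun t => _) = fun t => \sum_k complex.Re (P i k) * X t k j); last first.
  by apply/funext => x; rewrite ReE.
rewrite frac_sum mulr_sumr; apply: eq_bigr => k _.
by rewrite mxE mulrCA.
Qed.

Let frac_Im (P : 'M[R[i]]_n.+1) i j t :
  (Gamma alpha)^-1 * frac alpha (fun t => complex.Im ((P *m cplx (X t)) i j)) t =
  complex.Im ((P *m cplx (Y t)) i j).
Proof.
rewrite ImE (_ : (fun t => _) = fun t => \sum_k complex.Im (P i k) * X t k j); last first.
  by apply/funext => x; rewrite ImE.
rewrite frac_sum mulr_sumr; apply: eq_bigr => k _.
by rewrite mxE mulrCA.
Qed.

Let continuous_sum (c : 'I_n.+1 -> R) j : continuous (fun t => \sum_k c k * X t k j).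
Proof.
move=> t; apply: cvg_big => [|k _]; first by apply: add_continuous.
by apply: cvgM; [exact: cvg_cst|exact: continuous_X].
Qed.

(** [P X = z P Y + M Y + P w], where [Y] is not controlled. But [M] commutes with [A], so
    [M Y = A^-1 M (X - w)]: the forcing [U] involves only [M X] and [w], and each entry of [P X]
    solves the scalar equation with eigenvalue [z]. *)
Let descent_step (z : R[i]) (P : 'M[R[i]]_n.+1) : Lambda alpha z -> P * AC = AC * P ->
  LgM (fun t => (P * (AC - z%:M)) *m cplx (X t)) -> LgM (fun t => P *m cplx (X t)).
Proof.
move=> hz cP hM; set M := P * (AC - z%:M) in hM.
pose U t := invmx AC *m (M *m cplx (X t)) + (P - invmx AC *m M) *m cplx (w t).
have LU : LgM U by apply: LgM_add; apply: LgM_mul => //; exact: Lg_w.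
have cX i j : continuous (fun t => complex.Re ((P *m cplx (X t)) i j)) /\
              continuous (fun t => complex.Im ((P *m cplx (X t)) i j)).
  split.
    rewrite (_ : (fun t => _) = fun t => \sum_k complex.Re (P i k) * X t k j); first exact: continuous_sum.
    by apply/funext => x; rewrite ReE.
  rewrite (_ : (fun t => _) = fun t => \sum_k complex.Im (P i k) * X t k j); first exact: continuous_sum.
  by apply/funext => x; rewrite ImE.
have key t : 0 < t -> P *m cplx (X t) = z *: (P *m cplx (Y t)) + U t.
  move=> t0.
  have E : cplx (X t) = AC *m cplx (Y t) + cplx (w t).
    by rewrite {1}X_eq// /cplx map_mxD map_mxM.
  have c1 : (AC - z%:M) * AC = AC * (AC - z%:M).
    by rewrite mulrBl mulrBr; congr (_ - _); exact/esym/scalar_mxC.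
  have cM : M *m AC = AC *m M.
    by rewrite -[LHS]/(M * AC) /M -mulrA c1 mulrA cP -mulrA.
  have -> : U t = M *m cplx (Y t) + P *m cplx (w t).
    rewrite /U E mulmxDr (mulmxA M) cM -(mulmxA AC) mulmxDr (mulKmx complex_unitmx) mulmxBl (mulmxA (invmx AC) M).
    by rewrite -[LHS]addrA; congr (_ + _); rewrite addrC subrK.
  rewrite {1}E mulmxDr addrA; congr (_ + _).
  have -> : M = P *m AC - z *: P.
    by rewrite /M mulrBr; congr (_ - _); rewrite -[LHS]/(P *m z%:M) scalar_mxC mul_scalar_mx.
  by rewrite mulmxBl -scalemxAl addrC subrK mulmxA.
have [C C0 hC] := sector_energy alpha_gt0 alpha_lt1 hz.
move=> i j; have [cR cI] := cX i j; have [[cU1 [C1 C10 h1]] [cU2 [C2 C20 h2]]] := LU i j.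
have H T : 0 <= T -> \int[mu]_(t in `]0, T[) (complex.Re ((P *m cplx (X t)) i j) ^+ 2 + complex.Im ((P *m cplx (X t)) i j) ^+ 2)
   <= C * (C1 + C2) * T.
  move=> T0.
  apply: (le_trans (hC T _ _ (fun t => complex.Re (U t i j)) (fun t => complex.Im (U t i j)) T0 cR cI cU1 cU2 _)).
    move=> t /andP[t0 _].
    have kk : (P *m cplx (X t)) i j = z * (P *m cplx (Y t)) i j + U t i j.
      by rewrite (key t t0) [LHS]mxE [X in X + _]mxE.
    rewrite !mulrDr !mulrN !(mulrCA (Gamma alpha)^-1) frac_Re frac_Im kk.
    move: ((P *m cplx (Y t)) i j) (U t i j) => y v.
    by case: (z) => p q; case: y => y1 y2; case: v => v1 v2 /=; split; ring.
  rewrite -mulrA; apply: ler_wpM2l => //.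
  rewrite RintegralD//; [|exact: integrable_sqr_0T|exact: integrable_sqr_0T].
  by rewrite mulrDl; apply: lerD; [exact: h1|exact: h2].
have pos (f g : R -> R) T : continuous f -> continuous g ->
    \int[mu]_(t in `]0, T[) (f t ^+ 2) <= \int[mu]_(t in `]0, T[) (f t ^+ 2 + g t ^+ 2).
  move=> cf cg.
  have If := integrable_sqr_0T T cf; have Ig := integrable_sqr_0T T cg.
  rewrite RintegralD// lerDl; apply: Rintegral_ge0 => t _; exact: sqr_ge0.
split; split => //; exists (C * (C1 + C2)); rewrite ?mulr_ge0 ?addr_ge0// => T T0;
  apply: le_trans (H T T0); first exact: pos.
have := pos _ _ T cI cR.
by under [leRHS]eq_Rintegral do rewrite addrC.
Qed.

Let descent (ls : seq R[i]) (P : 'M[R[i]]_n.+1) : (forall z, z \in ls -> Lambda alpha z) ->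
  P * AC = AC * P ->
  LgM (fun t => (P * \prod_(z <- ls) (AC - z%:M)) *m cplx (X t)) -> LgM (fun t => P *m cplx (X t)).
Proof.
elim: ls P => [|z ls ih] P hls cP; first by rewrite big_nil mulr1.
rewrite big_cons mulrA => h.
have hz : Lambda alpha z by apply: hls; rewrite mem_head.
apply: (descent_step hz cP); apply: ih h.
  by move=> y yls; apply: hls; rewrite in_cons yls orbT.
have c1 : (AC - z%:M) * AC = AC * (AC - z%:M).
  by rewrite mulrBl mulrBr; congr (_ - _); exact/esym/scalar_mxC.
by rewrite -mulrA c1 mulrA cP -mulrA.
Qed.

Lemma matrix_energy i j : Lg (fun t => X t i j).
Proof.
have [ls Els] := closed_field_poly_normal (char_poly AC).
move: Els; rewrite (monicP (char_poly_monic AC)) scale1r => Els.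
have H : LgM (fun t => 1 *m cplx (X t)).
  apply: (descent (ls := ls)).
  - move=> z zls; apply: specA; rewrite /spectrum /= -/AC.
    rewrite eigenvalue_root_char Els root_prod_XsubC//.
  - by rewrite mul1r mulr1.
  - have -> : 1 * \prod_(z <- ls) (AC - z%:M) = 0.
      rewrite mul1r -(Cayley_Hamilton AC) Els rmorph_prod/=; apply: eq_bigr => z _.
      by rewrite rmorphB/= horner_mx_X horner_mx_C.
    move=> k l; under eq_fun do rewrite mul0mx mxE.
    exact: (LgC_real (Lg_cst 0)).
have [h _] := H i j.
rewrite (_ : (fun t => _) = fun t => complex.Re ((1 *m cplx (X t)) i j)) //.
by apply/funext => t; rewrite mul1mx mxE.
Qed.

End MatrixEnergy.

(** * Boundedness of the matrix Mittag-Leffler function *)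

Section ResolventBound.
Context {R : realType}.
Context (alpha : R) (alpha_gt0 : 0 < alpha) (alpha_lt1 : alpha < 1).
Implicit Types (f : R -> R) (c d : nat -> R) (b t u : R).

Lemma geo_scale x c : geo c -> geo (fun m => x * c m).
Proof.
move=> [C [M [C0 M0 h]]]; exists (`|x| * C), M; split=> //; first exact: mulr_ge0.
by move=> m; rewrite normrM -mulrA ler_wpM2l.
Qed.

Lemma geo_add c d : geo c -> geo d -> geo (fun m => c m + d m).
Proof.
move=> [C [M [C0 M0 h]]] [D [L [D0 L0 k]]]; exists (C + D), (M + L).
split; [exact: addr_ge0|exact: addr_ge0|move=> m].
rewrite (le_trans (ler_normD _ _))// mulrDl lerD//.
  by rewrite (le_trans (h m))// ler_wpM2l// lerXn2r ?nnegrE ?addr_ge0// lerDl.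
by rewrite (le_trans (k m))// ler_wpM2l// lerXn2r ?nnegrE ?addr_ge0// lerDr.
Qed.

Lemma geo_natM c : geo c -> geo (fun m => m%:R * c m).
Proof.
move=> [C [M [C0 M0 h]]]; exists C, (2 * M); split=> //; first exact: mulr_ge0.
move=> m; rewrite normrM normr_nat exprMn mulrCA; apply: ler_pM => //.
by rewrite -natrX ler_nat ltnW// ltn_expl.
Qed.

Lemma geo_shift c : geo c -> geo (fun m => c m.+1).
Proof.
move=> [C [M [C0 M0 h]]]; exists (C * M), M; split=> //; first exact: mulr_ge0.
by move=> m; rewrite -mulrA -exprS.
Qed.

Lemma geo0 : geo (fun=> 0 : R).
Proof. by exists 0, 0; split=> // m; rewrite normr0 mul0r. Qed.

Lemma geo_sum (I : Type) (r : seq I) (D : I -> nat -> R) : (forall i, geo (D i)) ->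
  geo (fun m => \sum_(i <- r) D i m).
Proof.
move=> hD; elim: r => [|i r ih]; first by under eq_fun do rewrite big_nil; exact: geo0.
by under eq_fun do rewrite big_cons; exact: geo_add.
Qed.

Lemma geo_delta : geo (fun m => (m == 0%N)%:R : R).
Proof.
exists 1, 1; split=> // m; rewrite mul1r expr1n; case: (m == 0%N); by rewrite ?normr1 ?normr0.
Qed.

Lemma ps_mcoefD b c d u : 0 < b -> geo c -> geo d ->
  ps (mcoef alpha b (fun m => c m + d m)) u = ps (mcoef alpha b c) u + ps (mcoef alpha b d) u.
Proof.
move=> b0 hc hd.
have ec := entire_mcoef alpha_gt0 b0 hc; have ed := entire_mcoef alpha_gt0 b0 hd.
have := @ps_sum R bool [:: true; false] (fun=> 1)
  (fun e => if e then mcoef alpha b c else mcoef alpha b d) u.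
rewrite !big_cons !big_nil !addr0 !mul1r => <-; last by case.
by congr (ps _ u); apply/funext => m; rewrite !big_cons !big_nil !mul1r addr0 /mcoef mulrDl.
Qed.

Lemma ps_mcoefZ b x c u : 0 < b -> geo c ->
  ps (mcoef alpha b (fun m => x * c m)) u = x * ps (mcoef alpha b c) u.
Proof.
move=> b0 hc; have ec := entire_mcoef alpha_gt0 b0 hc.
have := @ps_sum R unit [:: tt] (fun=> x) (fun=> mcoef alpha b c) u (fun=> ec).
rewrite big_seq1 => <-; congr (ps _ u); apply/funext => m.
by rewrite big_seq1 /mcoef mulrA.
Qed.

Lemma ps_mcoef_sum b (I : Type) (r : seq I) (x : I -> R) (D : I -> nat -> R) u :
  0 < b -> (forall i, geo (D i)) ->
  ps (mcoef alpha b (fun m => \sum_(i <- r) x i * D i m)) u =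
  \sum_(i <- r) x i * ps (mcoef alpha b (D i)) u.
Proof.
move=> b0 hD; rewrite -ps_sum; last by move=> i; exact: entire_mcoef.
congr (ps _ u); apply/funext => m; rewrite /mcoef mulr_suml.
by apply: eq_bigr => i _; rewrite mulrA.
Qed.

Lemma ps_mcoef_shift c u : geo c ->
  ps (mcoef alpha 1 c) u = c 0%N + u * ps (mcoef alpha (1 + alpha) (fun m => c m.+1)) u.
Proof.
move=> hc; rewrite ps_shift; last exact: entire_mcoef.
have -> : mcoef alpha 1 c 0 = c 0%N by rewrite /mcoef mulr0n mulr0 add0r Gamma1 divr1.
have -> : (fun m => mcoef alpha 1 c m.+1) = mcoef alpha (1 + alpha) (fun m => c m.+1).
  by apply/funext => m; rewrite /mcoef; congr (_ / Gamma _); rewrite -natr1; ring.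
by [].
Qed.

(** The series with [b = 1] as a function of time, continued by its value at [0] to negative times,
    because the energy lemmas ask for continuity on the whole line. *)
Definition psa c t := ps (mcoef alpha 1 c) ((Num.max t 0) `^ alpha).

Lemma continuous_max_powR : continuous (fun t : R => (Num.max t 0) `^ alpha).
Proof.
have cmax : continuous (fun t : R => Num.max t 0).
  by move=> t; apply: (@continuous_max R R id (cst 0)); [exact: cvg_id|exact: cvg_cst].
move=> t; have [t0|t0] := ltP 0 t.
  have m0 : 0 < Num.max t 0 by rewrite lt_max t0.
  apply: (@continuous_comp _ _ _ (fun t : R => Num.max t 0) (fun t => t `^ alpha)).
    exact: cmax.
  exact: continuous_powR_gt0.
rewrite /continuous_at (max_idPr t0) powR0 ?gt_eqF//.
apply/cvgrPdist_le => /= e e0; have d0 : 0 < e `^ alpha^-1 by rewrite powR_gt0.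
have hs : \forall s \near (t : R), s <= e `^ alpha^-1.
  exact: (cvgr_le t (@cvg_id _ (nbhs (t : R))) _ (le_lt_trans t0 d0)).
near=> s; rewrite sub0r normrN ger0_norm ?powR_ge0//.
have -> : e = (e `^ alpha^-1) `^ alpha by rewrite -powRrM mulVf ?gt_eqF// powRr1// ltW.
rewrite ge0_ler_powR ?nnegrE ?powR_ge0 ?(ltW alpha_gt0) ?le_max ?lexx ?orbT//.
rewrite ge_max powR_ge0 andbT; near: s; exact: hs.
Unshelve. all: by end_near.
Qed.

Lemma continuous_psa c : geo c -> continuous (psa c).
Proof.
move=> hc t; apply: (@continuous_comp _ _ _ (fun t : R => (Num.max t 0) `^ alpha) (ps (mcoef alpha 1 c))).
  exact: continuous_max_powR.
by apply: continuous_ps; exact: entire_mcoef.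
Qed.

Lemma psa_gt0 c t : 0 < t -> psa c t = ps (mcoef alpha 1 c) (t `^ alpha).
Proof. by move=> t0; rewrite /psa max_l// ltW. Qed.

Lemma mser1_psa c : mser alpha c 1 = psa c \_ `]0, +oo[.
Proof.
apply/funext => t; rewrite patchE mem_setE in_itv/= andbT /mser.
have [t0|t0] := ltP 0 t; last by rewrite pk_le0// mul0r.
by rewrite psa_gt0// pk_gt0// subrr powRr0 mul1r.
Qed.

Lemma frac_psa c t : geo c -> 0 < t ->
  (Gamma alpha)^-1 * frac alpha (psa c) t =
  t `^ alpha * ps (mcoef alpha (1 + alpha) c) (t `^ alpha).
Proof.
move=> hc t0; rewrite /frac -mser1_psa.
have wm := W_mser alpha_gt0 ltr01 hc.
rewrite -(convZl _ _ alpha_gt0 ltr01 (W_pk alpha) wm) -[LHS]/(conv (rlk alpha) _ t).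
by rewrite conv_mser// /mser pk_gt0// (addrC 1) addrK.
Qed.

Lemma Lg_psaD c d : geo c -> geo d -> Lg (psa c) -> Lg (psa d) -> Lg (psa (fun m => c m + d m)).
Proof.
move=> hc hd Lc Ld; rewrite (_ : psa _ = fun t => psa c t + psa d t); first exact: Lg_add.
by apply/funext => t; rewrite /psa ps_mcoefD.
Qed.

Lemma Lg_psaZ x c : geo c -> Lg (psa c) -> Lg (psa (fun m => x * c m)).
Proof.
move=> hc Lc; rewrite (_ : psa _ = fun t => x * psa c t); first exact: Lg_scale.
by apply/funext => t; rewrite /psa ps_mcoefZ.
Qed.

Lemma psa_delta t : psa (fun m => (m == 0%N)%:R) t = 1.
Proof.
rewrite /psa ps_mcoef_shift; last exact: geo_delta.
rewrite [X in ps (mcoef _ _ X)](_ : _ = fun m => 0 * (m == 0%N)%:R).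
  by rewrite ps_mcoefZ ?mul0r ?mulr0 ?addr0//; [exact: addr_gt0|exact: geo_delta].
by apply/funext => m; rewrite mul0r.
Qed.

(** Pointwise [|f| <= (1 + f^2) / 2]; the constant integrates to a multiple of [t], matching the
    linear growth of the energy. *)
Lemma Rintegral_le_energy f t C : 0 < t -> continuous f ->
  \int[mu]_(x in `]0, t[) f x ^+ 2 <= C * t ->
  `|\int[mu]_(x in `]0, t[) f x| <= t * ((1 + C) / 2).
Proof.
move=> t0 cf hC.
have mD : measurable (`]0, t[%classic : set (measurableTypeR R)) by exact: measurable_itv.
have I1 := integrable_0T t cf.
have I2 := integrable_sqr_0T t cf.
have I3 : mu.-integrable `]0, t[ (EFin \o cst 1).
  by apply: integrable_0T => x; exact: cvg_cst.
have I4 : mu.-integrable `]0, t[ (EFin \o (fun x => 1 + f x ^+ 2)).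
  exact: (integrableD mD I3 I2).
apply: (le_trans (le_normr_Rintegral mD I1)).
apply: (@le_trans _ _ (\int[mu]_(x in `]0, t[) (2^-1 * (1 + f x ^+ 2)))).
  apply: le_Rintegral => //.
  - exact: integrable_norm.
  - exact: (integrableZl mD _ I4).
  - move=> x _; have := sqr_ge0 (`|f x| - 1); rewrite sqrrB1 real_normK ?num_real//; lra.
rewrite RintegralZl// RintegralD// Rintegral_cst//= lebesgue_measure_itv/= lte_fin t0 -EFinB/= subr0 mul1r.
have := hC; set J := \int[mu]_(x in _) _ => h.
by rewrite mulrCA; lra.
Qed.

Section Matrix.
Context (n : nat) (A : 'M[R]_n.+1).
Hypothesis specA : spectrum A `<=` Lambda alpha.

Definition mxpow i j m := (A ^+ m) i j.

Lemma geo_mxpow i j : geo (mxpow i j).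
Proof.
(* The sum of all entries dominates every row sum, which is what the induction on the power uses. *)
pose B := \sum_i \sum_j `|A i j|.
have B0 : 0 <= B by apply: sumr_ge0 => k _; exact: sumr_ge0.
exists 1, B; split=> // m; rewrite mul1r /mxpow.
elim: m i j => [|m ih] i j.
  by rewrite expr0 mxE expr0; case: (i == j); rewrite ?normr1 ?normr0.
rewrite exprS mxE (le_trans (ler_norm_sum _ _ _))//.
apply: (@le_trans _ _ (\sum_k `|A i k| * B ^+ m)).
  by apply: ler_sum => k _; rewrite normrM ler_wpM2l.
rewrite -mulr_suml exprS; apply: ler_wpM2r; first exact: exprn_ge0.
rewrite /B [leRHS](bigD1 i)//= lerDl.
by apply: sumr_ge0 => k _; exact: sumr_ge0.
Qed.

Lemma mxpowS i j m : mxpow i j m.+1 = \sum_k A i k * mxpow k j m.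
Proof. by rewrite /mxpow exprS mxE. Qed.

(** The increments of [r]. For the series [X] with coefficients [r_m A^m], the operator [A I^alpha]
    raises the index by one, so [X - A I^alpha X] is the same series with [r] replaced by these
    increments. *)
Definition dweight (r : nat -> R) m := if m is m'.+1 then r m - r m' else r 0%N.

(** The series with weights [r] solves [X = A I^alpha X + w] with [w] the series of increments, so
    the matrix energy bound passes from the increments to [r]. A polynomial weight has increments of
    lower degree apart from the term [m = 0], which allows induction on the degree. *)
Lemma weight_energy (r : nat -> R) :
  (forall i j, geo (fun m => r m * mxpow i j m)) ->
  (forall i j, geo (fun m => dweight r m * mxpow i j m)) ->
  (forall i j, Lg (psa (fun m => dweight r m * mxpow i j m))) ->
  forall i j, Lg (psa (fun m => r m * mxpow i j m)).
Proof.
move=> gr gd Ld i j.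
pose X t := \matrix_(i, j) psa (fun m => r m * mxpow i j m) t.
pose w t := \matrix_(i, j) psa (fun m => dweight r m * mxpow i j m) t.
have XE i' j' : (fun t => X t i' j') = psa (fun m => r m * mxpow i' j' m).
  by apply/funext => t; rewrite mxE.
rewrite -XE; apply: (@matrix_energy _ alpha alpha_gt0 alpha_lt1 n A X w specA).
- by move=> i' j'; rewrite XE; exact: continuous_psa.
- by move=> i' j'; rewrite XE -mser1_psa; exact: W_mser.
- move=> t t0; apply/matrixP => i' j'.
  rewrite [LHS]mxE [RHS]mxE [X in _ = X + _]mxE [X in _ = _ + X]mxE.
  have a1 : 0 < 1 + alpha by exact: addr_gt0.
  set u := t `^ alpha.
  under eq_bigr do rewrite !mxE XE (frac_psa (gr _ _) t0) -/u mulrCA.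
  have gk k : geo (fun m => r m * mxpow k j' m) by exact: gr.
  rewrite -mulr_sumr -(ps_mcoef_sum _ _ _ a1 gk) (psa_gt0 _ t0) (psa_gt0 _ t0) -/u.
  rewrite [LHS](ps_mcoef_shift u (gr i' j')) [X in _ = _ + X](ps_mcoef_shift u (gd i' j')).
  rewrite [RHS]addrCA -mulrDr; congr (_ + _ * _).
  have gs : geo (fun m => \sum_(k <- index_enum 'I_n.+1) A i' k * (r m * mxpow k j' m)).
    by apply: geo_sum => k; apply: geo_scale; exact: gk.
  rewrite -(ps_mcoefD _ a1 gs (geo_shift (gd i' j'))).
  congr (ps _ u); apply/funext => m; rewrite /mcoef; congr (_ / _).
  rewrite [\sum_(_ <- _) _](_ : _ = r m * mxpow i' j' m.+1).
    by rewrite /dweight mulrBl addrC subrK.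
  by rewrite mxpowS mulr_sumr; apply: eq_bigr => k _; rewrite mulrCA.
- move=> i' j'; rewrite (_ : (fun t => _) = fun t => real_complex R (psa (fun m => dweight r m * mxpow i' j' m) t)).
    exact: LgC_real.
  by apply/funext => t; rewrite /= !mxE.
Qed.

Let P := mxpow.

Let geo_deltaP i j : geo (fun m => (m == 0%N)%:R * P i j m).
Proof.
rewrite (_ : (fun m => _) = fun m => P i j 0%N * (m == 0%N)%:R).
  exact: geo_scale geo_delta.
by apply/funext => -[|m] /=; rewrite ?mulr1 ?mul1r ?mulr0 ?mul0r.
Qed.

Let Lg_deltaP i j : Lg (psa (fun m => (m == 0%N)%:R * P i j m)).
Proof.
rewrite (_ : (fun m => _) = fun m => P i j 0%N * (m == 0%N)%:R).
  apply: Lg_psaZ; first exact: geo_delta.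
  rewrite (_ : psa _ = fun=> 1); first exact: Lg_cst.
  by apply/funext => t; exact: psa_delta.
by apply/funext => -[|m] /=; rewrite ?mulr1 ?mul1r ?mulr0 ?mul0r.
Qed.

Let geo_P0 i j : geo (fun m => 1 * P i j m).
Proof. exact: geo_scale (geo_mxpow i j). Qed.

Let geo_P1 i j : geo (fun m => alpha * m%:R * P i j m).
Proof.
rewrite (_ : (fun m => _) = fun m => alpha * (m%:R * P i j m)).
  exact: geo_scale (geo_natM (geo_mxpow i j)).
by apply/funext => m; rewrite mulrA.
Qed.

Let geo_P2 i j : geo (fun m => (alpha * m%:R) ^+ 2 * P i j m).
Proof.
rewrite (_ : (fun m => _) = fun m => alpha ^+ 2 * (m%:R * (m%:R * P i j m))).
  exact: geo_scale (geo_natM (geo_natM (geo_mxpow i j))).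
by apply/funext => m; ring.
Qed.

Let Lg_P0 i j : Lg (psa (fun m => 1 * P i j m)).
Proof.
have E k l : (fun m => dweight (fun=> 1) m * mxpow k l m) = (fun m => (m == 0%N)%:R * P k l m).
  by apply/funext => -[|m] /=; rewrite ?subrr.
by apply: (weight_energy geo_P0) => k l; rewrite E; [exact: geo_deltaP|exact: Lg_deltaP].
Qed.

(** The weight [alpha * m] is the effect of [t d/dt] on [t^(alpha m)], so this is the first Euler
    derivative of [E_alpha(t^alpha A)]; the squared weight gives the second. *)
Let Lg_P1 i j : Lg (psa (fun m => alpha * m%:R * P i j m)).
Proof.
have E k l : (fun m => dweight (fun m => alpha * m%:R) m * mxpow k l m) =
    (fun m => alpha * (1 * P k l m) + (- alpha) * ((m == 0%N)%:R * P k l m)).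
  apply/funext => -[|m]; rewrite /P /dweight ?eqxx -?[m.+1%:R]natr1 /=; ring.
apply: (weight_energy geo_P1) => k l; rewrite E.
  by apply: geo_add; apply: geo_scale; [exact: geo_P0|exact: geo_deltaP].
apply: Lg_psaD; [exact: geo_scale|exact: geo_scale|exact: Lg_psaZ|exact: Lg_psaZ].
Qed.

Let Lg_P2 i j : Lg (psa (fun m => (alpha * m%:R) ^+ 2 * P i j m)).
Proof.
have E k l : (fun m => dweight (fun m => (alpha * m%:R) ^+ 2) m * mxpow k l m) =
    (fun m => 2 * alpha * (alpha * m%:R * P k l m) +
      ((- alpha ^+ 2) * (1 * P k l m) + alpha ^+ 2 * ((m == 0%N)%:R * P k l m))).
  apply/funext => -[|m]; rewrite /P /dweight ?eqxx -?[m.+1%:R]natr1 /=; ring.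
have g3 k l : geo (fun m => (- alpha ^+ 2) * (1 * P k l m) + alpha ^+ 2 * ((m == 0%N)%:R * P k l m)).
  by apply: geo_add; apply: geo_scale; [exact: geo_P0|exact: geo_deltaP].
apply: (weight_energy geo_P2) => k l; rewrite E.
  by apply: geo_add => //; apply: geo_scale.
apply: Lg_psaD => //; first exact: geo_scale.
  exact: Lg_psaZ.
by apply: Lg_psaD; [exact: geo_scale|exact: geo_scale|exact: Lg_psaZ|exact: Lg_psaZ].
Qed.

(* [t X(t)] is the integral of [X] plus its Euler derivative, which turns mean square
   bounds into a pointwise one. *)
Let bound_P1 i j : exists2 C, 0 <= C & forall t, 0 < t ->
  `|ps (mcoef alpha 1 (fun m => alpha * m%:R * P i j m)) (t `^ alpha)| <= C.
Proof.
pose c m := alpha * m%:R * P i j m + (alpha * m%:R) ^+ 2 * P i j m.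
have gc : geo c by exact: geo_add.
have [cf [C C0 hC]] : Lg (psa c) by exact: Lg_psaD.
exists ((1 + C) / 2); first by rewrite divr_ge0// addr_ge0.
move=> t t0; have two0 : 0 < 1 + 1 :> R by [].
have E : mser alpha c (1 + 1) t = t * ps (mcoef alpha 1 (fun m => alpha * m%:R * P i j m)) (t `^ alpha).
  have -> : mser alpha c (1 + 1) t = pk (1 + 1) t * ps (mcoef alpha (1 + 1) c) (t `^ alpha) by [].
  have -> : mcoef alpha (1 + 1) c = mcoef alpha 1 (fun m => alpha * m%:R * P i j m).
    apply/funext => m; rewrite /mcoef /c addrA GammaD1; last exact: am_gt0.
    have g0 := lt0r_neq0 (Gamma_gt0 (am_gt0 alpha_gt0 m (@ltr01 R))).
    have a0 := lt0r_neq0 (am_gt0 alpha_gt0 m (@ltr01 R)).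
    by field; rewrite g0 a0.
  have -> : pk (1 + 1) t = t by rewrite (pk_gt0 _ t0) addrK (powRr1 (ltW t0)).
  by [].
have E2 : mser alpha c (1 + 1) t = \int[mu]_(x in `]0, t[) psa c x.
  rewrite -(conv_mser alpha_gt0 t ltr01 ltr01 gc) /rlk.
  have wm := W_mser alpha_gt0 ltr01 gc.
  rewrite (convZl _ _ ltr01 ltr01 (W_pk 1) wm) Gamma1 invr1 mul1r conv1E; last first.
    by move=> x; exact: (W_le0 wm).
  apply: eq_Rintegral => x; rewrite inE/= in_itv/= => /andP[x0 _].
  by rewrite mser1_psa patchE mem_setE in_itv/= x0.
rewrite -(ler_pM2l t0) -[X in X * `|_|](gtr0_norm t0) -normrM -E E2.
exact: Rintegral_le_energy (hC t (ltW t0)).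
Qed.

(** At [u = t^alpha] this is [t d/dt E_alpha(t^alpha A) = t^alpha A E_{alpha,alpha}(t^alpha A)],
    compared coefficient by coefficient through [Gamma (x + 1) = x * Gamma x]. *)
Let euler_psa i j u :
  u * (\sum_k A i k * ps (mcoef alpha alpha (P k j)) u) =
  ps (mcoef alpha 1 (fun m => alpha * m%:R * P i j m)) u.
Proof.
have gk k : geo (P k j) by exact: geo_mxpow.
rewrite (ps_mcoef_shift u (geo_P1 i j)) -(ps_mcoef_sum _ _ _ alpha_gt0 gk).
have -> : alpha * 0%:R * P i j 0 = 0 by rewrite mulr0 mul0r.
rewrite add0r.
suff -> : mcoef alpha alpha (fun m => \sum_i0 A i i0 * P i0 j m) =
    mcoef alpha (1 + alpha) (fun m => alpha * m.+1%:R * P i j m.+1) by [].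
apply/funext => m; rewrite /mcoef /P mxpowS.
have -> : alpha * m%:R + (1 + alpha) = (alpha * m%:R + alpha) + 1 by ring.
rewrite GammaD1; last exact: am_gt0.
have g0 := lt0r_neq0 (Gamma_gt0 (am_gt0 alpha_gt0 m alpha_gt0)).
have a0 := lt0r_neq0 (am_gt0 alpha_gt0 m alpha_gt0).
have -> : alpha * m.+1%:R = alpha * m%:R + alpha by rewrite -natr1 mulrDr mulr1.
by field; rewrite g0 a0.
Qed.

(** Inverting [A] in the Euler identity bounds [E_{alpha,alpha}(t^alpha A)], at the price of the
    factor [t^alpha]. *)
Let bound_far : exists2 C, 0 <= C & forall i j t, 0 < t ->
  t `^ alpha * `|ps (mcoef alpha alpha (P i j)) (t `^ alpha)| <= C.
Proof.
have uA : A \in unitmx by rewrite -(map_unitmx (real_complex R)); exact: complex_unitmx specA.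
have [D D0 hD] := @uniform_bound R ('I_n.+1 * 'I_n.+1)%type R (fun t => 0 < t)
  (fun ij t => `|ps (mcoef alpha 1 (fun m => alpha * m%:R * P ij.1 ij.2 m)) (t `^ alpha)|)
  (fun ij => bound_P1 ij.1 ij.2).
exists (\sum_i \sum_k `|invmx A i k| * D).
  by do 2![apply: sumr_ge0 => ? _]; rewrite mulr_ge0.
move=> i j t t0; set u := t `^ alpha.
have u0 : 0 <= u by exact: powR_ge0.
rewrite -[X in X * _](ger0_norm u0) -normrM.
pose E := \matrix_(k < n.+1, l < n.+1) ps (mcoef alpha alpha (P k l)) u.
pose F := \matrix_(k < n.+1, l < n.+1) ps (mcoef alpha 1 (fun m => alpha * m%:R * P k l m)) u.
have EF : u *: E = invmx A *m F.
  rewrite -[LHS](mulKmx uA); congr (_ *m _); apply/matrixP => k l; rewrite !mxE -euler_psa mulr_sumr.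
  by apply: eq_bigr => m _; rewrite !mxE mulrCA.
have -> : u * ps (mcoef alpha alpha (P i j)) u = (u *: E) i j by rewrite !mxE.
rewrite EF mxE; apply: (le_trans (ler_norm_sum _ _ _)).
apply: (@le_trans _ _ (\sum_k `|invmx A i k| * D)).
  by apply: ler_sum => k _; rewrite normrM ler_wpM2l// mxE; exact: (hD (k, j)).
rewrite [leRHS](bigD1 i)//= lerDl.
by do 2![apply: sumr_ge0 => ? _]; rewrite mulr_ge0.
Qed.

Lemma resolvent_bound : exists2 C, 0 <= C & forall i j t, 0 < t ->
  `|ps (mcoef alpha alpha (mxpow i j)) (t `^ alpha)| <= C.
Proof.
have [C C0 hC] := bound_far.
have [D D0 hD] := @uniform_bound R ('I_n.+1 * 'I_n.+1)%type R (fun u => `|u| <= 1)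
  (fun ij u => `|ps (mcoef alpha alpha (P ij.1 ij.2)) u|)
  (fun ij => ps_bound ler01 (entire_mcoef alpha_gt0 alpha_gt0 (geo_mxpow ij.1 ij.2))).
exists (C + D); first exact: addr_ge0.
move=> i j t t0; set u := t `^ alpha.
have u0 : 0 <= u by exact: powR_ge0.
have [u1|u1] := leP u 1.
  apply: (@le_trans _ _ D); last by rewrite lerDr.
  by apply: (hD (i, j)); rewrite ger0_norm.
apply: (@le_trans _ _ C); last by rewrite lerDl.
apply: le_trans (hC i j t t0); rewrite -/u ler_peMl//; exact: ltW.
Qed.

End Matrix.
End ResolventBound.

(** * The resolvent and the variation of constants formula *)

Section Resolvent.
Context {R : realType}.
Context (alpha : R) (alpha_gt0 : 0 < alpha) (alpha_lt1 : alpha < 1).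
Context (n : nat) (A : 'M[R]_n.+1).

Definition resolvent i j := mser alpha (mxpow A i j) alpha.

Lemma W_resolvent i j : W alpha (resolvent i j).
Proof. exact: W_mser alpha_gt0 _ _ alpha_gt0 (geo_mxpow A i j). Qed.

Lemma rlk1 t : rlk 1 t = pk 1 t :> R.
Proof. by rewrite /rlk Gamma1 invr1 mul1r. Qed.

Lemma mxpowSr i j m : mxpow A i j m.+1 = \sum_k A k j * mxpow A i k m.
Proof. by rewrite /mxpow exprSr mxE; apply: eq_bigr => k _; rewrite mulrC. Qed.

Let beta_gt0 : 0 < 1 - alpha. Proof. by rewrite subr_gt0. Qed.

(** Dropping the constant term of the series shifts its index and splits off one power of [A]. That
    power is put on the right, which is possible since [A] commutes with its powers, so that it
    meets the [A x] of the equation and cancels. *)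
Lemma conv_rlk_resolvent i j t : conv (rlk (1 - alpha)) (resolvent i j) t =
  (i == j)%:R * pk 1 t + \sum_l A l j * conv (pk 1) (resolvent i l) t.
Proof.
have gP k : geo (mxpow A i k) := geo_mxpow A i k.
rewrite (conv_mser alpha_gt0 t beta_gt0 alpha_gt0 (gP j)).
have -> : alpha + (1 - alpha) = 1 by ring.
have E l : conv (pk 1) (resolvent i l) t = mser alpha (mxpow A i l) (1 + alpha) t.
  rewrite (addrC 1) -(conv_mser alpha_gt0 t ltr01 alpha_gt0 (gP l)).
  by apply: eq_conv => // x; rewrite rlk1.
under eq_bigr do rewrite E.
rewrite /mser; set u := t `^ alpha.
have -> : pk (1 + alpha) t = pk 1 t * u.
  have [t0|t0] := leP t 0; first by rewrite !pk_le0// mul0r.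
  by rewrite (pk_gt0 _ t0) (pk_gt0 _ t0) subrr powRr0 mul1r (addrC 1) addrK.
rewrite (ps_mcoef_shift alpha_gt0 u (gP j)).
have -> : mxpow A i j 0 = (i == j)%:R by rewrite /mxpow expr0 mxE.
rewrite mulrDr mulrC; congr (_ + _).
have a1 : 0 < 1 + alpha by exact: addr_gt0.
have -> : (fun m => mxpow A i j m.+1) = (fun m => \sum_k A k j * mxpow A i k m).
  by apply/funext => m; exact: mxpowSr.
rewrite (ps_mcoef_sum alpha_gt0 _ _ _ a1 gP) mulrA mulr_sumr.
by apply: eq_bigr => k _; rewrite mulrCA.
Qed.

Section Representation.
Context (x h : 'I_n.+1 -> R -> R) (c : 'I_n.+1 -> R).
Hypothesis W_x : forall i, W alpha (x i).
Hypothesis W_h : forall i, W alpha (h i).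
Hypothesis x_eq : forall i t, conv (rlk (1 - alpha)) (x i) t =
  c i * pk 1 t + conv (pk 1) (fun s => \sum_l A i l * x l s + h i s) t.

Definition variation i s := \sum_j (c j * resolvent i j s + conv (resolvent i j) (h j) s).

Lemma W_conv_resolvent i j : W alpha (conv (resolvent i j) (h j)).
Proof.
apply: W_weaken (W_conv alpha_gt0 alpha_gt0 (W_resolvent i j) (W_h j)).
by rewrite lerDl ltW.
Qed.

Lemma W_variation i : W alpha (variation i).
Proof.
apply: W_sum => j; apply: W_add; last exact: W_conv_resolvent.
by apply: W_scale; exact: W_resolvent.
Qed.

(** The triple convolution [e * k_{1-alpha} * x] is computed twice: [lhs] joins [e] to the kernel
    and uses the resolvent identity, [rhs] joins the kernel to [x] and uses the integrated
    equation. *)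
Lemma conv_variation i t : conv (pk 1) (x i) t = conv (pk 1) (variation i) t.
Proof.
have o1 : 0 < 1 :> R by [].
have a1 : 0 < 1 + alpha by exact: addr_gt0.
have W1 : W 1 (pk 1 : R -> R) := W_pk 1.
pose f i s := \sum_l A i l * x l s + h i s.
pose E j := conv (pk 1) (resolvent i j).
have WE j : W (1 + alpha) (E j) := W_conv o1 alpha_gt0 W1 (W_resolvent i j).
have Wf j : W alpha (f j).
  by apply: W_add => //; apply: W_sum => l; exact: W_scale.
have mr j := W_measurable (W_resolvent i j).
have m1 : measurable_fun setT (pk 1 : R -> R) := measurable_pk 1.
have mk : measurable_fun setT (rlk (1 - alpha)) := W_measurable (W_rlk (1 - alpha)).
have one_E g j : W alpha g -> conv (E j) g t = conv (pk 1) (conv (resolvent i j) g) t.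
  by move=> Wg; exact: (convA t o1 alpha_gt0 alpha_gt0 W1 (W_resolvent i j) Wg).
have lhs j : conv (resolvent i j) (conv (rlk (1 - alpha)) (x j)) t =
    (i == j)%:R * conv (pk 1) (x j) t + \sum_l A l j * conv (E l) (x j) t.
  rewrite -(convA t alpha_gt0 beta_gt0 alpha_gt0 (W_resolvent i j) (W_rlk _) (W_x j)).
  rewrite (eq_conv (f2 := fun s => (i == j)%:R * pk 1 s + \sum_l A l j * E l s) (g2 := x j) t); last 2 first.
  - by move=> s; rewrite convC// conv_rlk_resolvent.
  - by [].
  rewrite (@convDl _ 1 alpha) //.
  - rewrite (convZl _ _ o1 alpha_gt0 W1 (W_x j)); congr (_ + _).
    rewrite (@conv_suml _ (1 + alpha) alpha)//; last by move=> l; exact: W_scale.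
    by apply: eq_bigr => l _; rewrite (convZl _ _ a1 alpha_gt0 (WE l) (W_x j)).
  - exact: W_scale.
  - apply: W_sum => l; apply: W_scale; apply: W_weaken (WE l).
    by rewrite lerDl ltW.
have rhs j : conv (resolvent i j) (conv (rlk (1 - alpha)) (x j)) t =
    c j * E j t + (\sum_l A j l * conv (E j) (x l) t + conv (E j) (h j) t).
  rewrite (eq_conv (f2 := resolvent i j) (g2 := fun s => c j * pk 1 s + conv (pk 1) (f j) s) t) //.
  rewrite (@convDr _ alpha 1)//; last 3 first.
  - exact: W_resolvent.
  - exact: W_scale.
  - by apply: W_weaken (W_conv o1 alpha_gt0 W1 (Wf j)); rewrite lerDl ltW.
  rewrite (convZr _ _ alpha_gt0 o1 (W_resolvent i j) W1) (convC _ (mr j) m1); congr (_ + _).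
  rewrite -(convA t alpha_gt0 o1 alpha_gt0 (W_resolvent i j) W1 (Wf j)).
  rewrite (eq_conv (f2 := E j) (g2 := f j) t); last 2 first.
  - by move=> s; rewrite convC.
  - by [].
  rewrite (@convDr _ (1 + alpha) alpha)//; last by apply: W_sum => l; exact: W_scale.
  rewrite (@conv_sumr _ (1 + alpha) alpha)//; last by move=> l; exact: W_scale.
  by under eq_bigr do rewrite (convZr _ _ a1 alpha_gt0 (WE j) (W_x _)).
have H : \sum_j ((i == j)%:R * conv (pk 1) (x j) t + \sum_l A l j * conv (E l) (x j) t) =
  \sum_j (c j * E j t + (\sum_l A j l * conv (E j) (x l) t + conv (E j) (h j) t)).
  by apply: eq_bigr => j _; rewrite -lhs rhs.
rewrite big_split/= (bigD1 i)//= eqxx mul1r big1 ?addr0 in H; last first.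
  by move=> j ji; rewrite eq_sym (negbTE ji) mul0r.
(* After the exchange of summations both sides contain the same double sum with [A]; it cancels and
   leaves [1 * x] on the left. *)
rewrite 2!big_split/= exchange_big/= addrCA (addrC (conv _ _ _)) in H.
move/addrI in H; rewrite H /variation.
rewrite (conv_sumr _ _ o1 alpha_gt0 W1); last first.
  by move=> j; apply: W_add; [apply: W_scale; exact: W_resolvent|exact: W_conv_resolvent].
rewrite -big_split/=; apply: eq_bigr => j _.
rewrite (convDr _ o1 alpha_gt0 W1 (W_scale _ (W_resolvent i j)) (W_conv_resolvent i j)).
by rewrite (convZr _ _ o1 alpha_gt0 W1 (W_resolvent i j)) one_E.
Qed.

End Representation.
End Resolvent.

(** * From integral identities to pointwise statements *)

Section AlmostEverywhere.
Context {R : realType}.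
Implicit Types (a b c t T : R) (f d : R -> R).

(** Lebesgue differentiation. The factor [pk 1 (T - x)] cuts [d] at [T], which makes it integrable
    on the line without changing it before [T]; its primitive vanishes up to [T]. *)
Lemma conv1_eq0_ae a d T : 0 < a -> W a d -> (forall t, conv (pk 1) d t = 0) ->
  {ae mu, forall t, t < T -> d t = 0}.
Proof.
move=> a0 wd d0; pose f x := pk 1 (T - x) * d x.
have If : mu.-integrable setT (EFin \o f) := W_conv_integrable T ltr01 a0 (W_pk 1) wd.
have loc : locally_integrable [set: R] f.
  by have := integrable_locally measurableT If; rewrite patch_setT.
have IN y : mu.-integrable [set` Interval -oo%O (BRight y)] (EFin \o f).
  by apply: integrableS If => //; exact: measurable_itv.
have fE t x : t <= T -> x < t -> f x = d x.
  move=> tT xt; rewrite /f pk_gt0 ?subr_gt0 ?(lt_le_trans xt tT)//.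
  by rewrite subrr powRr0 mul1r.
have F0 t : t <= T -> \int[mu]_(x in [set` Interval -oo%O (BRight t)]) f x = 0.
  move=> tT; rewrite -Rintegral_itv_bndo_bndc; last first.
    by apply: integrableS If => //; exact: measurable_itv.
  rewrite -[RHS](d0 t) Rintegral_mkcond /conv; apply: eq_Rintegral => x _.
  rewrite patchE mem_setE in_itv/=; have [xt|xt] := ltP x t.
    by rewrite (fE t)// pk_gt0 ?subr_gt0// subrr powRr0 mul1r.
  by rewrite pk_le0 ?mul0r// subr_le0.
have := FTC1 IN loc; apply: filterS; first exact: (ae_filter_ringOfSetsType mu).
move=> t /(_ (ltNyr t))[_ H] tT.
rewrite -(fE T t)// -H derive1E.
have near0 : \forall x \near t, (fun x => \int[mu]_(x in [set` Interval -oo%O (BRight x)]) f x) x = cst 0 x.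
  near=> x; apply: F0; apply: ltW.
  by near: x; exact: lt_nbhsl.
by rewrite (near_eq_derive _ near0) derive_cst.
Unshelve. all: by end_near.
Qed.

(** A violation at [t] would persist near [t], and that neighbourhood meets []a, b[] in an interval
    of positive length even when [t] is an end point. *)
Lemma ae_le_continuous a b c f t : a < b -> a <= t <= b -> {for t, continuous f} ->
  {ae mu, forall s, a < s < b -> f s <= c} -> f t <= c.
Proof.
move=> ab tab cf hae; rewrite leNgt; apply/negP => ct.
have /nbhs_ballP[e /= e0 he] : \forall s \near t, c < f s by exact: (cvgr_gt (f t) cf c ct).
have [B [mB B0 hB]] := hae.
pose l := Num.max a (t - e); pose r := Num.min b (t + e).
have lr : l < r.
  rewrite /l /r lt_min !gt_max; move: tab => /andP[? ?].
  by apply/andP; split; apply/andP; split; lra.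
have sub : `]l, r[%classic `<=` B.
  move=> s /=; rewrite in_itv/= => /andP[ls sr]; apply: hB => /= /(_ _).
  move: ls sr; rewrite /l /r lt_min gt_max => /andP[as_ es] /andP[sb se].
  have : c < f s.
    by apply: he; rewrite /ball/= ltr_distl; apply/andP; split; lra.
  by move=> cs; rewrite as_ sb => /(_ isT); rewrite leNgt cs.
have : (mu `]l, r[%classic <= mu B)%E.
  by apply: le_measure => //; rewrite inE//; exact: measurable_itv.
by rewrite B0 lebesgue_measure_itv/= lte_fin lr -EFinB lee_fin leNgt subr_gt0 lr.
Qed.

(* [f2] need not be measurable: it will be the induced norm of a matrix function. *)
Lemma ge0_le_integral_nonmeas (D : set R) (f1 f2 : R -> \bar R) :
  (forall x, D x -> 0 <= f1 x)%E -> (forall x, D x -> f1 x <= f2 x)%E ->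
  (\int[mu]_(x in D) f1 x <= \int[mu]_(x in D) f2 x)%E.
Proof.
move=> f0 f12; rewrite !ge0_integralE//; last first.
  by move=> x Dx; apply: le_trans (f12 x Dx); exact: f0.
apply: ereal_sup_le => y [h /= hf <-]; exists h => //= x.
apply: le_trans (hf x) _; rewrite !patchE; case: ifPn => //.
by move=> /set_mem; exact: f12.
Qed.

Lemma weighted_bound a (x : R -> R) T : (forall t : R, 0 < t -> {for t, continuous x}) ->
  cvg (t `^ (1 - a) * x t @[t --> 0^'+]) ->
  exists2 C, 0 <= C & forall t, 0 < t <= T -> t `^ (1 - a) * `|x t| <= C.
Proof.
move=> cx cv; pose z t := t `^ (1 - a) * `|x t|.
have [M M0 hM] : exists2 M, 0 <= M & \forall t \near 0^'+, z t <= M.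
  have cz : cvg (z t @[t --> 0^'+]).
    apply/cvg_ex; exists `|lim (t `^ (1 - a) * x t @[t --> 0^'+])|.
    rewrite (_ : z = fun t => `|t `^ (1 - a) * x t|); first exact: cvg_norm.
    by apply/funext => t; rewrite normrM (ger0_norm (powR_ge0 _ _)).
  exists (`|lim (z t @[t --> 0^'+])| + 1); first exact: addr_ge0.
  have : \forall t \near 0^'+, `|lim (z t @[t --> 0^'+]) - z t| <= 1.
    by apply: cvgr_dist_le => //.
  apply: filterS => t; rewrite ler_distlC => /andP[_ /le_trans]; apply.
  by rewrite lerD2r ler_norm.
move: hM; rewrite near_withinE => /nbhs_ballP[e /= e0 he].
have zM t : 0 < t < e -> z t <= M.
  move=> /andP[t0 te]; apply: he => //=.
  by rewrite /ball/= sub0r normrN gtr0_norm.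
have [eT|eT] := leP (e / 2) T; last first.
  by exists M => // t /andP[t0 tT]; apply: zM; rewrite t0/=; lra.
have cz : {within `[e / 2, T], continuous z}.
  apply: continuous_in_subspaceT => t /set_mem/=; rewrite in_itv/= => /andP[et _].
  have t0 : 0 < t by apply: lt_le_trans et; rewrite divr_gt0.
  apply: cvgM; first exact: continuous_powR_gt0.
  by apply: cvg_norm; exact: cx.
have [c _ hc] := EVT_max eT cz.
exists (M + `|z c|); first exact: addr_ge0.
move=> t /andP[t0 tT]; have [te|te] := ltP t e.
  by apply: (le_trans (zM t _)); rewrite ?t0// lerDl.
apply: (@le_trans _ _ (z c)); first by apply: hc; rewrite in_itv/= tT andbT; lra.
by rewrite (le_trans (ler_norm _))// lerDr.
Qed.

Lemma W_weighted a (x : R -> R) : (forall t : R, 0 < t -> {for t, continuous x}) ->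
  cvg (t `^ (1 - a) * x t @[t --> 0^'+]) -> W a (x \_ `]0, +oo[).
Proof.
move=> cx cv; split; first exact: measurable_cut.
move=> T; have [C C0 hC] := weighted_bound T cx cv; exists C => // t tT.
have [t0|t0] := ltP 0 t; last by rewrite cut_le0// normr0 pk_le0// mulr0.
rewrite (cutE _ t0) (pk_gt0 _ t0) -opprB powRN ler_pdivlMr ?powR_gt0// mulrC.
by apply: hC; rewrite t0.
Qed.

(** [y] and the primitive [F] have the same increments on []0, +oo[]. The derivative is known only
    there, so the constant is read off at [1] rather than at [0]. *)
Lemma volterra_integral b (y f : R -> R) t : 0 < t ->
  (forall s : R, 0 < s -> is_derive s 1 y (f s)) ->
  (forall s : R, 0 < s -> {for s, continuous f}) ->
  W b (f \_ `]0, +oo[) -> 0 < b ->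
  y t = y 1 - conv (pk 1) (f \_ `]0, +oo[) 1 + conv (pk 1) (f \_ `]0, +oo[) t.
Proof.
move=> t0 dy cf wf b0; set F := conv _ _.
have step p q : 0 < p -> p < q -> y q - F q = y p - F p.
  move=> p0 pq.
  have q0 := lt_trans p0 pq.
  have FE s : 0 < s -> F s = \int[mu]_(u in `]0, s[) f u.
    move=> s0; rewrite /F conv1E; last by move=> x; exact: cut_le0.
    by apply: eq_Rintegral => x; rewrite inE/= in_itv/= => /andP[x0 _]; rewrite cutE.
  suff : F q - F p = y q - y p by move: (F q) (F p) (y q) (y p) => ? ? ? ?; lra.
  have Iq : mu.-integrable `]0, q[ (EFin \o f).
    have I1 := W_conv_integrable q ltr01 b0 (W_pk 1) wf.
    have : mu.-integrable `]0, q[ (EFin \o (fun x => pk 1 (q - x) * (f \_ `]0, +oo[) x)).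
      by apply: integrableS I1 => //; exact: measurable_itv.
    apply: eq_integrable => [|x]; first exact: measurable_itv.
    rewrite inE/= in_itv/= => /andP[x0 xq]; rewrite (cutE _ x0).
    by rewrite pk_gt0 ?subr_gt0// subrr powRr0 mul1r.
  rewrite (FE _ p0) (FE _ q0).
  have := @Rintegral_itvB R f (BRight 0) (BLeft q) p Iq.
  rewrite !bnd_simp => /(_ (ltW p0) pq) EB.
  rewrite (@Rintegral_itv_bndo_bndc R (BRight 0) p); last first.
    apply: integrableS Iq; [exact: measurable_itv|exact: measurable_itv|move=> s /=].
    by rewrite !in_itv/= => /andP[-> /lt_trans]; apply.
  rewrite EB; apply: Rintegral_FTC => // s /andP[ps _]; [apply: cf|apply: dy];
    exact: lt_le_trans ps.
have : y t - F t = y 1 - F 1.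
  have [t1|t1|->//] := ltgtP t 1; [exact/esym/step|exact: step].
by move=> <-; rewrite subrK.
Qed.

End AlmostEverywhere.

(** * Arbitrary norms in finite dimension *)

Section FiniteDimensionalNorm.
Context {R : realType} (n : nat) (N : 'cV[R]_n.+1 -> R) (normN : is_norm N).
Implicit Types (u v w : 'cV[R]_n.+1) (l : 'I_n.+1 -> R) (M : 'M[R]_n.+1).

Lemma is_norm0 : N 0 = 0.
Proof. by rewrite -(scale0r 0) (normZ normN) normr0 mul0r. Qed.

Lemma is_normN v : N (- v) = N v.
Proof. by rewrite -scaleN1r (normZ normN) normrN1 mul1r. Qed.

Lemma is_norm_sum (I : Type) (r : seq I) (F : I -> 'cV[R]_n.+1) :
  N (\sum_(i <- r) F i) <= \sum_(i <- r) N (F i).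
Proof.
elim: r => [|i r ih]; first by rewrite !big_nil is_norm0.
by rewrite !big_cons (le_trans (norm_triangle normN _ _))// lerD2l.
Qed.

Lemma mx_norm_entry p q (M : 'M[R]_(p, q)) i j : `|M i j| <= `|M|.
Proof.
rewrite [leRHS]/Num.norm /= mx_normrE; apply/bigmax_geP; right => /=.
by exists (i, j).
Qed.

Definition norm_basis_sum := \sum_i N (delta_mx i 0).

Lemma norm_basis_sum_ge0 : 0 <= norm_basis_sum.
Proof. by apply: sumr_ge0 => i _; exact: norm_ge0. Qed.

Lemma norm_le_entries v c : 0 <= c -> (forall i, `|v i 0| <= c) -> N v <= norm_basis_sum * c.
Proof.
move=> c0 hv; rewrite [X in N X]matrix_sum_delta (le_trans (is_norm_sum _ _))//.
rewrite mulr_suml; apply: ler_sum => i _; rewrite big_ord1 (normZ normN) mulrC.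
by apply: ler_wpM2l => //; exact: norm_ge0.
Qed.

Lemma norm_le_mx_norm v : N v <= norm_basis_sum * `|v|.
Proof. by apply: norm_le_entries => // i; exact: mx_norm_entry. Qed.

Lemma is_norm_dist u v : `|N u - N v| <= N (u - v).
Proof.
have h a b : N a - N b <= N (a - b).
  by rewrite lerBlDr -{1}(subrK b a) (norm_triangle normN).
have E : N (v - u) = N (u - v) by rewrite -is_normN opprB.
have := h u v; have := h v u; rewrite ler_norml E; lra.
Qed.

Lemma cvg_is_norm (T : Type) (F : set_system T) {FF : Filter F} (f : T -> 'cV[R]_n.+1) u :
  f x @[x --> F] --> u -> N (f x) @[x --> F] --> N u.
Proof.
move=> fu; apply/(@cvgrPdist_lt _ _ _ F) => e e0.
have K0 : 0 < norm_basis_sum + 1 by rewrite ltr_wpDl// norm_basis_sum_ge0.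
have : \forall x \near F, `|u - f x| < e / (norm_basis_sum + 1).
  by move/(@cvgrPdist_lt _ _ _ F): fu; apply; rewrite divr_gt0.
apply: filterS => x hx; apply: (le_lt_trans (is_norm_dist u (f x))).
apply: (le_lt_trans (norm_le_mx_norm _)).
apply: (@le_lt_trans _ _ ((norm_basis_sum + 1) * `|u - f x|)).
  by rewrite ler_wpM2r// lerDl.
by rewrite mulrC -ltr_pdivlMr.
Qed.

Lemma continuous_is_norm : continuous N.
Proof. by move=> u; apply: (@cvg_is_norm _ (nbhs u) (@nbhs_filter _ u) id); exact: cvg_id. Qed.

(** On the unit sphere of the sup norm, [1 / N] is continuous and the sphere is compact, so it is
    bounded; homogeneity does the rest. The sphere is taken among row vectors, and transposition is
    an isometry. *)
Lemma entries_le_norm : exists2 C, 0 <= C & forall v i, `|v i 0| <= C * N v.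
Proof.
pose S := [set r : 'rV[R]_n.+1 | `|r| = 1].
have trle p q (M : 'M[R]_(p, q)) : `|M^T| <= `|M|.
  rewrite [leLHS]/Num.norm /= mx_normrE; apply/bigmax_leP; split=> // -[i j] _ /=.
  by rewrite mxE mx_norm_entry.
have trN (r : 'rV[R]_n.+1) : `|r^T| = `|r|.
  by apply/eqP; rewrite eq_le trle -{1}(trmxK r) trle.
have cS : compact S.
  apply: bounded_closed_compact.
    exists 1; split; first exact: num_real.
    by move=> M M1 r /= ->; exact: ltW.
  rewrite (_ : S = (fun r : 'rV[R]_n.+1 => `|r|) @^-1` [set x | x = 1])//.
  apply: preimage_closed; first by move=> r _; exact: norm_continuous.
  exact: closed_eq.
have ctr : continuous (fun r : 'rV[R]_n.+1 => r^T).
  move=> r; apply/(@cvgrPdist_lt _ _ _ (nbhs r) (@nbhs_filter _ r)) => e e0; near=> s.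
  by rewrite -linearB/= trN; near: s; apply: cvgr_dist_lt => //; exact: cvg_id.
have cN : {within S, continuous (fun r => (N r^T)^-1)}.
  apply: continuous_in_subspaceT => r /set_mem /= r1.
  apply: (@cvgV _ _ (nbhs r) (@nbhs_filter _ r)); last first.
    by apply: continuous_comp; [exact: ctr|exact: continuous_is_norm].
  apply/eqP => /(norm_eq0 normN) r0.
  have := oner_neq0 R; rewrite -r1 -trN r0 normr0 eqxx; by [].
have [B [_ hB]] := compact_bounded (continuous_compact cN cS).
(* [hB] gives a bound by every real strictly above [B], hence the [+ 1]. *)
exists (`|B| + 1) => [|v i]; first exact: addr_ge0.
have [->|v0] := eqVneq v 0; first by rewrite mxE normr0 is_norm0 mulr0.
have nv0 : 0 < `|v| by rewrite normr_gt0.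
pose r := (`|v|^-1 *: v)^T.
have rS : S r by rewrite /S/= -trN trmxK normrZ normfV normr_id mulVf ?gt_eqF.
have := hB (`|B| + 1) (le_lt_trans (ler_norm B) (ltr_pwDr ltr01 (lexx _))) (N r^T)^-1.
have -> : N r^T = `|v|^-1 * N v by rewrite /r trmxK (normZ normN) normfV normr_id.
have Nv : 0 < N v.
  rewrite lt0r (norm_ge0 normN) andbT; apply/eqP => /(norm_eq0 normN) /eqP.
  by rewrite (negbTE v0).
rewrite invfM invrK => H.
apply: (le_trans (mx_norm_entry v i 0)).
rewrite -ler_pdivrMr//; apply: le_trans (H _).
  by rewrite ger0_norm// divr_ge0// ltW.
exists r => //.
by rewrite /r trmxK (normZ normN) normfV normr_id invfM invrK.
Unshelve. all: by end_near.
Qed.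

(** [sup] has a default value on unbounded sets, so the set defining the induced norm is first shown
    bounded, by comparison with the entries. *)
Lemma norm_le_induced M v : N (M *m v) <= induced_norm N M * N v.
Proof.
have [C C0 hC] := entries_le_norm.
pose B := norm_basis_sum * (\sum_i \sum_j `|M i j| * C).
have B0 : 0 <= \sum_i \sum_j `|M i j| * C.
  by do 2![apply: sumr_ge0 => ? _]; rewrite mulr_ge0.
have ub w : N w <= 1 -> N (M *m w) <= B.
  move=> w1; apply: norm_le_entries => // i; rewrite mxE.
  apply: (le_trans (ler_norm_sum _ _ _)); apply: (@le_trans _ _ (\sum_j `|M i j| * C)).
    apply: ler_sum => j _; rewrite normrM ler_wpM2l// (le_trans (hC w j))//.
    by rewrite ler_piMr.
  rewrite [leRHS](bigD1 i)//= lerDl.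
  by do 2![apply: sumr_ge0 => ? _]; rewrite mulr_ge0.
have hs : has_sup [set N (M *m w) | w in [set w : 'cV[R]_n.+1 | N w <= 1]].
  split; first by exists (N (M *m 0)); exists 0 => //=; rewrite is_norm0.
  by exists B => _ [w /= w1 <-]; exact: ub.
have [->|v0] := eqVneq v 0; first by rewrite mulmx0 is_norm0 mulr0.
have Nv : 0 < N v.
  rewrite lt0r (norm_ge0 normN) andbT; apply/eqP => /(norm_eq0 normN) /eqP.
  by rewrite (negbTE v0).
rewrite -ler_pdivrMr//; apply: (ub_le_sup hs.2).
exists ((N v)^-1 *: v).
  by rewrite /= (normZ normN) normfV gtr0_norm// mulVf// gt_eqF.
by rewrite -scalemxAr (normZ normN) normfV gtr0_norm// mulrC.
Qed.

Lemma induced_norm_ge0 M : 0 <= induced_norm N M.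
Proof.
pose v : 'cV[R]_n.+1 := delta_mx 0 0.
have Nv : 0 < N v.
  rewrite lt0r (norm_ge0 normN) andbT; apply/eqP => /(norm_eq0 normN) /matrixP /(_ 0 0).
  by rewrite !mxE eqxx => /eqP; rewrite oner_eq0.
by rewrite -(pmulr_lge0 _ Nv) (le_trans (norm_ge0 normN _) (norm_le_induced M v)).
Qed.

Definition dot l v := \sum_i l i * v i 0.

Lemma dotD l u v : dot l (u + v) = dot l u + dot l v.
Proof. by rewrite /dot -big_split; apply: eq_bigr => i _; rewrite mxE mulrDr. Qed.

Lemma dotZ l a v : dot l (a *: v) = a * dot l v.
Proof. by rewrite /dot mulr_sumr; apply: eq_bigr => i _; rewrite mxE mulrCA. Qed.

Lemma dot_lin l m a v : dot (fun i => l i + a * m i) v = dot l v + a * dot m v.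
Proof.
by rewrite /dot mulr_sumr -big_split; apply: eq_bigr => i _ /=; rewrite mulrDl mulrA.
Qed.

Lemma dot_delta l i : dot l (delta_mx i 0) = l i.
Proof.
rewrite /dot (bigD1 i)//= big1 ?addr0 ?mxE ?eqxx ?mulr1// => j ji.
by rewrite mxE (negbTE ji) mulr0.
Qed.

(* One step of the Hahn-Banach extension: from the span [S] of [w] and the first [k] basis
   vectors to the span of [S] and [e]. *)
Let extend (S : set 'cV[R]_n.+1) l m e :
  S 0 -> (forall u v, S u -> S v -> S (u + v)) -> (forall a v, S v -> S (a *: v)) ->
  (forall v, S v -> dot l v <= N v) -> (forall v, S v -> dot m v = 0) -> dot m e = 1 ->
  exists l', (forall v, S v -> dot l' v = dot l v) /\
             (forall v a, S v -> dot l' (v + a *: e) <= N (v + a *: e)).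
Proof.
move=> S0 SD SZ lN mS me.
pose X := [set dot l u - N (u - e) | u in S].
have sep u v : S u -> S v -> dot l u - N (u - e) <= N (v + e) - dot l v.
  move=> Su Sv; rewrite lerBlDr addrAC lerBrDr -dotD (le_trans (lN _ (SD _ _ Su Sv)))//.
  have -> : u + v = (v + e) + (u - e) by rewrite addrACA subrr addr0 addrC.
  by rewrite norm_triangle.
have hX : has_sup X.
  split; first by exists (dot l 0 - N (0 - e)); exists 0.
  by exists (N (0 + e) - dot l 0) => _ [u Su <-]; exact: sep.
pose c := sup X.
have c1 u : S u -> dot l u - N (u - e) <= c.
  by move=> Su; apply: (ub_le_sup hX.2); exists u.
have c2 u : S u -> c <= N (u + e) - dot l u.
  by move=> Su; apply: ge_sup hX.1 _ => _ [v Sv <-]; exact: sep.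
exists (fun i => l i + (c - dot l e) * m i); split=> [v Sv|v a Sv].
  by rewrite dot_lin mS// mulr0 addr0.
rewrite dot_lin !dotD !dotZ mS// me add0r mulr1.
have -> : dot l v + a * dot l e + (c - dot l e) * a = dot l v + a * c by ring.
have [a0|a0|->] := ltgtP a 0; last by rewrite mul0r scale0r !addr0 lN.
- have b0 : 0 < - a by rewrite oppr_gt0.
  have := c1 _ (SZ (- a)^-1 v Sv); rewrite dotZ.
  have -> : v + a *: e = (- a) *: ((- a)^-1 *: v - e).
    by rewrite scalerBr scalerA mulfV ?gt_eqF// scale1r scaleNr opprK.
  rewrite (normZ normN) (gtr0_norm b0) => h.
  have := ler_wpM2l (ltW b0) h; rewrite mulrBr mulrA mulfV ?gt_eqF// mul1r; lra.
- have := c2 _ (SZ a^-1 v Sv); rewrite dotZ.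
  have -> : v + a *: e = a *: (a^-1 *: v + e).
    by rewrite scalerDr scalerA mulfV ?gt_eqF// scale1r.
  rewrite (normZ normN) (gtr0_norm a0) => h.
  have := ler_wpM2l (ltW a0) h; rewrite mulrBr mulrA mulfV ?gt_eqF// mul1r; lra.
Qed.

(** Induction on [k] over [S k], the span of [w] and the first [k] basis vectors, encoded by the
    entries from [k] on being those of a multiple of [w]. [S 0] is the line of [w], where the value
    at [w] decides; the last stage is the whole space, where [- v] gives the lower bound. *)
Lemma norming_functional w : exists2 l, dot l w = N w & forall v, `|dot l v| <= N v.
Proof.
pose S k v := exists r, forall i : 'I_n.+1, (k <= i)%N -> v i 0 = r * w i 0.
have S0 k : S k 0 by exists 0 => i _; rewrite mxE mul0r.
have SD k u v : S k u -> S k v -> S k (u + v).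
  by move=> [r hr] [s hs]; exists (r + s) => i ki; rewrite mxE hr// hs// mulrDl.
have SZ k a v : S k v -> S k (a *: v).
  by move=> [r hr]; exists (a * r) => i ki; rewrite mxE hr// mulrA.
suff H k : (k <= n.+1)%N -> exists2 l, dot l w = N w & forall v, S k v -> dot l v <= N v.
  have [l lw lN] := H n.+1 (leqnn _); exists l => // v.
  have Sn u : S n.+1 u by exists 0 => i; rewrite leqNgt ltn_ord.
  rewrite ler_norml lN// andbT lerNl -is_normN -mulN1r -dotZ scaleN1r.
  exact: lN.
elim: k => [_|k ih kn].
  have [w0|w0] := eqVneq w 0.
    exists (fun=> 0) => [|v _].
      by rewrite w0 is_norm0 /dot big1// => i _; rewrite mul0r.
    by rewrite /dot big1 ?(norm_ge0 normN)// => i _; rewrite mul0r.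
  have [i wi] : exists i, w i 0 != 0.
    apply: contrapT => h; move/negP: w0; apply; apply/eqP/matrixP => i j.
    by rewrite ord1 mxE; apply/eqP/negPn/negP => wi; apply: h; exists i.
  exists (fun j => (N w / w i 0) * (j == i)%:R).
    rewrite /dot (bigD1 i)//= big1 ?addr0 ?eqxx ?mulr1 ?divfK// => j ji.
    by rewrite (negbTE ji) mulr0 mul0r.
  move=> v [r hr]; have -> : v = r *: w by apply/matrixP => j p; rewrite ord1 mxE hr.
  rewrite dotZ (normZ normN) /dot (bigD1 i)//= big1 ?addr0 ?eqxx ?mulr1 ?divfK//; last first.
    by move=> j ji; rewrite (negbTE ji) mulr0 mul0r.
  by apply: ler_wpM2r; [exact: norm_ge0|exact: ler_norm].
have [l lw lN] := ih (ltnW kn).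
pose k' := Ordinal kn; pose e : 'cV[R]_n.+1 := delta_mx k' 0.
have decomp v : S k.+1 v -> exists2 a, S k (v - a *: e) & True.
  move=> [r hr]; exists (v k' 0 - r * w k' 0) => //; exists r => i ki; rewrite !mxE.
  have [->|ik] := eqVneq i k'; first by rewrite eqxx mulr1 opprB addrC subrK.
  by rewrite mulr0 subr0 hr// ltn_neqAle ki andbT eq_sym; apply: contra ik => /eqP ik; apply/eqP/val_inj.
have [Se|nSe] := pselect (S k e).
  exists l => // v /decomp[a Sv _]; rewrite -(subrK (a *: e) v); apply: lN.
  by apply: SD => //; exact: SZ.
(* The extension needs a functional that vanishes on [S k] and is [1] at [e]. It is the coordinate
   [k], corrected when [w] does not vanish there by a later coordinate where [w] does not vanish;
   one exists because [e] is outside [S k]. *)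
have [m mS me] : exists2 m, (forall v, S k v -> dot m v = 0) & dot m e = 1.
  have [wk|wk] := eqVneq (w k' 0) 0.
    exists (fun i => (i == k')%:R); last by rewrite dot_delta eqxx.
    move=> v [r hr]; rewrite /dot (bigD1 k')//= big1 ?addr0.
      by rewrite hr// wk !mulr0.
    by move=> i ik; rewrite (negbTE ik) mul0r.
  have [i [ki wi]] : exists i : 'I_n.+1, (k < i)%N /\ w i 0 != 0.
    apply: contrapT => h; apply: nSe; exists (w k' 0)^-1 => i ki; rewrite mxE eqxx andbT.
    have [->|ik] := eqVneq i k'; first by rewrite mulVf.
    have [->|wi] := eqVneq (w i 0) 0; first by rewrite mulr0.
    exfalso; apply: h; exists i; split=> //.
    by rewrite ltn_neqAle ki andbT eq_sym; apply: contra ik => /eqP ik; apply/eqP/val_inj.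
  have ik : i != k' by apply: contraTneq ki => ->; rewrite ltnn.
  exists (fun j => (j == k')%:R + (- (w k' 0 / w i 0)) * (j == i)%:R).
    move=> v [r hr]; rewrite dot_lin /dot (bigD1 k')//= big1 ?addr0; last first.
      by move=> j jk; rewrite (negbTE jk) mul0r.
    rewrite (bigD1 i)//= big1 ?addr0 ?eqxx; last first.
      by move=> j jk; rewrite (negbTE jk) mul0r.
    rewrite !mul1r !hr//; last exact: ltnW.
    by rewrite mulNr mulrCA -mulrA mulVf// mulr1 subrr.
  by rewrite dot_delta eqxx eq_sym (negbTE ik) mulr0 addr0.
have [l' [l'S l'N]] := extend (S0 k) (@SD k) (@SZ k) lN mS me.
exists l'; first by rewrite l'S//; exists 1 => i _; rewrite mul1r.
by move=> v /decomp[a Sv _]; rewrite -(subrK (a *: e) v); exact: l'N.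
Qed.

End FiniteDimensionalNorm.

(** * Limits and derivatives entry by entry *)

Section MatrixLimits.
Context {R : realType}.

Lemma cvg_mx_entries (p q : nat) (T : Type) (F : set_system T) {FF : Filter F}
    (f : T -> 'M[R]_(p, q)) (L : 'M[R]_(p, q)) :
  (forall i j, f x i j @[x --> F] --> L i j) -> f x @[x --> F] --> L.
Proof.
move=> h; apply/(@cvgrPdist_lt _ _ _ F) => e e0.
have H : \forall x \near F, forall ij : 'I_p * 'I_q, `|L ij.1 ij.2 - f x ij.1 ij.2| < e.
  by apply: filter_forall => -[i j] /=; move: (h i j) => /cvgrPdist_lt /(_ e e0).
apply: filterS H => x hx; rewrite [ltLHS]/Num.norm /= mx_normrE.
by apply/bigmax_ltP; split=> // ij _; rewrite !mxE.
Qed.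

Lemma cvg_entry (p q : nat) (T : Type) (F : set_system T) {FF : Filter F}
    (f : T -> 'M[R]_(p, q)) (L : 'M[R]_(p, q)) i j :
  f x @[x --> F] --> L -> f x i j @[x --> F] --> L i j.
Proof. move=> fL; exact: (cvg_comp f (fun M : 'M[R]_(p, q) => M i j) fL (@coord_continuous _ _ _ i j L)). Qed.

Lemma is_derive_entry (p q : nat) (f : R -> 'M[R]_(p, q)) (t : R) d i j :
  is_derive t 1 f d -> is_derive t 1 (fun s => f s i j) (d i j).
Proof.
move=> [fd fE].
have c : h^-1 *: (f (h *: 1 + t) - f t) @[h --> 0^'] --> d by rewrite -fE; exact: fd.
have ce : h^-1 *: (f (h *: 1 + t) i j - f t i j) @[h --> 0^'] --> d i j.
  rewrite (_ : (fun h : R => _) = fun h => (h^-1 *: (f (h *: 1 + t) - f t)) i j).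
    exact: cvg_entry.
  by apply/funext => h; rewrite !mxE.
by apply: DeriveDef; [apply/cvg_ex; exists (d i j)|apply: cvg_lim].
Qed.

Lemma continuous_entry_within (p q : nat) (f : R -> 'M[R]_(p, q)) (D : set R) i j :
  {within D, continuous f} -> {within D, continuous (fun t => f t i j)}.
Proof.
move=> cf t.
exact: (cvg_comp _ (fun M : 'M[R]_(p, q) => M i j) (cf t) (@coord_continuous _ _ _ i j (f t))).
Qed.

(** The matrix limit is only meaningful once convergence is known; it is assembled from the
    convergent scalar series of the entries. *)
Lemma mittag_lefflerE (alpha u : R) (n : nat) (A : 'M[R]_n.+1) i j : 0 < alpha ->
  mittag_leffler alpha alpha (u *: A) i j = ps (mcoef alpha alpha (mxpow A i j)) u.
Proof.
move=> alpha_gt0.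
suff -> : mittag_leffler alpha alpha (u *: A) =
    \matrix_(i, j) ps (mcoef alpha alpha (mxpow A i j)) u by rewrite mxE.
apply: cvg_lim; first exact: norm_hausdorff.
apply: cvg_mx_entries => k l; rewrite mxE.
have := @entire_cvg _ _ u (entire_mcoef alpha_gt0 alpha_gt0 (geo_mxpow A k l)).
rewrite /ps; apply: cvg_trans; apply: near_eq_cvg; apply: nearW => m /=.
rewrite /pseries /series /= summxE; apply: eq_bigr => e _.
by rewrite exprZn !mxE /mcoef /mxpow; ring.
Qed.

End MatrixLimits.

(** * Weighted estimate of one convolution with the resolvent *)

Section Forcing.
Context {R : realType}.
Context (alpha : R) (alpha_gt0 : 0 < alpha) (alpha_lt1 : alpha < 1).
Context (n : nat) (A : 'M[R]_n.+1) (specA : spectrum A `<=` Lambda alpha).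
Context (N : 'cV[R]_n.+1 -> R) (normN : is_norm N).
Implicit Types (h : 'I_n.+1 -> R -> R) (l : 'I_n.+1 -> R).

Let e i j := resolvent alpha A i j.
Let E s := mittag_leffler alpha alpha (s `^ alpha *: A).

Lemma resolvent_gt0 i j t : 0 < t -> resolvent alpha A i j t = t `^ (alpha - 1) * E t i j.
Proof. by move=> t0; rewrite /resolvent /mser (pk_gt0 _ t0) /E mittag_lefflerE. Qed.

Lemma resolvent_le_pk : exists2 C, 0 <= C &
  forall i j t, `|resolvent alpha A i j t| <= C * pk alpha t.
Proof.
have [C C0 hC] := resolvent_bound alpha_gt0 alpha_lt1 specA; exists C => // i j t.
have [t0|t0] := leP t 0.
  by rewrite (W_le0 (W_resolvent alpha_gt0 A i j) t0) normr0 (pk_le0 _ t0) mulr0.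
rewrite /resolvent /mser normrM (ger0_norm (pk_ge0 _ _)) mulrC.
by apply: ler_wpM2r; [exact: pk_ge0|exact: hC].
Qed.

Lemma dual_coef_le l i : (forall v, `|dot l v| <= N v) -> `|l i| <= N (delta_mx i 0).
Proof. by move=> lN; rewrite -(dot_delta l i). Qed.

(** Here [t - x >= t / 2], the exponent is negative, and [2^(1-alpha) <= 2]. *)
Let pk_half t x : 2 <= t -> 0 < x <= 1 -> pk alpha (t - x) <= 2 * t `^ (alpha - 1).
Proof.
move=> t2 /andP[x0 x1]; have t0 : 0 < t by apply: lt_le_trans t2.
have tx : t / 2 <= t - x by lra.
have th : 0 < t / 2 by rewrite divr_gt0.
rewrite (pk_gt0 _ (lt_le_trans th tx)).
have s0 : 0 <= 1 - alpha by rewrite subr_ge0 ltW.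
have E1 : (t - x) `^ (alpha - 1) <= (t / 2) `^ (alpha - 1).
  rewrite -(opprB 1) !powRN lef_pV2 ?posrE ?powR_gt0 ?(lt_le_trans th tx)//.
  by rewrite ge0_ler_powR ?nnegrE// ltW// (lt_le_trans th tx).
apply: (le_trans E1); rewrite powRM ?invr_ge0 ?(ltW t0)// mulrC ler_wpM2r ?powR_ge0//.
rewrite -powR_inv1// -powRrM.
have -> : -1 * (alpha - 1) = 1 - alpha by ring.
rewrite -[leRHS]powRr1// ler_powR ?ler1n//; have := alpha_gt0; lra.
Qed.

(** The weighted contribution of []0, 1]] is at most this for every [t >= 2]; the [2] is that of the
    preceding kernel estimate, and [C] bounds the resolvent against [pk alpha]. *)
Definition near_mass (C : R) h : R :=
  \sum_i N (delta_mx i 0) * \sum_j 2 * C * \int[mu]_(x in `]0, 1]) `|h j x|.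

(** The weight [w] and the factor [M] are separate so that one estimate serves both [Q x], with [M]
    a bound for the solution, and [g], with [M = 1]. Comparison with [M * w] is asked for on []1,
    t[] only, where such an [M] will be available. *)
Lemma forcing_bound h l C M q (w : R -> R) t : 0 < M -> 2 <= t ->
  (forall j, W alpha (h j)) -> (forall v, `|dot l v| <= N v) -> 0 <= C ->
  (forall i j t, `|e i j t| <= C * pk alpha t) ->
  (forall x, 0 < x -> 0 <= w x) ->
  (forall x, 1 < x < t -> N (E (t - x) *m \col_j h j x) <= M * w x) ->
  ((t `^ (1 - alpha))%:E *
    \int[mu]_(x in `]0%R, t[) ((t - x) `^ (alpha - 1) * w x)%:E <= q%:E)%E ->
  t `^ (1 - alpha) * `|\sum_i l i * \sum_j conv (e i j) (h j) t| <= near_mass C h + M * q.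
Proof.
move=> M0 t2 Wh lN C0 eC w0 hw hq.
have t0 : 0 < t by apply: lt_le_trans t2.
have t1 : 1 < t by apply: lt_le_trans t2; rewrite ltr1n.
pose G i j x := e i j (t - x) * h j x.
have IG i j : mu.-integrable setT (EFin \o G i j).
  exact: W_conv_integrable alpha_gt0 alpha_gt0 (W_resolvent alpha_gt0 A i j) (Wh j).
pose F x := \sum_i l i * (\sum_j 1 * G i j x).
have IGs i : mu.-integrable setT (EFin \o (fun x => \sum_j 1 * G i j x)).
  exact: integrable_lsum.
have IF : mu.-integrable setT (EFin \o F) by exact: integrable_lsum.
have FE : \int[mu]_x F x = \sum_i l i * \sum_j conv (e i j) (h j) t.
  rewrite Rintegral_lsum//; apply: eq_bigr => i _; rewrite Rintegral_lsum//.
  by congr (_ * _); apply: eq_bigr => j _; rewrite mul1r.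
have F0 x : ~~ (0 < x < t) -> F x = 0.
  rewrite negb_and -!leNgt => /orP[x0|tx].
    rewrite /F big1// => i _; rewrite big1 ?mulr0// => j _.
    by rewrite /G (W_le0 (Wh j) x0) !mulr0.
  rewrite /F big1// => i _; rewrite big1 ?mulr0// => j _.
  have tx0 : t - x <= 0 by rewrite subr_le0.
  by rewrite /G /e (W_le0 (W_resolvent alpha_gt0 A i j) tx0) mul0r mulr0.
have sub (i : interval R) : mu.-integrable [set` i] (EFin \o F).
  by apply: integrableS IF => //; exact: measurable_itv.
have split1 : \int[mu]_x F x = \int[mu]_(x in `]0, 1]) F x + \int[mu]_(x in `]1, t[) F x.
  have -> : \int[mu]_x F x = \int[mu]_(x in `]0, t[) F x.
    rewrite [RHS]Rintegral_mkcond; apply: eq_Rintegral => x _.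
    rewrite patchE mem_setE in_itv/=; case: ifPn => // /F0 //.
  have := @Rintegral_itvB R F (BRight 0) (BLeft t) 1 (sub _).
  by rewrite !bnd_simp => /(_ ler01 t1) <-; rewrite addrC subrK.
have near : `|\int[mu]_(x in `]0, 1]) F x| <= t `^ (alpha - 1) * near_mass C h.
  have m01 : measurable (`]0, 1]%classic : set (measurableTypeR R)) by exact: measurable_itv.
  have IG1 i j : mu.-integrable `]0, 1] (EFin \o G i j).
    by apply: integrableS (IG i j) => //; exact: measurable_itv.
  have IGs1 i : mu.-integrable `]0, 1] (EFin \o (fun x => \sum_j 1 * G i j x)).
    by apply: integrableS (IGs i) => //; exact: measurable_itv.
  rewrite Rintegral_lsum// (le_trans (ler_norm_sum _ _ _))//.
  rewrite /near_mass mulr_sumr; apply: ler_sum => i _.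
  rewrite normrM mulrCA; apply: ler_pM => //; first exact: dual_coef_le.
  rewrite Rintegral_lsum// (le_trans (ler_norm_sum _ _ _))//.
  rewrite mulr_sumr; apply: ler_sum => j _; rewrite mul1r.
  apply: (le_trans (le_normr_Rintegral m01 (IG1 i j))).
  have Ih : mu.-integrable `]0, 1] (EFin \o (fun x => `|h j x|)).
    have I1 := W_conv_integrable 2 ltr01 alpha_gt0 (W_pk 1) (W_abs (Wh j)).
    have : mu.-integrable `]0, 1] (EFin \o (fun x => pk 1 (2 - x) * `|h j x|)).
      by apply: integrableS I1 => //; exact: measurable_itv.
    apply: eq_integrable => // x; rewrite inE/= in_itv/= => /andP[x0 x1].
    have x2 : 0 < 2 - x by lra.
    by rewrite (pk_gt0 _ x2) subrr powRr0 mul1r.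
  rewrite mulrA -RintegralZl//; apply: le_Rintegral => //.
  - exact: integrable_norm.
  - exact: (integrableZl m01 _ Ih).
  - move=> x; rewrite /= in_itv/= => x01; rewrite normrM; apply: ler_wpM2r => //.
    apply: (le_trans (eC i j _)); have := pk_half t2 x01 => H.
    have := ler_wpM2l C0 H; set a := pk _ _; set b := _ `^ _; lra.
have far : t `^ (1 - alpha) * `|\int[mu]_(x in `]1, t[) F x| <= M * q.
  have mD : measurable (`]1, t[%classic : set (measurableTypeR R)) by exact: measurable_itv.
  (* The functional is applied to the whole vector [E (t - x) *m h x], so the norm of the product
     appears, as in the hypotheses of the theorem, and no separate bound on [E]. *)
  have FN x : 1 < x < t -> `|F x| <= M * ((t - x) `^ (alpha - 1) * w x).
    move=> x1t; have /andP[x1 xt] := x1t.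
    have tx : 0 < t - x by rewrite subr_gt0.
    have -> : F x = (t - x) `^ (alpha - 1) * dot l (E (t - x) *m \col_j h j x).
      rewrite /F /dot mulr_sumr; apply: eq_bigr => i _; rewrite mulrCA; congr (_ * _).
      rewrite mxE mulr_sumr; apply: eq_bigr => j _.
      by rewrite mul1r /G /e (resolvent_gt0 _ _ tx) mxE mulrA.
    rewrite normrM (ger0_norm (powR_ge0 _ _)) mulrCA; apply: ler_wpM2l; first exact: powR_ge0.
    exact: le_trans (lN _) (hw x x1t).
  have IA : mu.-integrable `]1, t[ (EFin \o (fun x => `|F x|)) by exact: integrable_norm.
  have s0 : 0 <= t `^ (1 - alpha) by exact: powR_ge0.
  apply: (@le_trans _ _ (t `^ (1 - alpha) * \int[mu]_(x in `]1, t[) `|F x|)).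
    by apply: ler_wpM2l => //; exact: le_normr_Rintegral.
  rewrite -ler_pdivrMl// mulrCA -RintegralZl// -lee_fin EFinM.
  apply: le_trans hq; apply: lee_wpmul2l; first by rewrite lee_fin.
  rewrite /Rintegral fineK; last first.
    by apply: integrable_fin_num => //; exact: (integrableZl mD _ IA).
  rewrite [leRHS]integral_mkcond [leLHS]integral_mkcond.
  apply: ge0_le_integral_nonmeas => x _; rewrite !patchE !mem_setE !in_itv/=.
    by case: ifP => // _; rewrite lee_fin mulr_ge0// invr_ge0 ltW.
  case: ifPn => [x1t|_].
    have /andP[x1 xt] := x1t; rewrite (lt_trans ltr01 x1) xt/= lee_fin.
    by rewrite mulrC ler_pdivrMr// mulrC; exact: FN.
  case: ifPn => // /andP[x0 xt]; rewrite lee_fin mulr_ge0 ?powR_ge0//.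
  exact: w0.
rewrite -FE split1.
apply: (@le_trans _ _ (t `^ (1 - alpha) * (`|\int[mu]_(x in `]0, 1]) F x| + `|\int[mu]_(x in `]1, t[) F x|))).
  by apply: ler_wpM2l; [exact: powR_ge0|exact: ler_normD].
rewrite mulrDr; apply: lerD => //.
have := ler_wpM2l (powR_ge0 t (1 - alpha)) near; rewrite mulrA.
rewrite -powRD ?(gt_eqF t0) ?implybT//.
have -> : 1 - alpha + (alpha - 1) = 0 by ring.
by rewrite powRr0 mul1r.
Qed.

End Forcing.

(** * Coefficients continuous on the closed half line *)

Section HalfLine.
Context {R : realType}.
Implicit Types (a t T : R) (f q : R -> R).

Lemma W_within f : {within `[(0 : R), +oo[, continuous f} -> W 1 (f \_ `]0, +oo[).
Proof.
move=> cf; split.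
  by apply: measurable_cut => t; exact: (within_continuous_gt0 (b := true)).
move=> T; have [C C0 hC] := within_bounded T cf; exists C => // t tT.
have [t0|t0] := leP t 0; first by rewrite cut_le0// normr0 mulr_ge0// pk_ge0.
by rewrite (cutE _ t0) (pk_gt0 _ t0) subrr powRr0 mulr1; apply: hC; rewrite t0.
Qed.

Lemma W_within_mul a q f : {within `[(0 : R), +oo[, continuous q} -> W a f ->
  W a (fun t => (q \_ `]0, +oo[) t * f t).
Proof.
move=> cq Wf; split.
  apply: measurable_funM; last exact: W_measurable Wf.
  by apply: measurable_cut => t; exact: (within_continuous_gt0 (b := true)).
move=> T; have [C C0 hC] := within_bounded T cq; have [D D0 hD] := Wf.2 T.
exists (C * D); first exact: mulr_ge0.
move=> t tT; have [t0|t0] := leP t 0.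
  by rewrite cut_le0// mul0r normr0 !mulr_ge0// pk_ge0.
by rewrite (cutE _ t0) normrM -mulrA; apply: ler_pM => //; [apply: hC; rewrite t0|exact: hD].
Qed.

End HalfLine.

(** * A priori bound for solutions *)

Section Attractivity.
Context {R : realType}.
Local Notation mu := (@lebesgue_measure R).
Context (alpha : R) (alpha_gt0 : 0 < alpha) (alpha_lt1 : alpha < 1).
Context (n : nat) (A : 'M[R]_n.+1) (specA : spectrum A `<=` Lambda alpha).
Context (N : 'cV[R]_n.+1 -> R) (normN : is_norm N).
Context (Q : R -> 'M[R]_n.+1) (g : R -> 'cV[R]_n.+1).
Hypothesis contQ : {within `[(0 : R), +oo[, continuous Q}.
Hypothesis contg : {within `[(0 : R), +oo[, continuous g}.
Context (q G : R) (q_lt1 : q < 1) (G_ge0 : 0 <= G).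
Let E s := mittag_leffler alpha alpha (s `^ alpha *: A).
Hypothesis boundQ : forall t, 0 < t -> ((t `^ (1 - alpha))%:E *
  \int[mu]_(x in `]0%R, t[) ((t - x) `^ (alpha - 1) * induced_norm N (E (t - x) *m Q x))%:E
  <= q%:E)%E.
Hypothesis boundg : forall t, 0 < t -> ((t `^ (1 - alpha))%:E *
  \int[mu]_(x in `]0%R, t[) ((t - x) `^ (alpha - 1) * N (E (t - x) *m g x))%:E <= G%:E)%E.
Context (x0 : 'cV[R]_n.+1) (phi : R -> 'cV[R]_n.+1).
Hypothesis sol : is_solution alpha A Q g x0 phi.

Let x i := (fun t => phi t i 0) \_ `]0, +oo[.
Let hQ j s := \sum_l ((fun t => Q t j l) \_ `]0, +oo[) s * x l s.
Let hg j := (fun t => g t j 0) \_ `]0, +oo[.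
Let h j s := hQ j s + hg j s.
Let e i j := resolvent alpha A i j.

Let continuous_phi i t : 0 < t -> {for t, continuous (fun s => phi s i 0)}.
Proof.
have [[cphi _] _ _] := sol => t0.
by apply: (within_continuous_gt0 (b := false)) t0; exact: continuous_entry_within.
Qed.

Let cvg_phi i : cvg (t `^ (1 - alpha) * phi t i 0 @[t --> 0^'+]).
Proof.
have [_ _ c] := sol; apply/cvg_ex; exists (x0 i 0).
rewrite (_ : (fun t => _) = fun t => (t `^ (1 - alpha) *: phi t) i 0); first exact: cvg_entry.
by apply/funext => t; rewrite mxE.
Qed.

Let W_x i : W alpha (x i).
Proof. by apply: W_weighted; [exact: continuous_phi|exact: cvg_phi]. Qed.

Let W_hQ j : W alpha (hQ j).
Proof. by apply: W_sum => l; apply: W_within_mul => //; exact: continuous_entry_within. Qed.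

Let W_hg j : W alpha (hg j).
Proof.
by apply: W_weaken (W_within _); [exact: ltW|exact: continuous_entry_within].
Qed.

Let W_h j : W alpha (h j). Proof. exact: W_add. Qed.

Let f i t := (A *m phi t + Q t *m phi t + g t) i 0.

Let f_cut i : f i \_ `]0, +oo[ = fun s => \sum_l A i l * x l s + h i s.
Proof.
apply/funext => s; have [s0|s0] := leP s 0.
  rewrite cut_le0// big1 => [|l _]; last by rewrite /x cut_le0// mulr0.
  by rewrite /h /hQ big1 => [|l _]; rewrite ?/hg ?/x ?cut_le0 ?mulr0 ?addr0.
rewrite (cutE _ s0) /f !mxE -addrA /h /hg (cutE _ s0); congr (_ + (_ + _)).
  by apply: eq_bigr => l _; rewrite /x (cutE _ s0).
by apply: eq_bigr => l _; rewrite /x !(cutE _ s0).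
Qed.

Let continuous_f i t : 0 < t -> {for t, continuous (f i)}.
Proof.
move=> t0; rewrite (_ : f i = fun s => (\sum_l A i l * phi s l 0 + \sum_l Q s i l * phi s l 0) + g s i 0); last first.
  by apply/funext => s; rewrite /f !mxE.
have cg : {for t, continuous (fun s => g s i 0)}.
  by apply: (within_continuous_gt0 (b := true)) t0; exact: continuous_entry_within.
have cQ l : {for t, continuous (fun s => Q s i l)}.
  by apply: (within_continuous_gt0 (b := true)) t0; exact: continuous_entry_within.
apply: cvgD => //; apply: cvgD.
  apply: cvg_big => [|l _]; first by apply: add_continuous.
  by apply: cvgM; [exact: cvg_cst|exact: continuous_phi].
apply: cvg_big => [|l _]; first by apply: add_continuous.
by apply: cvgM; [exact: cQ|exact: continuous_phi].
Qed.

Let beta_gt0 : 0 < 1 - alpha. Proof. by rewrite subr_gt0. Qed.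

(** The constant of integration, read off at [t = 1]. For boundedness it matters only that it is
    independent of [t]. *)
Let c i := conv (rlk (1 - alpha)) (x i) 1 - conv (pk 1) (f i \_ `]0, +oo[) 1.

Let x_eq i t : conv (rlk (1 - alpha)) (x i) t =
  c i * pk 1 t + conv (pk 1) (fun s => \sum_l A i l * x l s + h i s) t.
Proof.
have Wf : W alpha (f i \_ `]0, +oo[).
  by rewrite f_cut; apply: W_add => //; apply: W_sum => l; exact: W_scale.
rewrite -f_cut; have [t0|t0] := leP t 0.
  rewrite (W_le0 (W_conv beta_gt0 alpha_gt0 (W_rlk _) (W_x i)) t0).
  by rewrite (W_le0 (W_conv ltr01 alpha_gt0 (W_pk 1) Wf) t0) (pk_le0 _ t0) mulr0 addr0.
pose y s := RL_integral (1 - alpha) phi s i 0.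
have yE s : y s = conv (rlk (1 - alpha)) (x i) s.
  rewrite /y /RL_integral !mxE (convZl _ _ beta_gt0 alpha_gt0 (W_pk _) (W_x i)).
  by rewrite conv_pkE.
have dy (s : R) : 0 < s -> is_derive s 1 y (f i s).
  move=> s0; have [_ hs _] := sol; have := hs s s0; rewrite /is_RL_derivative => d.
  exact: is_derive_entry d.
have := volterra_integral t0 dy (@continuous_f i) Wf alpha_gt0.
by rewrite !yE (pk_gt0 _ t0) subrr powRr0 mulr1.
Qed.

Let variation_ae T : {ae mu, forall t, t < T -> forall i, x i t = variation alpha A h c i t}.
Proof.
have H i : {ae mu, forall t, t < T -> x i t + - variation alpha A h c i t = 0}.
  have Wv := W_variation alpha_gt0 A c W_h i.
  apply: (conv1_eq0_ae (a := alpha)) => //.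
    by apply: W_add => //; exact: W_opp.
  move=> t; rewrite (convDr _ ltr01 alpha_gt0 (W_pk 1) (W_x i) (W_opp Wv)).
  rewrite (conv_variation alpha_gt0 alpha_lt1 W_x W_h x_eq).
  rewrite (@eq_conv R (pk 1) (pk 1) (fun s => - variation alpha A h c i s)
    (fun s => -1 * variation alpha A h c i s)) //; last first.
    by move=> s; rewrite mulN1r.
  by rewrite (convZr _ _ ltr01 alpha_gt0 (W_pk 1) Wv) mulN1r subrr.
have FF := ae_filter_ringOfSetsType mu.
have := @filter_forall _ _ _ _ FF H.
apply: filterS => t ht tT i; apply/eqP; rewrite -subr_eq0; apply/eqP.
exact: ht.
Qed.

Let u t := t `^ (1 - alpha) * N (phi t).

Let u_ge0 t : 0 <= u t.
Proof. by rewrite mulr_ge0 ?powR_ge0//; exact: norm_ge0. Qed.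

(** [K] depends on neither [T] nor [M], so that [M] can later be a maximum of [u] itself. The
    exceptional null set is that of the variation of constants formula. *)
Let bound_ae : exists2 K, 0 <= K & forall T M, 0 < M ->
  (forall s, 1 < s < T -> N (phi s) <= M) ->
  {ae mu, forall t, 2 < t < T -> u t <= K + M * q}.
Proof.
have [C C0 eC] := resolvent_le_pk alpha_gt0 alpha_lt1 specA.
pose K0 := \sum_i N (delta_mx i 0) * \sum_j `|c j| * C.
have K00 : 0 <= K0.
  apply: sumr_ge0 => i _; apply: mulr_ge0; first exact: norm_ge0.
  by apply: sumr_ge0 => j _; exact: mulr_ge0.
have mass_ge0 k : 0 <= near_mass N C k.
  apply: sumr_ge0 => i _; apply: mulr_ge0; first exact: norm_ge0.
  by apply: sumr_ge0 => j _; rewrite !mulr_ge0// Rintegral_ge0.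
exists (K0 + near_mass N C hQ + (near_mass N C hg + 1 * G)).
  by rewrite mul1r !addr_ge0.
move=> T M M0 hM; have := variation_ae T; have FF := ae_filter_ringOfSetsType mu.
apply: filterS => t ht /andP[t2 tT].
have t0 : 0 < t by apply: lt_trans t2.
have [l lN lub] := norming_functional normN (phi t).
have phiE i : phi t i 0 = \sum_j (c j * e i j t + (conv (e i j) (hQ j) t + conv (e i j) (hg j) t)).
  have := ht tT i; rewrite /x (cutE _ t0) => ->; apply: eq_bigr => j _.
  by rewrite -(convDr _ alpha_gt0 alpha_gt0 (W_resolvent alpha_gt0 A i j) (W_hQ j) (W_hg j)).
pose Sc := \sum_i l i * \sum_j c j * e i j t.
pose SQ := \sum_i l i * \sum_j conv (e i j) (hQ j) t.
pose Sg := \sum_i l i * \sum_j conv (e i j) (hg j) t.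
have NE : N (phi t) = Sc + (SQ + Sg).
  rewrite -lN /dot /Sc /SQ /Sg -!big_split; apply: eq_bigr => i _ /=.
  by rewrite phiE !big_split/= !mulrDr.
have bQ : t `^ (1 - alpha) * `|SQ| <= near_mass N C hQ + M * q.
  apply: (forcing_bound alpha_gt0 alpha_lt1 M0 (ltW t2) W_hQ lub C0 eC _ _ (boundQ t0)).
    by move=> s _; exact: induced_norm_ge0.
  move=> s /andP[s1 st]; have s0 := lt_trans ltr01 s1.
  have -> : \col_j hQ j s = Q s *m phi s.
    apply/matrixP => i j; rewrite ord1 !mxE; apply: eq_bigr => k _.
    by rewrite /x !(cutE _ s0).
  rewrite mulmxA (le_trans (norm_le_induced normN _ _))// mulrC.
  apply: ler_wpM2r; first exact: induced_norm_ge0.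
  by apply: hM; rewrite s1 (lt_trans st).
have bg : t `^ (1 - alpha) * `|Sg| <= near_mass N C hg + 1 * G.
  apply: (forcing_bound alpha_gt0 alpha_lt1 ltr01 (ltW t2) W_hg lub C0 eC _ _ (boundg t0)).
    by move=> s _; exact: norm_ge0.
  move=> s /andP[s1 st]; have s0 := lt_trans ltr01 s1.
  have -> : \col_j hg j s = g s.
    by apply/matrixP => i j; rewrite ord1 !mxE /hg (cutE _ s0).
  by rewrite mul1r.
have s0 : 0 <= t `^ (1 - alpha) by exact: powR_ge0.
have bc : t `^ (1 - alpha) * `|Sc| <= K0.
  apply: (@le_trans _ _ (t `^ (1 - alpha) * (\sum_i N (delta_mx i 0) * \sum_j `|c j| * (C * pk alpha t)))).
    apply: ler_wpM2l => //; apply: (le_trans (ler_norm_sum _ _ _)); apply: ler_sum => i _.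
    rewrite normrM; apply: ler_pM => //; first exact: dual_coef_le.
    apply: (le_trans (ler_norm_sum _ _ _)); apply: ler_sum => j _.
    by rewrite normrM; apply: ler_wpM2l => //; exact: eC.
  rewrite le_eqVlt; apply/orP; left; apply/eqP; rewrite mulr_sumr; apply: eq_bigr => i _.
  rewrite mulrCA; congr (_ * _); rewrite mulr_sumr; apply: eq_bigr => j _.
  have P : t `^ (1 - alpha) * pk alpha t = 1.
    rewrite (pk_gt0 _ t0) -powRD ?(gt_eqF t0) ?implybT//.
    by rewrite (_ : _ + _ = 0) ?powRr0//; ring.
  by rewrite mulrCA (mulrCA _ C) P mulr1.
rewrite /u -[N (phi t)]ger0_norm ?(norm_ge0 normN)// NE.
apply: (@le_trans _ _ (t `^ (1 - alpha) * (`|Sc| + (`|SQ| + `|Sg|)))).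
  apply: ler_wpM2l => //; apply: (le_trans (ler_normD _ _)); rewrite lerD2l.
  exact: ler_normD.
rewrite !mulrDr; lra.
Qed.

Let continuous_u t : 0 < t -> {for t, continuous u}.
Proof.
move=> t0; have cphi : phi s @[s --> t] --> phi t.
  by apply: cvg_mx_entries => i j; rewrite ord1; exact: continuous_phi.
have cN : N (phi s) @[s --> t] --> N (phi t).
  exact: (cvg_is_norm normN cphi).
by apply: cvgM => //; exact: continuous_powR_gt0.
Qed.

Let bound_near : exists2 B, 0 <= B & forall t, 0 < t <= 2 -> u t <= B.
Proof.
have [D D0 hD] : exists2 D, 0 <= D & forall i t, 0 < t <= 2 ->
    t `^ (1 - alpha) * `|phi t i 0| <= D.
  apply: (@uniform_bound R _ R (fun t => 0 < t <= 2)) => i.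
  by apply: weighted_bound; [exact: continuous_phi|exact: cvg_phi].
exists (norm_basis_sum N * D) => [|t t2].
  by apply: mulr_ge0 => //; exact: norm_basis_sum_ge0.
rewrite /u -(ger0_norm (powR_ge0 t (1 - alpha))) -(normZ normN).
apply: norm_le_entries => // i; rewrite mxE normrM (ger0_norm (powR_ge0 _ _)).
exact: hD.
Qed.

(** At a maximiser [m] of [u] on [[1, t]] the bound reads [u m <= K + q * u m]; it can be solved for
    [u m] as [q < 1], with a result that does not involve [t]. *)
Lemma solution_bounded : exists2 B, 0 <= B &
  forall t, 0 < t -> t `^ (1 - alpha) * N (phi t) <= B.
Proof.
have [B B0 hB] := bound_near; have [K K0 hK] := bound_ae.
have q1 : 0 < 1 - q by rewrite subr_gt0.
(* The terms answer the three cases for the maximiser: [u m <= 1], [m <= 2], and the remaining one,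
   where [q * u m] is absorbed. *)
pose D := 1 + B + K / (1 - q).
have KD : 0 <= K / (1 - q) by rewrite divr_ge0// ltW.
exists D; first by rewrite !addr_ge0.
move=> t t0; rewrite -/(u t); have [t2|t2] := leP t 2.
  apply: (le_trans (hB t _)); first by rewrite t0.
  by rewrite /D; lra.
have cu : {within `[1, t], continuous u}.
  apply: continuous_in_subspaceT => s /set_mem/=; rewrite in_itv/= => /andP[s1 _].
  by apply: continuous_u; apply: lt_le_trans s1.
have t1 : 1 <= t by lra.
have [m mt hm] := EVT_max t1 cu.
suff mD : u m <= D.
  by apply: le_trans mD; apply: hm; rewrite in_itv/= t1 lexx.
have [m1|m1] := leP (u m) 1; first by rewrite /D; lra.
have [m2|m2] := leP m 2.
  apply: (le_trans (hB m _)); last by rewrite /D; lra.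
  by rewrite m2 andbT; move: mt; rewrite in_itv/= => /andP[? _]; lra.
have um0 : 0 < u m by apply: lt_trans m1.
(* For [s >= 1] the weight is at least [1], so the plain norm is below [u s]; hence the left end [1]
   of the interval. *)
have hs s : 1 < s < t -> N (phi s) <= u m.
  move=> /andP[s1 st]; apply: (@le_trans _ _ (u s)).
    rewrite /u ler_peMl//; first exact: norm_ge0.
    rewrite -[leLHS](powRr0 s) ler_powR//; first exact: ltW.
    exact: ltW.
  by apply: hm; rewrite in_itv/= !ltW.
(* Continuity of [u] carries the almost everywhere bound to the single point [m], which may be the
   end point [t]. *)
have H : u m <= K + u m * q.
  apply: (ae_le_continuous t2 _ _ (hK t (u m) um0 hs)).
    by move: mt; rewrite in_itv/= => /andP[_ ->]; rewrite ltW.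
  by apply: continuous_u; apply: lt_trans m2.
have : u m <= K / (1 - q) by rewrite ler_pdivlMr//; lra.
by rewrite /D; lra.
Qed.

End Attractivity.

Lemma ereal_sup_fin_bound {R : realType} (S : set (\bar R)) :
  (forall x, S x -> 0 <= x)%E -> S !=set0 -> (ereal_sup S < +oo)%E ->
  exists2 q : R, 0 <= q & ereal_sup S = q%:E.
Proof.
move=> S0 [x Sx] fin.
have ge0 : (0 <= ereal_sup S)%E by apply: le_trans (S0 x Sx) _; exact: ereal_sup_ubound.
exists (fine (ereal_sup S)); first exact: fine_ge0.
by rewrite fineK// ge0_fin_numE.
Qed.



Unset Implicit Arguments.
Set Strict Implicit.
Set Printing Implicit Defensive.

Theorem theorem4p2 (R : realType) (alpha : R) (s : nat)
    (N : 'cV[R]_s -> R) (A : 'M[R]_s)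
    (Q : R -> 'M[R]_s) (g : R -> 'cV[R]_s)
    (alpha_gt0 : 0 < alpha) (alpha_lt1 : alpha < 1)
    (s_ge1 : (1 <= s)%N)
    (normN : is_norm N)
    (contQ : {within `[(0 : R), +oo[, continuous Q})
    (contg : {within `[(0 : R), +oo[, continuous g})
    (specA : spectrum A `<=` Lambda alpha)
    (supQ : (ereal_sup
       [set (t `^ (1 - alpha))%:E *
            \int[lebesgue_measure]_(tau in `]0%R, t[)
              ((t - tau) `^ (alpha - 1) *
               induced_norm N
                 (mittag_leffler alpha alpha ((t - tau) `^ alpha *: A)
                    *m Q tau))%:E
       | t in `]0%R, +oo[] < 1)%E)
    (supg : (ereal_sup
       [set (t `^ (1 - alpha))%:E *
            \int[lebesgue_measure]_(tau in `]0%R, t[)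
              ((t - tau) `^ (alpha - 1) *
               N (mittag_leffler alpha alpha ((t - tau) `^ alpha *: A)
                    *m g tau))%:E
       | t in `]0%R, +oo[] < +oo)%E) :
  (forall (x0 : 'cV[R]_s) (phi : R -> 'cV[R]_s),
     is_solution alpha A Q g x0 phi -> C_weighted_bounded N alpha phi)
  /\ globally_attractive alpha A Q g.
Proof.
case: s N A Q g s_ge1 normN contQ contg specA supQ supg => // n N A Q g _ normN contQ contg specA supQ supg.
have s0 t : 0 <= t `^ (1 - alpha) by exact: powR_ge0.
have [q q_lt1 hq] : exists2 q : R, q < 1 & forall t, 0 < t ->
    ((t `^ (1 - alpha))%:E * \int[lebesgue_measure]_(x in `]0%R, t[)
      ((t - x) `^ (alpha - 1) * induced_norm N
        (mittag_leffler alpha alpha ((t - x) `^ alpha *: A) *m Q x))%:E <= q%:E)%E.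
  have [||q _ hq] := ereal_sup_fin_bound _ _ (lt_le_trans supQ (leey _)).
  - move=> _ [t _ <-]; apply: mule_ge0; first by rewrite lee_fin.
    by apply: integral_ge0 => x _; rewrite lee_fin mulr_ge0 ?powR_ge0 ?induced_norm_ge0.
  - by eexists; exists 1; [rewrite /= in_itv/= ltr01|reflexivity].
  exists q; first by move: supQ; rewrite hq lte_fin.
  by move=> t t0; rewrite -hq; apply: ereal_sup_ubound; exists t; rewrite //= in_itv/= t0.
have [||G G_ge0 hG] := ereal_sup_fin_bound _ _ supg.
- move=> _ [t _ <-]; apply: mule_ge0; first by rewrite lee_fin.
  by apply: integral_ge0 => x _; rewrite lee_fin mulr_ge0 ?powR_ge0// (norm_ge0 normN).
- by eexists; exists 1; [rewrite /= in_itv/= ltr01|reflexivity].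
have hg t : 0 < t -> ((t `^ (1 - alpha))%:E * \int[lebesgue_measure]_(x in `]0%R, t[)
    ((t - x) `^ (alpha - 1) * N (mittag_leffler alpha alpha ((t - x) `^ alpha *: A) *m g x))%:E
    <= G%:E)%E.
  by move=> t0; rewrite -hG; apply: ereal_sup_ubound; exists t; rewrite //= in_itv/= t0.
have bnd x0 x (sol : is_solution alpha A Q g x0 x) :=
  solution_bounded alpha_gt0 alpha_lt1 specA normN contQ contg q_lt1 G_ge0 hq hg sol.
split=> [x0 phi sol|x0 x sol]; have [B B0 hB] := bnd _ _ sol.
  split; first by have [] := sol.
  apply: (@le_lt_trans _ _ B%:E); last exact: ltry.
  apply: ge_ereal_sup => _ [t /= t0 <-]; rewrite lee_fin; apply: hB.
  by move: t0; rewrite in_itv/= andbT.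
have [C C0 hC] := entries_le_norm normN.
apply: cvg_mx_entries => i j; rewrite ord1 mxE; apply/cvgrPdist_lt => e e0.
(* With this [D], [C * B < D * e], so the weighted bound [B] forces every entry below [e] as soon as
   [t ^ (1 - alpha) >= D]. *)
pose D := C * B / e + 1; have D0 : 0 < D by rewrite ltr_wpDl// divr_ge0 ?mulr_ge0// ltW.
have a0 : 0 < 1 - alpha by rewrite subr_gt0.
near=> t; have t0 : 0 < t by near: t; exact: nbhs_pinfty_gt.
have tD : D <= t `^ (1 - alpha).
  have -> : D = (D `^ (1 - alpha)^-1) `^ (1 - alpha).
    by rewrite -powRrM mulVf ?gt_eqF// powRr1// ltW.
  by rewrite ge0_ler_powR ?nnegrE ?powR_ge0 ?(ltW t0) ?(ltW a0)//.
have p0 : 0 < t `^ (1 - alpha) by rewrite powR_gt0.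
rewrite sub0r normrN; apply: (le_lt_trans (hC (x t) i)).
rewrite -(ltr_pM2l p0) mulrCA; apply: (@le_lt_trans _ _ (C * B)).
  by apply: ler_wpM2l => //; exact: hB.
apply: (@lt_le_trans _ _ (D * e)); last by rewrite ler_wpM2r// ltW.
by rewrite /D mulrDl divfK ?gt_eqF// mul1r ltrDl.
Unshelve. all: by end_near.
Qed.
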